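(* Let $z\ge 1$ be a constant. There is an algorithm that, for every $\epsilon>0$, computes a $(1+\epsilon)$-approximate solution for Robust $(k,z)$-Clustering in metrics of doubling dimension $d$ in time $f(k,d,\epsilon,z)\,\mathrm{poly}(m,n)$, where $$f(k,d,\epsilon,z)=\left(\left(\frac{2^z}{\epsilon}\right)^{d}k\log k\right)^{O(k)} .$$
   Context: Robust $(k,z)$-Clustering (for a constant $z\ge 1$): the input consists of a set $P$ of $n=|P|$ points (clients), a set $F$ of candidate centers (facilities), a metric $\delta$ on $P\cup F$, a positive integer $k$, a weight function $w:P\to\mathbb{R}_{+}$, and $m$ groups $S_1,\dots,S_m\subseteq P$ with $P=\bigcup_{i\in[m]}S_i$. The goal is to output a $k$-element subset $X\subseteq F$ minimizing $\max_{i\in[m]}\sum_{p\in S_i}w(p)\,\delta(p,X)^z$, where $\delta(p,X)=\min_{x\in X}\delta(p,x)$. A $(1+\epsilon)$-approximate solution is a feasible set $X$ whose objective value is at most $(1+\epsilon)$ times the minimum. The metric has doubling dimension $d$ if every ball of radius $r$ can be covered by at most $2^{O(d)}$ balls of radius $r/2$. Standing assumption: the weight aspect ratio $\frac{\max_{p\in P}w(p)}{\min_{p'\in P}w(p')}$ and the distance aspect ratio $\frac{\max_{p,p'\in P}\delta(p,p')}{\min_{p\ne p'\in P}\delta(p,p')}$ are bounded by a polynomial in $n$.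
   Formalization: The time bound uses max(1, log k) for log k and min(1, ε) for ε, since literally f is 0 at k = 1 and tends to 0 for large ε; the polynomial factor is in m, n and |F|, since all candidate centers must be inspected. *)

(* Defs.v *)
From mathcomp Require Import all_boot all_order all_algebra.
From mathcomp Require Import reals exp.

Set Implicit Arguments.
Unset Strict Implicit.
Unset Printing Implicit Defensive.

Import Order.TTheory GRing.Theory Num.Theory.
Local Open Scope ring_scope.

(* Both are used only for nonnegative [f].  Starting the iterated minimum from
   the maximum makes [minover A f] the true minimum whenever [A] is nonempty;
   both are 0 on the empty set. *)
Definition maxover (R : realType) (T : finType) (A : {set T}) (f : T -> R) : R :=
  \big[Num.max/0]_(x in A) f x.
Definition minover (R : realType) (T : finType) (A : {set T}) (f : T -> R) : R :=
  \big[Num.min/maxover A f]_(x in A) f x.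

(* The points of P \cup F are numbered 0, ..., npts - 1; a point may be both a
   client and a facility. *)
Record clustering_input (R : realType) := ClusteringInput {
  npts : nat;
  ngroups : nat;
  clients : {set 'I_npts};
  facilities : {set 'I_npts};
  delta : 'I_npts -> 'I_npts -> R;
  weight : 'I_npts -> R;            (* meaningful on [clients] only *)
  group : 'I_ngroups -> {set 'I_npts};
  ncenters : nat }.

Definition is_metric (R : realType) (T : Type) (dist : T -> T -> R) : Prop :=
  [/\ forall x y, dist x y = 0 <-> x = y,
      forall x y, dist x y = dist y x &
      forall x y u, dist x u <= dist x y + dist y u].

Definition valid_input (R : realType) (I : clustering_input R) : Prop :=
  [/\ clients I :|: facilities I = [set: 'I_(npts I)],
      is_metric (@delta R I),
      forall p, p \in clients I -> 0 < weight p,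
      \bigcup_(i < ngroups I) group i = clients I &
      (0 < ncenters I <= #|facilities I|)%N].

Definition weight_aspect_ratio (R : realType) (I : clustering_input R) : R :=
  maxover (clients I) (@weight R I) / minover (clients I) (@weight R I).

(* With a single client the minimum ranges over no pair and the ratio is
   0 / 0 = 0. *)
Definition distance_aspect_ratio (R : realType) (I : clustering_input R) : R :=
  let P := clients I in
  maxover (setX P P) (fun e => @delta R I e.1 e.2) /
  minover [set e in setX P P | e.1 != e.2] (fun e => @delta R I e.1 e.2).

(* [c] is the constant hidden in the bound 2^{O(d)}. *)
Definition has_doubling_dimension (R : realType) (I : clustering_input R)
    (c d : R) : Prop :=
  forall (x : 'I_(npts I)) (r : R), 0 < r ->
    exists Y : {set 'I_(npts I)},
      #|Y|%:R <= 2 `^ (c * d) /\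
      forall y, delta x y <= r -> exists2 u, u \in Y & delta u y <= r / 2.

Definition dist_to_set (R : realType) (I : clustering_input R)
    (X : {set 'I_(npts I)}) (p : 'I_(npts I)) : R :=
  minover X (fun x => delta p x).

Definition robust_cost (R : realType) (I : clustering_input R) (z : R)
    (X : {set 'I_(npts I)}) : R :=
  maxover [set: 'I_(ngroups I)]
    (fun i => \sum_(p in group i) weight p * dist_to_set X p `^ z).

Definition feasible (R : realType) (I : clustering_input R)
    (X : {set 'I_(npts I)}) : Prop :=
  X \subset facilities I /\ #|X| = ncenters I.

Definition approx_solution (R : realType) (I : clustering_input R) (z eps : R)
    (X : {set 'I_(npts I)}) : Prop :=
  feasible X /\
  forall Y : {set 'I_(npts I)}, feasible Y ->
    robust_cost z X <= (1 + eps) * robust_cost z Y.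

(* The model of computation is a real RAM with structured control: one memory
   of natural numbers and one of reals, both indirectly addressable by naturals,
   and random access to the input.  On naturals it has only addition and
   truncated subtraction, so that at unit cost t steps build numbers of O(t)
   bits.  On reals it has the field operations and x |-> x^z, comparisons, and
   no rounding to integers.  Programs contain no real constants besides 1. *)
Inductive nexp : Type :=
| NConst of nat
| NMem of nexp
| NAdd of nexp & nexp
| NSub of nexp & nexp
| NPoints
| NGroups
| NCenters
| NIsClient of nexp
| NIsFacility of nexp
| NInGroup of nexp & nexp.          (* group, point *)

Inductive rexp : Type :=
| ROne
| RMem of nexp
| RAdd of rexp & rexp
| RSub of rexp & rexp
| RMul of rexp & rexp
| RDiv of rexp & rexp
| RPowZ of rexp
| RZ
| REps
| RDelta of nexp & nexp
| RWeight of nexp.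

Inductive test : Type :=
| TNatLt of nexp & nexp
| TRealLe of rexp & rexp
| TNot of test.

Inductive program : Type :=
| PSkip
| PSetNat of nexp & nexp            (* address, value *)
| PSetReal of nexp & rexp           (* address, value *)
| PSeq of program & program
| PIf of test & program & program
| PWhile of test & program.

Record state (R : realType) := State { nmem : nat -> nat; rmem : nat -> R }.

Definition init_state (R : realType) : state R :=
  State (fun=> 0%N) (fun=> 0 : R).

Definition upd (T : Type) (f : nat -> T) (a : nat) (v : T) : nat -> T :=
  fun b => if b == a then v else f b.

(* Input accesses with an index out of range return the default value. *)
Definition at_index (n : nat) (T : Type) (dflt : T) (f : 'I_n -> T) (a : nat) : T :=
  oapp f dflt (insub a).

Fixpoint neval (R : realType) (I : clustering_input R) (s : state R)
    (e : nexp) : nat :=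
  match e with
  | NConst a => a
  | NMem a => nmem s (neval I s a)
  | NAdd a b => (neval I s a + neval I s b)%N
  | NSub a b => (neval I s a - neval I s b)%N
  | NPoints => npts I
  | NGroups => ngroups I
  | NCenters => ncenters I
  | NIsClient a =>
      nat_of_bool (at_index false (fun p => p \in clients I) (neval I s a))
  | NIsFacility a =>
      nat_of_bool (at_index false (fun p => p \in facilities I) (neval I s a))
  | NInGroup i a =>
      nat_of_bool
        (at_index false
           (fun j => at_index false (fun p => p \in @group R I j) (neval I s a))
           (neval I s i))
  end.

Fixpoint reval (R : realType) (I : clustering_input R) (z eps : R)
    (s : state R) (e : rexp) : R :=
  match e with
  | ROne => 1
  | RMem a => rmem s (neval I s a)
  | RAdd a b => reval I z eps s a + reval I z eps s b
  | RSub a b => reval I z eps s a - reval I z eps s b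
  | RMul a b => reval I z eps s a * reval I z eps s b
  | RDiv a b => reval I z eps s a / reval I z eps s b
  | RPowZ a => reval I z eps s a `^ z
  | RZ => z
  | REps => eps
  | RDelta a b =>
      at_index 0 (fun x => at_index 0 (fun y => @delta R I x y) (neval I s b))
        (neval I s a)
  | RWeight a => at_index 0 (@weight R I) (neval I s a)
  end.

Fixpoint teval (R : realType) (I : clustering_input R) (z eps : R)
    (s : state R) (b : test) : bool :=
  match b with
  | TNatLt a a' => (neval I s a < neval I s a')%N
  | TRealLe a a' => reval I z eps s a <= reval I z eps s a'
  | TNot b' => ~~ teval I z eps s b'
  end.

(* [exec I z eps p s s' t]: on input (I, z, eps), program [p] started in state
   [s] halts in state [s'] after [t] steps.  Each assignment and each evaluation
   of a test is one step; the size of the expressions is bounded by a constant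
   depending on the program only. *)
Inductive exec (R : realType) (I : clustering_input R) (z eps : R) :
    program -> state R -> state R -> nat -> Prop :=
| ExecSkip s : exec I z eps PSkip s s 0
| ExecSetNat a e s :
    exec I z eps (PSetNat a e) s
      (State (upd (nmem s) (neval I s a) (neval I s e)) (rmem s)) 1
| ExecSetReal a e s :
    exec I z eps (PSetReal a e) s
      (State (nmem s) (upd (rmem s) (neval I s a) (reval I z eps s e))) 1
| ExecSeq p p' s s' s'' t t' :
    exec I z eps p s s' t -> exec I z eps p' s' s'' t' ->
    exec I z eps (PSeq p p') s s'' (t + t')
| ExecIfTrue b p p' s s' t :
    teval I z eps s b -> exec I z eps p s s' t ->
    exec I z eps (PIf b p p') s s' t.+1
| ExecIfFalse b p p' s s' t :
    ~~ teval I z eps s b -> exec I z eps p' s s' t ->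
    exec I z eps (PIf b p p') s s' t.+1
| ExecWhileFalse b p s :
    ~~ teval I z eps s b -> exec I z eps (PWhile b p) s s 1
| ExecWhileTrue b p s s' s'' t t' :
    teval I z eps s b -> exec I z eps p s s' t ->
    exec I z eps (PWhile b p) s' s'' t' ->
    exec I z eps (PWhile b p) s s'' (t + t').+1.

Definition output_set (R : realType) (n : nat) (s : state R) : {set 'I_n} :=
  [set x : 'I_n | nmem s x != 0%N].

(* ((2^z / eps)^d k log k)^{O(k)}, where [C] is the constant hidden in O(k).
   The untruncated expression vanishes for k = 1 and tends to 0 as eps grows,
   hence the truncations of log k and eps at 1. *)
Definition f_bound (R : realType) (C k : nat) (d eps z : R) : R :=
  ((2 `^ z / Num.min 1 eps) `^ d * k%:R * Num.max 1 (ln k%:R)) ^+ (C * k).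

(* Main.v *)
(* A set [A] with [robust_cost A <= 4 OPT] and O(k z log n log m) centers is found
   greedily: as long as the largest group cost exceeds 4 OPT, one of the k optimal
   centers decreases the total cost of the groups above half of it by a factor
   1 - 1/(2k), and a phase that brings all groups below the threshold halves the
   largest cost.  Moving an optimal center o by at most e d(o, A) costs at most
   O(e 4^z (OPT + cost A)), so the centers may be taken in a net [N] of the facilities
   whose resolution is proportional to the distance to [A].  The doubling dimension
   and the aspect ratios bound the size of [N] by k polylog(n, m) (2^z / eps)^O(d),
   and all k-tuples of points of [N] are tried.  The logarithms are harmless because
   l^k <= k^k 2^l. *)

Require Import Defs.
From mathcomp Require Import all_boot all_order all_algebra.
From mathcomp Require classical_sets.
From mathcomp Require Import interval_inference convex hoelder.
From mathcomp Require Import reals exp.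
From mathcomp Require Import zify ring lra.

Set Implicit Arguments.
Unset Strict Implicit.
Unset Printing Implicit Defensive.

Import Order.TTheory GRing.Theory Num.Theory.
Local Open Scope ring_scope.

(** * A language with bounded loops *)

(** The program knows neither the optimum nor the quantities of the analysis ([c], [d], the aspect
    ratios, the number of additions per phase), so each of its tests compares computable values. In
    place of the optimum it uses bounds V <= OPT <= U with U <= (8 n Q^2)^z V, where n is the number
    of clients and Q bounds both aspect ratios. The logarithm of this ratio bounds the number of
    greedy phases and enters the number of annuli that the net has to fill. The greedy loop stops
    when no single facility gains enough; that the cost is then at most 4 OPT is the contrapositive
    of the averaging argument. V is also the smallest scale of the net: with W the total weight, a
    displacement x with W (x / e)^z <= V is always accepted, so the annuli need not shrink towards A
    forever. The case V = 0 is harmless, since then U = 0. Running times are read off a language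
    whose loops are bounded by input sizes; only the enumeration of the tuples, whose number is not
    polynomial, is a genuine while loop. *)

Definition ndouble (e : nexp) : nexp := NAdd e e.

(* Below address [npts] the natural memory holds the output.  From there on, the
   two memories are split into 32 interleaved arrays; a scalar is entry 0. *)
Definition cell_exp (v : nat) (i : nexp) : nexp :=
  NAdd (NConst v) (ndouble (ndouble (ndouble (ndouble (ndouble i))))).
Definition nat_addr (v : nat) (i : nexp) : nexp := NAdd NPoints (cell_exp v i).

Definition NArr (v : nat) (i : nexp) : nexp := NMem (nat_addr v i).
Definition RArr (v : nat) (i : nexp) : rexp := RMem (cell_exp v i).
Definition NVar (v : nat) : nexp := NArr v (NConst 0).
Definition RVar (v : nat) : rexp := RArr v (NConst 0).

Inductive bound := AllPoints | AllGroups | AllCenters.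

Definition bound_exp (b : bound) : nexp :=
  match b with AllPoints => NPoints | AllGroups => NGroups | AllCenters => NCenters end.

(* [Block c] behaves as [c]; no rewriting rule enters it. *)
Inductive cmd : Type :=
| Skip
| SetN of nat & nexp & nexp
| SetR of nat & nexp & rexp
| Mark of nexp
| Seq of cmd & cmd
| If of test & cmd & cmd
| For of nat & bound & cmd
| Block of cmd.

Fixpoint compile (c : cmd) : program :=
  match c with
  | Skip => PSkip
  | SetN v i e => PSetNat (nat_addr v i) e
  | SetR v i e => PSetReal (cell_exp v i) e
  | Mark x => PIf (TNatLt x NPoints) (PSetNat x (NConst 1)) PSkip
  | Seq a b => PSeq (compile a) (compile b)
  | If t a b => PIf t (compile a) (compile b)
  | For v b c =>
      PSeq (PSetNat (nat_addr v (NConst 0)) (NConst 0))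
        (PWhile (TNatLt (NVar v) (bound_exp b))
           (PSeq (compile c)
              (PSetNat (nat_addr v (NConst 0)) (NAdd (NVar v) (NConst 1)))))
  | Block a => compile a
  end.

(** A computable sufficient condition for [c] not to write the natural array [v]. The bounds by 32
    are what [cell_inj] requires; [Mark] is exempt because it writes only below [npts]. *)
Fixpoint nfree (v : nat) (c : cmd) : bool :=
  match c with
  | SetN w _ _ => [&& (v < 32)%N, (w < 32)%N & v != w]
  | Seq a b | If _ a b => nfree v a && nfree v b
  | For w _ a => [&& (v < 32)%N, (w < 32)%N, v != w & nfree v a]
  | Block a => nfree v a
  | _ => true
  end.

Fixpoint rfree (v : nat) (c : cmd) : bool :=
  match c with
  | SetR w _ _ => [&& (v < 32)%N, (w < 32)%N & v != w]
  | Seq a b | If _ a b => rfree v a && rfree v b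
  | For _ _ a => rfree v a
  | Block a => rfree v a
  | _ => true
  end.

Fixpoint markfree (c : cmd) : bool :=
  match c with
  | Mark _ => false
  | Seq a b | If _ a b => markfree a && markfree b
  | For _ _ a => markfree a
  | Block a => markfree a
  | _ => true
  end.

(** A body that leaves its own counter alone makes the loop run exactly as often as its bound
    says. *)
Fixpoint wf_loops (c : cmd) : bool :=
  match c with
  | Seq a b | If _ a b => wf_loops a && wf_loops b
  | For v _ a => [&& (v < 32)%N, nfree v a & wf_loops a]
  | Block a => wf_loops a
  | _ => true
  end.

Fixpoint time_bound (B : nat) (c : cmd) : nat :=
  match c with
  | Skip => 0
  | SetN _ _ _ | SetR _ _ _ => 1
  | Mark _ => 2
  | Seq a b => time_bound B a + time_bound B b
  | If _ a b => (time_bound B a + time_bound B b).+1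
  | For _ _ a => (B * (time_bound B a + 2)).+2
  | Block a => time_bound B a
  end%N.

Lemma time_bound_poly c :
  exists K e, forall B, (0 < B)%N -> (time_bound B c <= K * B ^ e)%N.
Proof.
have seq_poly (a b : cmd) K e K' e' :
    (forall B, (0 < B)%N -> (time_bound B a <= K * B ^ e)%N) ->
    (forall B, (0 < B)%N -> (time_bound B b <= K' * B ^ e')%N) ->
    forall B, (0 < B)%N ->
    ((time_bound B a + time_bound B b).+1 <= (K + K').+1 * B ^ (e + e'))%N.
  move=> Ha Hb B B0; have := Ha B B0; have := Hb B B0.
  rewrite expnD; have : (0 < B ^ e)%N by rewrite expn_gt0 B0.
  have : (0 < B ^ e')%N by rewrite expn_gt0 B0.
  move: (B ^ e)%N (B ^ e')%N => x y x0 y0 ? ?; nia.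
elim: c => [|v i e|v i e|x|a [K [e Ha]] b [K' [e' Hb]]|t a [K [e Ha]] b [K' [e' Hb]]
  |v b c [K [e Hc]]|a IHa] //=.
- by exists 0%N, 0%N.
- by exists 1%N, 0%N.
- by exists 1%N, 0%N.
- by exists 2%N, 0%N.
- exists (K + K').+1, (e + e')%N => B B0; exact: ltnW (seq_poly _ _ _ _ _ _ Ha Hb B B0).
- exists (K + K').+1, (e + e')%N; exact: seq_poly.
- exists (K + 4)%N, e.+1 => B B0; have := Hc B B0; rewrite expnS.
  have : (0 < B ^ e)%N by rewrite expn_gt0 B0.
  move: (B ^ e)%N => x x0 ?; nia.
Qed.

(** * State-transformer semantics of commands and its agreement with execution *)

Section Semantics.
Variables (R : realType) (I : clustering_input R) (z eps : R).
Implicit Types (s : state R) (c : cmd).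

(** This is [v + 32 i], written with the doublings of [cell_exp] so that addresses evaluate to it by
    conversion. *)
Definition cell (v i : nat) : nat :=
  (v + (let a := i + i in let b := a + a in let c := b + b in let d := c + c in
        d + d))%N.

Lemma cell_inj v i w j : (v < 32)%N -> (w < 32)%N ->
  (cell v i == cell w j) = (v == w) && (i == j).
Proof.
move=> hv hw; rewrite /cell /=; apply/eqP/andP => [E|[/eqP -> /eqP ->] //].
by split; apply/eqP; lia.
Qed.

Definition nv s (v i : nat) : nat := nmem s (npts I + cell v i).
Definition rv s (v i : nat) : R := rmem s (cell v i).
Definition setn (v i x : nat) s : state R :=
  State (upd (nmem s) (npts I + cell v i)%N x) (rmem s).
Definition setr (v i : nat) (x : R) s : state R :=
  State (nmem s) (upd (rmem s) (cell v i) x).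
Definition mark (x : nat) s : state R :=
  if (x < npts I)%N then State (upd (nmem s) x 1%N) (rmem s) else s.
Arguments cell : simpl never.
Arguments nv : simpl never.
Arguments rv : simpl never.
Arguments setn : simpl never.
Arguments setr : simpl never.
Arguments mark : simpl never.

Lemma nv_setn v i x s w j : (w < 32)%N -> (v < 32)%N ->
  nv (setn v i x s) w j = if (w == v) && (j == i) then x else nv s w j.
Proof. by move=> hw hv; rewrite /nv /setn /= /upd eqn_add2l cell_inj. Qed.
Lemma nv_setr v i x s w j : nv (setr v i x s) w j = nv s w j. Proof. by []. Qed.
Lemma rv_setn v i x s w j : rv (setn v i x s) w j = rv s w j. Proof. by []. Qed.
Lemma rv_setr v i x s w j : (w < 32)%N -> (v < 32)%N ->
  rv (setr v i x s) w j = if (w == v) && (j == i) then x else rv s w j.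
Proof. by move=> hw hv; rewrite /rv /setr /= /upd cell_inj. Qed.
Lemma nv_mark x s w j : nv (mark x s) w j = nv s w j.
Proof.
rewrite /mark; case: ifP => // hx; rewrite /nv /= /upd.
by case: eqP => // E; lia.
Qed.
Lemma rv_mark x s w j : rv (mark x s) w j = rv s w j.
Proof. by rewrite /mark; case: ifP. Qed.
Lemma nmem_setn v i x s a : (a < npts I)%N -> nmem (setn v i x s) a = nmem s a.
Proof. by move=> ha; rewrite /setn /= /upd; case: eqP => // E; lia. Qed.
Lemma nmem_mark x s a : (a < npts I)%N ->
  nmem (mark x s) a = if a == x then 1%N else nmem s a.
Proof.
rewrite /mark => ha; case: ifP => //= hx.
by case: eqP => // E; rewrite -E ha in hx.
Qed.

Definition bound_val (b : bound) : nat :=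
  match b with AllPoints => npts I | AllGroups => ngroups I | AllCenters => ncenters I end.

(** A total function is possible because every loop is bounded. The counter is reread from memory,
    as in the compiled loop; it agrees with the number of iterations once [nfree v c] holds. *)
Fixpoint den (c : cmd) (s : state R) : state R :=
  match c with
  | Skip => s
  | SetN v i e => setn v (neval I s i) (neval I s e) s
  | SetR v i e => setr v (neval I s i) (reval I z eps s e) s
  | Mark x => mark (neval I s x) s
  | Seq a b => den b (den a s)
  | If t a b => if teval I z eps s t then den a s else den b s
  | For v b c =>
      iter (bound_val b) (fun s => let s' := den c s in setn v 0 (nv s' v 0).+1 s')
        (setn v 0 0 s)
  | Block a => den a s
  end.

(** The three frame lemmas reduce the question of what a command preserves to computing a boolean,
    so the later specifications settle it by [//]. *)
Lemma nv_den_free c v i s : nfree v c -> nv (den c s) v i = nv s v i.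
Proof.
elim: c s => [|w a e|w a e|x|a IHa b IHb|t a IHa b IHb|w b c IHc|a IHa] s //=.
- by case/and3P=> h h' hne; rewrite nv_setn // (negbTE hne).
- by rewrite nv_mark.
- by case/andP=> ha hb; rewrite IHb ?IHa.
- by case/andP=> ha hb; case: ifP => _; rewrite ?IHb ?IHa.
- case/and4P=> h h' hne hc.
  elim: (bound_val b) => [|n IHn] /=; first by rewrite nv_setn // (negbTE hne).
  by rewrite nv_setn // (negbTE hne) /= IHc.
- exact: IHa.
Qed.

Lemma rv_den_free c v i s : rfree v c -> rv (den c s) v i = rv s v i.
Proof.
elim: c s => [|w a e|w a e|x|a IHa b IHb|t a IHa b IHb|w b c IHc|a IHa] s //=.
- by case/and3P=> h h' hne; rewrite rv_setr // (negbTE hne).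
- by rewrite rv_mark.
- by case/andP=> ha hb; rewrite IHb ?IHa.
- by case/andP=> ha hb; case: ifP => _; rewrite ?IHb ?IHa.
- by move=> hc; elim: (bound_val b) => [|n IHn] //=; rewrite rv_setn IHc.
- exact: IHa.
Qed.

Lemma nmem_den_free c x s : markfree c -> (x < npts I)%N -> nmem (den c s) x = nmem s x.
Proof.
move=> + hx; elim: c s => [|w a e|w a e|y|a IHa b IHb|t a IHa b IHb|w b c IHc|a IHa] s //=.
- by move=> _; rewrite -[RHS](nmem_setn w (neval I s a) (neval I s e) s hx).
- by case/andP=> ha hb; rewrite IHb ?IHa.
- by case/andP=> ha hb; case: ifP => _; rewrite ?IHb ?IHa.
- move=> hc; elim: (bound_val b) => [|n IHn]; first exact: nmem_setn.
  rewrite iterS; set s' := iter _ _ _ in IHn *.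
  by rewrite nmem_setn // IHc.
- exact: IHa.
Qed.

Lemma den_Skip s : den Skip s = s. Proof. by []. Qed.
Lemma den_SetN v i e s : den (SetN v i e) s = setn v (neval I s i) (neval I s e) s.
Proof. by []. Qed.
Lemma den_SetR v i e s : den (SetR v i e) s = setr v (neval I s i) (reval I z eps s e) s.
Proof. by []. Qed.
Lemma den_Mark x s : den (Mark x) s = mark (neval I s x) s. Proof. by []. Qed.
Lemma den_Seq a b s : den (Seq a b) s = den b (den a s). Proof. by []. Qed.
Lemma den_If t a b s :
  den (If t a b) s = if teval I z eps s t then den a s else den b s.
Proof. by []. Qed.
Lemma den_Block c s : den (Block c) s = den c s. Proof. by []. Qed.
Lemma den_For v b c s :
  den (For v b c) s =
  iter (bound_val b) (fun s => let s' := den c s in setn v 0 (nv s' v 0).+1 s')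
    (setn v 0 0 s).
Proof. by []. Qed.

(** The step may assume that whatever the loop never writes still has its value from [s0];
    invariants then need to mention only what changes. *)
Definition loop_step (n : nat) (Inv : nat -> state R -> Prop) v b c s0 : Prop :=
  forall (x : 'I_n) s, nv s v 0 = x ->
    (forall w j, nfree w (For v b c) -> nv s w j = nv s0 w j) ->
    (forall w j, rfree w (For v b c) -> rv s w j = rv s0 w j) ->
    (markfree c -> forall y, (y < npts I)%N -> nmem s y = nmem s0 y) ->
    Inv x s -> Inv x.+1 (setn v 0 x.+1 (den c s)).

Lemma den_for_inv (Inv : nat -> state R -> Prop) v b c s0 :
  nfree v c -> (v < 32)%N -> Inv 0 (setn v 0 0 s0) ->
  loop_step (bound_val b) Inv v b c s0 -> Inv (bound_val b) (den (For v b c) s0).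
Proof.
move=> hv v32 H0 HS; rewrite den_For.
have : forall n, (n <= bound_val b)%N ->
    let s' := iter n (fun s => let s' := den c s in setn v 0 (nv s' v 0).+1 s')
      (setn v 0 0 s0) in
    [/\ nv s' v 0 = n,
     forall w j, nfree w (For v b c) -> nv s' w j = nv s0 w j,
     forall w j, rfree w (For v b c) -> rv s' w j = rv s0 w j,
     markfree c -> forall x, (x < npts I)%N -> nmem s' x = nmem s0 x & Inv n s'].
  elim=> [|n IHn] hn /=.
    split=> //; first by rewrite nv_setn // !eqxx.
      by move=> w j /and4P[w32 _ wv _]; rewrite nv_setn // (negbTE wv).
    by move=> _ x hx; rewrite -[RHS](nmem_setn v 0 0 s0 hx).
  have /= := IHn (ltnW hn); set s' := iter _ _ _ => -[E Hn Hr Hm HI].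
  rewrite nv_setn // !eqxx nv_den_free //= E; split=> //.
  - move=> w j hw; case/and4P: (hw) => w32 _ wv hw'.
    by rewrite nv_setn // (negbTE wv) /= nv_den_free // Hn.
  - by move=> w j hw; rewrite rv_setn rv_den_free // Hr.
  - move=> hm x hx; rewrite -[RHS](Hm hm x hx) -[RHS](nmem_den_free s' hm hx).
    exact: nmem_setn.
  - exact: (HS (Ordinal hn) s' E Hn Hr Hm HI).
by case/(_ _ (leqnn _)).
Qed.

Lemma den_for_points (Inv : nat -> state R -> Prop) v c s0 :
  nfree v c -> (v < 32)%N -> Inv 0 (setn v 0 0 s0) ->
  loop_step (npts I) Inv v AllPoints c s0 -> Inv (npts I) (den (For v AllPoints c) s0).
Proof. exact: (den_for_inv (b := AllPoints)). Qed.

Lemma den_for_groups (Inv : nat -> state R -> Prop) v c s0 :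
  nfree v c -> (v < 32)%N -> Inv 0 (setn v 0 0 s0) ->
  loop_step (ngroups I) Inv v AllGroups c s0 -> Inv (ngroups I) (den (For v AllGroups c) s0).
Proof. exact: (den_for_inv (b := AllGroups)). Qed.

Lemma den_for_centers (Inv : nat -> state R -> Prop) v c s0 :
  nfree v c -> (v < 32)%N -> Inv 0 (setn v 0 0 s0) ->
  loop_step (ncenters I) Inv v AllCenters c s0 -> Inv (ncenters I) (den (For v AllCenters c) s0).
Proof. exact: (den_for_inv (b := AllCenters)). Qed.

Lemma exec_for v b c s B t0 :
  nfree v c -> (v < 32)%N -> (bound_val b <= B)%N ->
  (forall s, exists t, exec I z eps (compile c) s (den c s) t /\ (t <= t0)%N) ->
  exists t, exec I z eps (compile (For v b c)) s (den (For v b c) s) t /\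
    (t <= (B * (t0 + 2)).+2)%N.
Proof.
move=> hv v32 hB Hc.
set step := fun s => let s' := den c s in setn v 0 (nv s' v 0).+1 s'.
have bE s' : neval I s' (bound_exp b) = bound_val b by case: (b).
(* [n] counts the iterations still to run, so the counter stands at [bound_val b - n]. *)
have loop n : forall s', nv s' v 0 = (bound_val b - n)%N -> (n <= bound_val b)%N ->
  exists t, exec I z eps (PWhile (TNatLt (NVar v) (bound_exp b))
           (PSeq (compile c)
              (PSetNat (nat_addr v (NConst 0)) (NAdd (NVar v) (NConst 1)))))
     s' (iter n step s') t /\ (t <= (n * (t0 + 2)).+1)%N.
  elim: n => [|n IHn] s' E hn.
    exists 1%N; split=> //; apply: ExecWhileFalse.
    by rewrite /= bE -[nmem _ _]/(nv s' v 0) E subn0 ltnn.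
  have E1 : nv (step s') v 0 = (bound_val b - n)%N.
    by rewrite /step nv_setn // !eqxx nv_den_free //= E; lia.
  have [t [Ht ht]] := IHn _ E1 (ltnW hn).
  have [t1 [Ht1 ht1]] := Hc s'.
  exists (t1 + 1 + t).+1; split; last by lia.
  rewrite iterSr; apply: (ExecWhileTrue (s' := step s')) Ht.
    by rewrite /= bE -[nmem _ _]/(nv s' v 0) E; lia.
  apply: ExecSeq Ht1 _.
  have -> : step s' = setn v 0 (neval I (den c s') (NAdd (NVar v) (NConst 1))) (den c s').
    by rewrite /step /= addn1.
  exact: ExecSetNat.
have [||t [Ht ht]] := loop (bound_val b) (setn v 0 0 s) => //.
  by rewrite nv_setn // !eqxx subnn.
exists (1 + t)%N; split; last by nia.
by apply: ExecSeq Ht; apply: ExecSetNat.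
Qed.

Lemma exec_compile B c s :
  (npts I <= B)%N -> (ngroups I <= B)%N -> (ncenters I <= B)%N -> wf_loops c ->
  exists t, exec I z eps (compile c) s (den c s) t /\ (t <= time_bound B c)%N.
Proof.
move=> hP hG hC.
elim: c s => [|v i e|v i e|x|a IHa b IHb|t a IHa b IHb|v b c IHc|a IHa] s.
- by exists 0%N; split=> //; apply: ExecSkip.
- by exists 1%N; split=> //; apply: ExecSetNat.
- by exists 1%N; split=> //; apply: ExecSetReal.
- move=> _ /=; rewrite /mark; case: ifP => hx.
    by exists 2%N; split=> //; apply: ExecIfTrue => //; apply: ExecSetNat.
  by exists 1%N; split=> //; apply: ExecIfFalse; [rewrite /= hx|apply: ExecSkip].
- case/andP=> /IHa Ha /IHb Hb.
  have [t1 [H1 h1]] := Ha s; have [t2 [H2 h2]] := Hb (den a s).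
  by exists (t1 + t2)%N; split; [apply: ExecSeq H1 H2|apply: leq_add].
- case/andP=> /IHa Ha /IHb Hb /=; case: ifP => ht.
    have [t1 [H1 h1]] := Ha s.
    by exists t1.+1; split; [apply: ExecIfTrue|lia].
  have [t1 [H1 h1]] := Hb s.
  by exists t1.+1; split; [apply: ExecIfFalse => //; rewrite ht|lia].
- case/and3P=> v32 hv /IHc Hc; apply: exec_for => //; by case: (b).
- exact: IHa.
Qed.

End Semantics.

Arguments cell : simpl never.
Arguments nv : simpl never.
Arguments rv : simpl never.
Arguments setn : simpl never.
Arguments setr : simpl never.
Arguments mark : simpl never.

Arguments den : simpl never.

(** * Clustering costs *)

Section Extrema.
Variables (R : realType) (T : finType).
Implicit Types (A : {set T}) (f : T -> R).

Lemma maxover_ge A f x : x \in A -> f x <= maxover A f.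
Proof. by move=> xA; apply: (@le_bigmax_cond _ _ _ _ x (mem A)). Qed.

Lemma maxover_ge0 A f : 0 <= maxover A f.
Proof. exact: bigmax_ge_id. Qed.

Lemma maxover_leP A f M :
  reflect (0 <= M /\ forall x, x \in A -> f x <= M) (maxover A f <= M).
Proof. exact: bigmax_leP. Qed.

Lemma minover_le A f x : x \in A -> minover A f <= f x.
Proof. by move=> xA; apply: (@bigmin_le_cond _ _ _ _ x (mem A)). Qed.

Lemma minover_ex A f : A != set0 -> exists2 x, x \in A & minover A f = f x.
Proof.
case/set0Pn=> x xA.
have [y yA E] := @eq_bigmin _ _ _ (maxover A f) x (mem A) f xA (fun y yA => maxover_ge f yA).
by exists y.
Qed.

End Extrema.

(** * Inequalities for powers with exponent at least 1 *)

Section RealPowers.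
Variable R : realType.
Implicit Types (a b e s z : R).

Lemma powR_le z a b : 1 <= z -> 0 <= a -> a <= b -> a `^ z <= b `^ z.
Proof.
move=> z1 a0 ab; apply: ge0_ler_powR => //; rewrite ?nnegrE ?(le_trans a0 ab) //.
exact: le_trans z1.
Qed.

Lemma powR_lt z a b : 1 <= z -> 0 <= a -> a < b -> a `^ z < b `^ z.
Proof.
move=> z1 a0 ab; apply: gt0_ltr_powR => //; rewrite ?nnegrE ?(le_trans a0 (ltW ab)) //.
exact: lt_le_trans z1.
Qed.

Lemma powR_le_cancel z a b : 1 <= z -> 0 <= b -> a `^ z <= b `^ z -> a <= b.
Proof.
move=> z1 b0; apply: contraTT; rewrite -!ltNge => ab; exact: powR_lt.
Qed.

(** The sum is at most twice the larger term. The loss of [2 ^ z] only enters the gap between the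
    two bounds on the optimum, which matters through its logarithm. *)
Lemma powR_addn z a b : 1 <= z -> 0 <= a -> 0 <= b ->
  (a + b) `^ z <= 2 `^ z * (a `^ z + b `^ z).
Proof.
move=> z1.
wlog ab : a b / a <= b.
  move=> H a0 b0; case: (leP a b) => ab; first exact: H.
  by rewrite addrC [a `^ z + _]addrC; apply: H => //; exact: ltW.
move=> a0 b0; rewrite (@le_trans _ _ ((2 * b) `^ z)) //.
  by apply: powR_le => //; lra.
by rewrite powRM // ler_wpM2l ?powR_ge0 // lerDr powR_ge0.
Qed.

(* Convexity: [a + e y = (1 - e) a + e (a + y)] with [y = a + b + s]. *)
Lemma powR_perturb z a b s e : 1 <= z -> 0 <= a -> 0 <= b -> 0 <= s -> 0 <= e <= 1 ->
  (a + e * (a + b + s)) `^ z <=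
  a `^ z + e * 4 `^ z * (a `^ z + b `^ z + s `^ z).
Proof.
move=> z1 a0 b0 s0 /andP[e0 e1].
pose t := Itv01 e0 e1.
pose y := a + (a + b + s).
have y0 : 0 <= y by rewrite /y; lra.
have h4 : y `^ z <= 4 `^ z * (a `^ z + b `^ z + s `^ z).
  (* [y = 2a + b + s] is at most four times the maximum, and the power of the maximum is one of the
     three summands: this is the origin of [4 ^ z]. *)
  pose m := Num.max a (Num.max b s).
  have m0 : 0 <= m by rewrite le_max a0.
  rewrite (@le_trans _ _ ((4 * m) `^ z)) //.
    apply: powR_le => //; rewrite /y.
    have : a <= m by rewrite le_max lexx.
    have : b <= m by rewrite !le_max lexx orbT.
    have : s <= m by rewrite !le_max lexx !orbT.
    by lra.
  rewrite powRM //; apply: ler_wpM2l; rewrite ?powR_ge0 //.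
  have := powR_ge0 a z; have := powR_ge0 b z; have := powR_ge0 s z.
  by rewrite /m /Num.max; case: ifP => _; [case: ifP => _|]; lra.
have H := @convex_powR R z z1 t y a.
rewrite !classical_sets.in_setE /= !in_itv /= !andbT in H.
move: (H y0 a0); rewrite !convRE /= /unstable.onem => {}H.
have -> : a + e * (a + b + s) = e * y + (1 - e) * a by rewrite /y; ring.
apply: le_trans H _.
have := ler_wpM2l e0 h4; have := mulr_ge0 e0 (powR_ge0 a z).
by rewrite mulrA; lra.
Qed.

End RealPowers.

(** * Metric facts and costs of center sets *)

Section Clustering.
Variables (R : realType) (I : clustering_input R) (z : R).
Hypotheses (valid : valid_input I) (z1 : 1 <= z).
Implicit Types (A X Y : {set 'I_(npts I)}) (p q x y f : 'I_(npts I)).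

Lemma delta_refl x : delta x x = 0.
Proof. by case: valid => _ [+ _ _] _ _ _ => /(_ x x) [_ ->]. Qed.

Lemma delta_sym x y : delta x y = delta y x.
Proof. by case: valid => _ [_ + _] _ _ _; apply. Qed.

Lemma delta_triangle x y u : delta x u <= delta x y + delta y u.
Proof. by case: valid => _ [_ _ +] _ _ _; apply. Qed.

Lemma delta_ge0 x y : 0 <= delta x y.
Proof.
have := delta_triangle x y x; rewrite delta_refl (delta_sym y x); lra.
Qed.

Lemma delta_eq0 x y : delta x y = 0 -> x = y.
Proof. by case: valid => _ [+ _ _] _ _ _ => /(_ x y) [+ _]. Qed.

Lemma delta_gt0 x y : x != y -> 0 < delta x y.
Proof.
by move=> xy; rewrite lt_neqAle delta_ge0 andbT eq_sym; apply: contra xy => /eqP/delta_eq0 ->.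
Qed.

Lemma weight_gt0 p : p \in clients I -> 0 < weight p.
Proof. by case: valid => _ _ + _ _; apply. Qed.

Lemma group_client i p : p \in @group R I i -> p \in clients I.
Proof. by case: valid => _ _ _ <- _ hp; apply/bigcupP; exists i. Qed.

Lemma client_group p : p \in clients I -> exists i, p \in @group R I i.
Proof. by case: valid => _ _ _ <- _ /bigcupP[i _ hp]; exists i. Qed.

Lemma dist_le X p x : x \in X -> dist_to_set X p <= delta p x.
Proof. exact: minover_le. Qed.

Lemma dist_ex X p : X != set0 -> exists2 x, x \in X & dist_to_set X p = delta p x.
Proof. exact: minover_ex. Qed.
Arguments dist_ex [X] p.

Lemma dist_ge0 X p : 0 <= dist_to_set X p.
Proof.
have [->|/(dist_ex p)[x _ ->]] := eqVneq X set0; last exact: delta_ge0.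
by rewrite /dist_to_set /minover big_set0 maxover_ge0.
Qed.

Lemma dist_anti A X p : A != set0 -> A \subset X -> dist_to_set X p <= dist_to_set A p.
Proof. by move=> /(dist_ex p)[x xA ->] /subsetP/(_ _ xA); exact: dist_le. Qed.

Lemma dist_set1 f p : dist_to_set [set f] p = delta p f.
Proof.
have [|x /set1P -> //] := dist_ex (X := [set f]) p.
by apply/set0Pn; exists f; rewrite set11.
Qed.

Lemma dist_setU1 A f p : A != set0 ->
  dist_to_set (f |: A) p = Num.min (dist_to_set A p) (delta p f).
Proof.
move=> A0; apply/eqP; rewrite eq_le; apply/andP; split.
  by rewrite le_min dist_anti ?subsetUr // dist_le // setU11.
have [|x] := dist_ex (X := f |: A) p; first by apply/set0Pn; exists f; rewrite setU11.
rewrite ge_min; case/setU1P => [->|xA] ->; first by rewrite lexx orbT.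
by rewrite dist_le.
Qed.

Lemma dist_triangle A p q : A != set0 -> dist_to_set A p <= delta p q + dist_to_set A q.
Proof.
move=> /(dist_ex q)[x xA ->]; apply: le_trans (dist_le p xA) _.
exact: delta_triangle.
Qed.

Definition group_cost A (i : 'I_(ngroups I)) : R :=
  \sum_(p in group i) weight p * dist_to_set A p `^ z.

Lemma group_cost_ge0 A i : 0 <= group_cost A i.
Proof.
by apply: sumr_ge0 => p /group_client/weight_gt0/ltW hp; rewrite mulr_ge0 ?powR_ge0.
Qed.

Lemma group_cost_le A i : group_cost A i <= robust_cost z A.
Proof. by apply: maxover_ge; rewrite inE. Qed.

Lemma robust_cost_le A M : 0 <= M -> (forall i, group_cost A i <= M) -> robust_cost z A <= M.
Proof. by move=> M0 H; apply/maxover_leP; split=> // i _; apply: H. Qed.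

Lemma robust_cost_ge0 A : 0 <= robust_cost z A.
Proof. exact: maxover_ge0. Qed.

Lemma group_cost_anti A X i : A != set0 -> A \subset X -> group_cost X i <= group_cost A i.
Proof.
move=> A0 AX; apply: ler_sum => p /group_client/weight_gt0/ltW hp.
by rewrite ler_wpM2l // powR_le ?dist_ge0 ?dist_anti.
Qed.

Lemma robust_cost_anti A X : A != set0 -> A \subset X -> robust_cost z X <= robust_cost z A.
Proof.
move=> A0 AX; apply: robust_cost_le; first exact: robust_cost_ge0.
by move=> i; apply: le_trans (group_cost_anti i A0 AX) (group_cost_le _ _).
Qed.

Lemma client_cost_le A p : p \in clients I ->
  weight p * dist_to_set A p `^ z <= robust_cost z A.
Proof.
case/client_group=> i hi; apply: le_trans (group_cost_le A i).
rewrite /group_cost (bigD1 p) //= lerDl; apply: sumr_ge0 => q /andP[+ _].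
by move=> /group_client/weight_gt0/ltW hq; rewrite mulr_ge0 ?powR_ge0.
Qed.

Lemma feasible_neq0 Y : feasible Y -> Y != set0.
Proof.
case=> _ hY; rewrite -card_gt0 hY; by case: valid => _ _ _ _ /andP[].
Qed.

(** Completing the at most [k] initial centers to a feasible set shows that the optimum does not
    exceed their cost. *)
Lemma extend_feasible A : A \subset facilities I -> (#|A| <= ncenters I)%N ->
  exists2 Y, feasible Y & A \subset Y.
Proof.
move=> AF hA; have hk : (ncenters I <= #|facilities I|)%N by case: valid => _ _ _ _ /andP[].
move E : (ncenters I - #|A|)%N => j; elim: j A AF hA E => [|j IHj] A AF hA E.
  by exists A => //; split=> //; apply/eqP; rewrite eqn_leq hA -subn_eq0 E.
have : A \proper facilities I.
  by rewrite properEcard AF; lia.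
case/properP=> _ [x xF xA].
have cA : #|x |: A| = #|A|.+1 by rewrite cardsU1 xA.
have [|||Y hY sY] := IHj (x |: A); rewrite ?cA; try lia.
  by rewrite subUset sub1set xF.
by exists Y => //; apply: subset_trans sY; apply: subsetUr.
Qed.

(** [u] is the inverse of the threshold on group costs; at [u = 0] no group is active. *)
Definition active (u : R) A (i : 'I_(ngroups I)) : bool := 1 < group_cost A i * u.
(** The groups are selected by [A] but priced under [X], so that the gain of a new center is
    measured on a fixed set of groups. *)
Definition active_cost (u : R) A X : R := \sum_(i | active u A i) group_cost X i.

(* Each client alone already accounts for the largest of the gains. *)
Lemma group_cost_union_gain A Y i : A != set0 -> Y != set0 ->
  group_cost A i - group_cost Y i <=
  \sum_(y in Y) (group_cost A i - group_cost (y |: A) i).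
Proof.
move=> A0 Y0; rewrite /group_cost -sumrB.
under [leRHS]eq_bigr do rewrite -sumrB.
rewrite exchange_big /=; apply: ler_sum => p /group_client/weight_gt0/ltW hp.
under [leRHS]eq_bigr do rewrite -mulrBr.
rewrite -mulrBr -mulr_sumr ler_wpM2l //.
have [y yY E] := dist_ex p Y0.
have gain x : 0 <= dist_to_set A p `^ z - dist_to_set (x |: A) p `^ z.
  by rewrite subr_ge0 powR_le ?dist_ge0 ?dist_anti ?subsetUr.
rewrite (bigD1 y) //= (@le_trans _ _ (dist_to_set A p `^ z - dist_to_set (y |: A) p `^ z)) //.
  rewrite lerD2l lerN2 powR_le ?dist_ge0 // dist_setU1 // E.
  by rewrite ge_min lexx orbT.
by rewrite lerDl sumr_ge0.
Qed.

(** Suppose the cost exceeds four times that of [Y]. Each active group is above half of the maximum,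
    so under [Y] it costs at most half of what it costs under [A]. Adding all of [Y] would then gain
    half of the active cost, and by averaging one of its [k] centers would gain a fraction
    [1 / (2k)], which the last hypothesis excludes. *)
Lemma greedy_stop A Y (u : R) : A != set0 -> feasible Y -> 0 < u ->
  1 < robust_cost z A * u <= 2 ->
  (forall f, f \in facilities I ->
     (2 * (ncenters I)%:R - 1) * active_cost u A A
       < 2 * (ncenters I)%:R * active_cost u A (f |: A)) ->
  robust_cost z A <= 4 * robust_cost z Y.
Proof.
move=> A0 fY u0 /andP[M1 M2] H.
have Y0 := feasible_neq0 fY.
case: (leP (robust_cost z A) (4 * robust_cost z Y)) => // big.
set k := (ncenters I)%:R in H; set Phi := active_cost u A A in H.
have k0 : 0 < k by rewrite ltr0n -(proj2 fY) card_gt0.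
have act0 i : active u A i -> 2 * group_cost Y i <= group_cost A i.
  rewrite /active => hi; have hY := group_cost_le Y i.
  have : robust_cost z A * u < 2 * group_cost A i * u by lra.
  by rewrite ltr_pM2r //; lra.
have [i hi] : exists i, active u A i.
  apply/existsP; apply: contraTT M1 => /existsPn Hn; rewrite -leNgt.
  rewrite -ler_pdivlMr //; apply: robust_cost_le; first by rewrite divr_ge0 // ltW.
  by move=> i; rewrite ler_pdivlMr // leNgt; exact: Hn.
have PhiY : 2 * active_cost u A Y <= Phi.
  by rewrite /active_cost mulr_sumr; apply: ler_sum => j; exact: act0.
have gain : Phi - active_cost u A Y <=
    \sum_(y in Y) (Phi - active_cost u A (y |: A)).
  rewrite /Phi /active_cost -sumrB.
  under [leRHS]eq_bigr do rewrite -sumrB.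
  rewrite exchange_big /=; apply: ler_sum => j _.
  exact: group_cost_union_gain.
have : k * \sum_(y in Y) (Phi - active_cost u A (y |: A)) < k * (Phi / 2).
  rewrite mulr_sumr.
  have [y0 y0Y] := set0Pn _ Y0.
  have lt1 y : y \in Y -> k * (Phi - active_cost u A (y |: A)) < Phi / 2.
    by move=> yY; have := H y (subsetP (proj1 fY) _ yY); lra.
  have -> : k * (Phi / 2) = \sum_(y in Y) (Phi / 2).
    by rewrite sumr_const (proj2 fY) mulr_natl.
  by apply: ltr_sum => //; apply/hasP; exists y0 => //; rewrite mem_index_enum.
rewrite ltr_pM2l //; lra.
Qed.

(* Two clients share a center, so one of them is at least half their distance away
   from it. *)
Lemma close_pair Y : feasible Y -> (ncenters I < #|clients I|)%N ->
  exists q x, [/\ q \in clients I, x \in clients I, q != x &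
    weight q * (delta q x / 2) `^ z <= robust_cost z Y].
Proof.
move=> fY hk; have Y0 := feasible_neq0 fY.
pose g p := odflt p [pick y in Y | dist_to_set Y p == delta p y].
have gP p : g p \in Y /\ dist_to_set Y p = delta p (g p).
  rewrite /g; case: pickP => [y /andP[yY /eqP E]|H] //=.
  by have [y yY E] := dist_ex p Y0; have := H y; rewrite yY E eqxx.
have : ~~ dinjectiveb g (clients I).
  apply/negP => /dinjectiveP inj; have := card_in_imset inj => E.
  have : (#|g @: clients I| <= #|Y|)%N.
    by apply/subset_leq_card/subsetP=> _ /imsetP[p _ ->]; case: (gP p).
  by rewrite E (proj2 fY) leqNgt hk.
case/dinjectivePn=> q qC [x /andP[/= xq xC] E].
wlog le : q x qC xC xq E / delta x (g x) <= delta q (g q).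
  move=> W; case: (leP (delta x (g x)) (delta q (g q))) => h; first exact: (W q x).
  by apply: (W x q) => //; [rewrite eq_sym|exact: ltW].
exists q, x; split=> //; first by rewrite eq_sym.
apply: le_trans (client_cost_le Y qC); rewrite ler_wpM2l ?(ltW (weight_gt0 qC)) //.
apply: powR_le => //; first by rewrite divr_ge0 ?delta_ge0.
rewrite (gP q).2; have := delta_triangle q (g q) x.
by rewrite E (delta_sym (g x) x) -E; rewrite -?E in le *; lra.
Qed.

End Clustering.

(** * The greedy bicriteria solution *)

Section Bicriteria.
Variables (R : realType) (I : clustering_input R) (z : R).
Hypotheses (valid : valid_input I) (z1 : 1 <= z).
Implicit Types (A X Y : {set 'I_(npts I)}) (p q x y f : 'I_(npts I)).

Lemma weight_le Q p q : weight_aspect_ratio I <= Q ->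
  p \in clients I -> q \in clients I -> weight p <= Q * weight q.
Proof.
move=> hQ pC qC; have C0 : clients I != set0 by apply/set0Pn; exists p.
move: hQ; rewrite /weight_aspect_ratio.
have := minover_le (@weight R I) qC; have := maxover_ge (@weight R I) pC.
have [x xC ->] := minover_ex (@weight R I) C0.
have x0 := weight_gt0 valid xC; have p0 := weight_gt0 valid pC.
rewrite ler_pdivrMr // => h1 h2 h3; apply: le_trans h1 (le_trans h3 _).
rewrite ler_wpM2l //; rewrite -(pmulr_lge0 _ x0); apply: le_trans h3; exact: maxover_ge0.
Qed.

Lemma delta_le Q p p' q x : distance_aspect_ratio I <= Q ->
  p \in clients I -> p' \in clients I -> q \in clients I -> x \in clients I -> q != x ->
  delta p p' <= Q * delta q x.
Proof.
move=> hQ pC pC' qC xC qx; move: hQ; rewrite /distance_aspect_ratio.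
set S := setX _ _; set g := fun e => _; set S' := [set e in S | _].
have pS : (p, p') \in S by rewrite inE /= pC.
have qS : (q, x) \in S' by rewrite !inE /= qC xC.
have := minover_le g qS; have := maxover_ge g pS; rewrite /g /=.
have S0 : S' != set0 by apply/set0Pn; exists (q, x).
have [[a b] + ->] := minover_ex g S0; rewrite !inE /= => /andP[_ ab].
have ab0 := delta_gt0 valid ab.
rewrite ler_pdivrMr // => h1 h2 h3; apply: le_trans h1 (le_trans h3 _).
rewrite ler_wpM2l //; rewrite -(pmulr_lge0 _ ab0); apply: le_trans h3; exact: maxover_ge0.
Qed.

(** Every client costs a bounded multiple of [V]: it reaches [f0] through [p0], its distance to [p0]
    is at most [2 Q] times half the distance of the close pair, and weights differ by a factor at
    most [Q <= Q ^ z]. The [n] clients add up to [2 n (4 Q^2)^z V], and [2 n <= (2 n)^z]. *)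
Lemma cost_gap A (Q V : R) p0 f0 :
  p0 \in clients I -> f0 \in A -> 1 <= Q ->
  weight_aspect_ratio I <= Q -> distance_aspect_ratio I <= Q ->
  weight p0 * delta p0 f0 `^ z <= V ->
  robust_cost z A <= V \/
    (exists q x, [/\ q \in clients I, x \in clients I, q != x &
       weight q * (delta q x / 2) `^ z <= V]) ->
  robust_cost z A <= (8 * #|clients I|%:R * Q ^+ 2) `^ z * V.
Proof.
move=> p0C f0A Q1 hw hd hV.
have Q0 : 0 <= Q by lra.
have z0 : 0 <= z by apply: le_trans z1.
have V0 : 0 <= V.
  by apply: le_trans hV; rewrite mulr_ge0 ?powR_ge0 // ltW // weight_gt0.
have n1 : 1 <= #|clients I|%:R :> R by rewrite ler1n card_gt0; apply/set0Pn; exists p0.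
have QQ : 1 <= Q ^+ 2 by rewrite exprn_ege1.
have nQ : #|clients I|%:R <= #|clients I|%:R * Q ^+ 2 by rewrite ler_peMr.
case=> [h|[q [x [qC xC qx hq]]]].
  apply: le_trans h _; rewrite -[leLHS]mul1r ler_wpM2r //.
  have D1 : 1 <= 8 * #|clients I|%:R * Q ^+ 2.
    by rewrite -mulrA; move: n1 nQ; set a := (_ * Q ^+ 2); set b := _%:R; lra.
  exact: le_trans D1 (le1r_powR D1 z1).
have hp p : p \in clients I ->
    weight p * dist_to_set A p `^ z <= 2 * (2 * Q * (2 * Q)) `^ z * V.
  move=> pC.
  have w0 := ltW (weight_gt0 valid pC).
  have hD : dist_to_set A p `^ z <= 2 `^ z * (delta p p0 `^ z + delta p0 f0 `^ z).
    apply: le_trans (powR_addn z1 (delta_ge0 valid _ _) (delta_ge0 valid _ _)).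
    apply: powR_le => //; first exact: (dist_ge0 valid).
    exact: le_trans (dist_le p f0A) (delta_triangle valid _ _ _).
  have QP : Q <= Q `^ z by rewrite le1r_powR.
  have h1 : weight p * delta p p0 `^ z <= Q `^ z * ((2 * Q) `^ z * V).
    have : delta p p0 `^ z <= (2 * Q) `^ z * (delta q x / 2) `^ z.
      rewrite -powRM ?divr_ge0 ?mulr_ge0 ?(delta_ge0 valid) //.
      apply: powR_le => //; first exact: (delta_ge0 valid).
      by have := delta_le hd pC p0C qC xC qx; lra.
    have := weight_le hw pC qC => a b.
    apply: (@le_trans _ _ ((Q `^ z * weight q) * ((2 * Q) `^ z * (delta q x / 2) `^ z))).
      apply: ler_pM => //; first exact: powR_ge0.
      by apply: le_trans a _; rewrite ler_wpM2r // ltW // (weight_gt0 valid).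
    rewrite [leLHS](_ : _ = Q `^ z * ((2 * Q) `^ z * (weight q * (delta q x / 2) `^ z))); last by ring.
    by rewrite !ler_wpM2l ?powR_ge0.
  have h2 : weight p * delta p0 f0 `^ z <= Q `^ z * ((2 * Q) `^ z * V).
    apply: (@le_trans _ _ (Q `^ z * (weight p0 * delta p0 f0 `^ z))).
      rewrite mulrA ler_wpM2r ?powR_ge0 //.
      apply: le_trans (weight_le hw pC p0C) _.
      by rewrite ler_wpM2r // ltW // (weight_gt0 valid).
    rewrite ler_wpM2l ?powR_ge0 //; apply: le_trans hV _.
    rewrite ler_peMl //; rewrite (@le_trans _ _ (2 * Q)) //; first lra.
    by rewrite le1r_powR //; lra.
  apply: le_trans (ler_wpM2l w0 hD) _.
  rewrite [leLHS](_ : _ = 2 `^ z * (weight p * delta p p0 `^ z + weight p * delta p0 f0 `^ z)); last by ring.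
  rewrite !powRM ?mulr_ge0 // in h1 h2 *.
  have := lerD h1 h2; move: (weight p * _ + _) => L hL.
  rewrite [leRHS](_ : _ = 2 `^ z * (Q `^ z * (2 `^ z * Q `^ z * V) + Q `^ z * (2 `^ z * Q `^ z * V))); last by ring.
  by rewrite ler_wpM2l ?powR_ge0.
have n0 : 0 <= #|clients I|%:R :> R by exact: ler0n.
apply: robust_cost_le => [|i].
  by rewrite mulr_ge0 ?powR_ge0.
apply: (@le_trans _ _ (\sum_(p in clients I) 2 * (2 * Q * (2 * Q)) `^ z * V)).
  rewrite /group_cost big_mkcond [leRHS]big_mkcond /=.
  apply: ler_sum => p _; case: ifP => [/(group_client valid) pC|_].
    by rewrite pC hp.
  by case: ifP => // _; rewrite !mulr_ge0 ?powR_ge0.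
rewrite sumr_const -[leLHS]mulr_natl mulrA ler_wpM2r // mulrA.
rewrite [8 * _ * _](_ : _ = (2 * #|clients I|%:R) * (2 * Q * (2 * Q))); last by ring.
rewrite [leRHS]powRM ?mulr_ge0 // ler_wpM2r ?powR_ge0 //.
by rewrite mulrC le1r_powR //; move: n1; set b := _%:R; lra.
Qed.

(** * Counting the greedy additions *)

Section GreedyCount.
Variables (A0 : {set 'I_(npts I)}) (T : nat) (U Delta : R).
Let k := ncenters I.
Let rate : R := 1 - (2 * k%:R)^-1.
Hypotheses (A0_neq0 : A0 != set0) (UE : U = robust_cost z A0)
  (hT : rate ^+ T * (2 * (ngroups I)%:R) <= 1).

(* [1 / u] is the threshold of the current phase, [g] the number of earlier
   phases and [a] the number of additions in the current one. *)
Definition greedy_inv A (u : R) : Prop :=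
  A0 \subset A /\
  ((u = 0 /\ (#|A| <= k)%N) \/
   exists g a, [/\ 0 < u, (#|A| <= k + g * T + a)%N, (a <= T)%N,
     2 ^+ g <= Delta /\ 2 * 2 ^+ g <= U * u &
     active_cost z u A A * u <= rate ^+ a * (2 * (ngroups I)%:R) /\
     robust_cost z A * u <= 2]).

Lemma k_gt0 : (0 < k)%N. Proof. by case: valid => _ _ _ _ /andP[]. Qed.

Lemma rate_ge0 : 0 <= rate.
Proof.
rewrite subr_ge0 invf_le1 ?mulr_gt0 ?ltr0n ?k_gt0 //.
by have : 1 <= k%:R :> R by [rewrite ler1n k_gt0]; lra.
Qed.

Lemma active_cost_le A u : 0 < u ->
  active_cost z u A A <= (ngroups I)%:R * robust_cost z A.
Proof.
move=> u0; rewrite /active_cost big_mkcond /=.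
apply: (@le_trans _ _ (\sum_(i < ngroups I) robust_cost z A)).
  apply: ler_sum => i _; case: ifP => _; first exact: group_cost_le.
  exact: robust_cost_ge0.
by rewrite sumr_const card_ord mulr_natl.
Qed.

(** The test also succeeds at [u = 0], so the initial infinite threshold needs no case of its
    own. *)
Definition next_threshold (M u : R) : R := if M * u <= 1 then 2 / M else u.

(** A new phase starts at the threshold [M / 2], which at least doubles a positive [u]. Hence
    [2^g M <= U] at the start of a phase preceded by [g] others, and [U <= Delta * M] turns this
    into [2^g <= Delta]. *)
Lemma greedy_reset A u (M := robust_cost z A) :
  greedy_inv A u -> 0 < M -> U <= Delta * M ->
  greedy_inv A (next_threshold M u) /\
  0 < next_threshold M u /\ 1 < M * next_threshold M u <= 2.
Proof.
move=> [sA H] M0 hD; rewrite /next_threshold; case: ifPn => [hu|].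
  have uM : M * (2 / M) = 2 by rewrite mulrC divfK ?gt_eqF.
  have u0 : 0 < 2 / M by rewrite divr_gt0.
  rewrite uM lexx andbT; split; last by split=> //; lra.
  split=> //; right.
  have MU : M <= U by rewrite UE (robust_cost_anti valid).
  have act : active_cost z (2 / M) A A * (2 / M) <= rate ^+ 0 * (2 * (ngroups I)%:R) /\
      M * (2 / M) <= 2.
    rewrite expr0 mul1r uM lexx; split=> //.
    apply: (@le_trans _ _ ((ngroups I)%:R * M * (2 / M))).
      by rewrite ler_wpM2r ?active_cost_le // ltW.
    by rewrite -mulrA uM mulrC.
  case: H => [[_ hA]|[g [a [u1 hA aT [h1 h2] [h3 h4]]]]].
    exists 0%N, 0%N; split=> //; first by rewrite addn0 mul0n addn0.
    rewrite expr0 mulr1; split; last by rewrite mulrCA ler_peMr // ler_pdivlMr // mul1r.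
    by rewrite -(ler_pM2r M0) mul1r; apply: le_trans MU hD.
  have hUM : 2 * 2 ^+ g * M <= U.
    have : U * u * M <= U by rewrite -mulrA ler_piMr ?UE ?robust_cost_ge0 // mulrC.
    by apply: le_trans; rewrite ler_wpM2r // ltW.
  exists g.+1, 0%N; split=> //.
    by rewrite mulSn addn0 addnCA addnC (leq_trans hA) // leq_add2l.
  rewrite exprS; split.
    by rewrite -(ler_pM2r M0); apply: le_trans hUM hD.
  by rewrite [leRHS]mulrCA ler_wpM2l // ler_pdivlMr.
rewrite -ltNge => hu; split=> //.
  have u0 : u != 0 by apply: contraTneq hu => ->; rewrite mulr0 -leNgt.
  by case: H => [[/eqP]|[g [a [u1 _ _ _ [_ h4]]]]]; rewrite ?(negbTE u0) // hu.
Qed.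

Lemma greedy_add A u f (M := robust_cost z A) :
  greedy_inv A u -> 0 < u -> 1 < M * u ->
  2 * k%:R * active_cost z u A (f |: A) <= (2 * k%:R - 1) * active_cost z u A A ->
  greedy_inv (f |: A) u /\ f \notin A.
Proof.
move=> [sA H] u0 Mu hf.
have A1 : A != set0 by apply: contra_neq A0_neq0 => E; apply/eqP; rewrite -subset0 -E.
have Phi0 : 1 < active_cost z u A A * u.
  have [i hi] : exists i, active z u A i.
    apply/existsP; apply: contraTT Mu => /existsPn Hn; rewrite -leNgt -ler_pdivlMr //.
    apply: robust_cost_le => [|i]; first by rewrite divr_ge0 // ltW.
    by rewrite ler_pdivlMr // leNgt; exact: Hn.
  apply: (lt_le_trans hi); rewrite ler_wpM2r ?(ltW u0) //.
  rewrite /active_cost (bigD1 i) //= lerDl; apply: sumr_ge0 => j _; exact: group_cost_ge0.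
have k0 : 0 < 2 * k%:R :> R by rewrite mulr_gt0 // ltr0n k_gt0.
have hf' : active_cost z u A (f |: A) <= rate * active_cost z u A A.
  rewrite -(ler_pM2l k0) mulrA; apply: le_trans hf _.
  by rewrite /rate mulrBr mulr1 divff ?gt_eqF.
have PhiP : 0 < active_cost z u A A.
  by rewrite -(pmulr_lgt0 _ u0); apply: lt_trans Phi0.
split; last first.
  (* An old center gains nothing, whereas [f] reduces a positive active cost by the factor
     [rate < 1]. *)
  apply/negP => fA; have E : f |: A = A by apply/setUidPr; rewrite sub1set.
  have := hf'; rewrite E leNgt gtr_pMl // => /negP; apply.
  by rewrite /rate gtrDl oppr_lt0 invr_gt0.
split; first by apply: subset_trans sA _; apply: subsetUr.
right; case: H => [[E _]|[g [a [_ hA aT [h1 h2] [h3 h4]]]]].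
  by rewrite E ltxx in u0.
(* At [a = T] the hypothesis on [rate ^+ T] would bring the scaled active cost down to 1, but a
   single active group already exceeds 1. *)
have aT' : (a < T)%N.
  rewrite ltn_neqAle aT andbT; apply/eqP => E.
  by have := lt_le_trans Phi0 (le_trans h3 _); rewrite E => /(_ _ hT); rewrite ltxx.
exists g, a.+1; split=> //.
- by rewrite (leq_trans (leq_card_setU _ _)) // cards1 addnS add1n ltnS.
- split; last first.
    apply: le_trans h4; rewrite ler_wpM2r ?(ltW u0) //.
    by apply: (robust_cost_anti valid) => //; apply: subsetUr.
  rewrite exprS -mulrA; apply: (@le_trans _ _ (rate * (active_cost z u A A * u))).
    rewrite mulrA ler_wpM2r ?(ltW u0) //; apply: le_trans hf'.
    (* Adding a center activates no group, so recomputing the active set can only lower the active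
       cost. *)
    rewrite /active_cost big_mkcond [leRHS]big_mkcond /=.
    apply: ler_sum => i _; case: ifP => hi; last first.
      by case: ifP => // _; apply: (group_cost_ge0 z valid).
    suff -> : active z u A i by [].
    apply: lt_le_trans hi _; rewrite ler_wpM2r ?(ltW u0) //.
    by apply: (group_cost_anti valid) => //; apply: subsetUr.
  by rewrite ler_wpM2l ?rate_ge0.
Qed.

Lemma greedy_card A u : greedy_inv A u -> 1 <= Delta ->
  exists g, (#|A| <= k + g.+1 * T)%N /\ 2 ^+ g <= Delta.
Proof.
move=> [_ [[_ hA]|[g [a [_ hA aT [h1 _] _]]]]] D1.
  by exists 0%N; rewrite expr0; split=> //; apply: leq_trans hA (leq_addr _ _).
by exists g; split=> //; rewrite mulSn addnCA addnC (leq_trans hA) // leq_add2l.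
Qed.

End GreedyCount.
End Bicriteria.

(** * Nets adapted to a solution *)

Section Nets.
Variables (R : realType) (I : clustering_input R) (z : R).
Hypotheses (valid : valid_input I) (z1 : 1 <= z).
Implicit Types (A N X Y Z : {set 'I_(npts I)}) (p q x y u : 'I_(npts I)).

Definition total_weight : R := \sum_(p in clients I) @weight R I p.

(** A displacement is accepted if it is small relative to the distance to the solution, or so small
    that its cost over the whole weight can be charged to [V]. The relation is not symmetric, as [D]
    is evaluated at [x]. *)
Definition covered (D : 'I_(npts I) -> R) (e V : R) x y : bool :=
  (delta x y <= e * D x) || (total_weight * (delta x y / e) `^ z <= V).

Lemma total_weight_gt0 p : p \in clients I -> 0 < total_weight.
Proof.
move=> pC; rewrite /total_weight (bigD1 p) //= ltr_pwDl ?(weight_gt0 valid) //.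
by apply: sumr_ge0 => q /andP[/(weight_gt0 valid)/ltW].
Qed.

(** [powR_perturb] charges each client [e 4^z] times the sum of its cost under [Y], its cost under
    [A] and a share of [V] proportional to its weight. Over a group these three are at most one,
    four and one times the cost of [Y], whence the 6. *)
Lemma snap_cost A X Y (e V : R) :
  A != set0 -> X != set0 -> feasible Y -> 0 < e <= 1 -> 0 <= V ->
  robust_cost z A <= 4 * robust_cost z Y -> V <= robust_cost z Y ->
  (forall p, p \in clients I -> exists2 y, dist_to_set Y p = delta p y &
     exists2 x, x \in X & covered (dist_to_set A) e V y x) ->
  robust_cost z X <= (1 + 6 * (e * 4 `^ z)) * robust_cost z Y.
Proof.
move=> A0 X0 fY /andP[e0 e1] V0 hA hV snap.
set E := e * 4 `^ z; have E0 : 0 <= E by rewrite mulr_ge0 ?powR_ge0 // ltW.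
set O := robust_cost z Y in hA hV *; have O0 : 0 <= O by exact: robust_cost_ge0.
have hp p : p \in clients I ->
    dist_to_set X p `^ z <= dist_to_set Y p `^ z +
      E * (dist_to_set Y p `^ z + dist_to_set A p `^ z + V / total_weight).
  move=> pC; have W0 := total_weight_gt0 pC; have [y Ey [x xX hx]] := snap p pC.
  set a := dist_to_set Y p in Ey *; set b := dist_to_set A p.
  have a0 : 0 <= a by exact: dist_ge0.
  have b0 : 0 <= b by exact: dist_ge0.
  (* Depending on the alternative of [covered], [s] is 0 or the displacement divided by [e]; both
     give the form that [powR_perturb] expects. *)
  have [s [s0 hs ds]] : exists s, [/\ 0 <= s, s `^ z <= V / total_weight &
      delta y x <= e * (a + b + s)].
    case/orP: hx => h.
      exists 0; split=> //.
        by rewrite powR0 ?divr_ge0 ?(ltW W0) // gt_eqF // (lt_le_trans _ z1).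
      rewrite addr0; apply: le_trans h _; rewrite ler_wpM2l ?(ltW e0) //.
      by apply: le_trans (dist_triangle valid y p A0) _; rewrite (delta_sym valid) -Ey.
    exists (delta y x / e); split; first by rewrite divr_ge0 ?delta_ge0 ?ltW.
      by rewrite ler_pdivlMr // mulrC.
    rewrite mulrDr [e * (_ / _)]mulrC divfK ?gt_eqF // lerDr mulr_ge0 ?(ltW e0) //.
    exact: addr_ge0.
  have hX : dist_to_set X p <= a + e * (a + b + s).
    apply: le_trans (dist_le p xX) _; apply: le_trans (delta_triangle valid p y x) _.
    by rewrite -Ey lerD2l.
  apply: le_trans (powR_le z1 (dist_ge0 valid _ _) hX) _.
  have e01 : 0 <= e <= 1 by rewrite ltW.
  apply: le_trans (powR_perturb z1 a0 b0 s0 e01) _.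
  by rewrite lerD2l ler_wpM2l // lerD2l.
apply: robust_cost_le => [|i]; first by rewrite mulr_ge0 // addr_ge0 // mulr_ge0.
have hw : \sum_(p in group i) weight p * (V / total_weight) <= O.
  rewrite -mulr_suml; apply: le_trans hV.
  have [->|/set0Pn[p /(group_client valid) pC]] := eqVneq (@group R I i) set0.
    by rewrite big_set0 mul0r.
  have W0 := total_weight_gt0 pC.
  rewrite mulrA ler_pdivrMr // mulrC ler_wpM2l // /total_weight.
  rewrite big_mkcond [leRHS]big_mkcond /=; apply: ler_sum => q _.
  case: ifP => [/(group_client valid) ->|_] //.
  by case: ifP => // /(weight_gt0 valid)/ltW.
apply: (@le_trans _ _ (group_cost z Y i + E * (group_cost z Y i + group_cost z A i +
    \sum_(p in group i) weight p * (V / total_weight)))).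
  rewrite /group_cost -!big_split /= mulr_sumr -big_split /=.
  apply: ler_sum => p /(group_client valid) pC.
  rewrite -!mulrDr mulrCA -mulrDr ler_wpM2l ?(ltW (weight_gt0 valid pC)) //.
  exact: hp.
have hY := group_cost_le z Y i; have hA' := le_trans (group_cost_le z A i) hA.
rewrite mulrDl mul1r; apply: lerD => //.
have -> : 6 * E * O = E * (O + 4 * O + O) by ring.
by rewrite ler_wpM2l // !lerD.
Qed.

Variables (c d : R).
Hypothesis doubling : has_doubling_dimension I c d.

Lemma ball_cover t x (r : R) : 0 < r -> exists Y,
  #|Y|%:R <= (2 `^ (c * d)) ^+ t /\
  forall y, delta x y <= r -> exists2 u, u \in Y & delta u y <= r / 2 ^+ t.
Proof.
move=> r0; elim: t => [|t [Y [hY cY]]].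
  exists [set x]; rewrite cards1 expr0; split=> // y hy.
  by exists x; rewrite ?set11 // expr0 divr1.
have r'0 : 0 < r / 2 ^+ t by rewrite divr_gt0 ?exprn_gt0.
pose P u (S : {set 'I_(npts I)}) := #|S|%:R <= 2 `^ (c * d) /\
  forall y, delta u y <= r / 2 ^+ t -> exists2 v, v \in S & delta v y <= r / 2 ^+ t / 2.
have [g hg] : exists g : {ffun 'I_(npts I) -> {set 'I_(npts I)}}, forall u, P u (g u).
  have /fin_all_exists[g hg] : forall u, exists S, P u S by move=> u; apply: doubling.
  by exists [ffun u => g u] => u; rewrite ffunE.
exists (\bigcup_(u in Y) g u); split.
  apply: (@le_trans _ _ (\sum_(u in Y) 2 `^ (c * d))).
    apply: (@le_trans _ _ (\sum_(u in Y) #|g u|)%:R).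
      rewrite ler_nat; elim/big_rec2: _ => [|u n S _ h]; first by rewrite cards0.
      by rewrite (leq_trans (leq_card_setU _ _)) // leq_add2l.
    by rewrite natr_sum; apply: ler_sum => u _; exact: (hg u).1.
  by rewrite sumr_const -[leLHS]mulr_natl exprSr ler_wpM2r // powR_ge0.
move=> y /cY[u uY /(hg u).2[v vS hv]].
exists v; first by apply/bigcupP; exists u.
by rewrite exprSr invfM mulrA.
Qed.

(** Each covering ball of radius [r / 2^t] contains at most one point of [Z], since two points in it
    are at most twice that radius apart. *)
Lemma separated_card t x (r : R) Z : 0 < r ->
  (forall y, y \in Z -> delta x y <= r) ->
  {in Z &, forall y y', y != y' -> 2 * (r / 2 ^+ t) < delta y y'} ->
  #|Z|%:R <= (2 `^ (c * d)) ^+ t.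
Proof.
move=> r0 hZ sep; have [Y [hY cY]] := ball_cover t x r0.
apply: le_trans hY; rewrite ler_nat.
pose g y := odflt x [pick u in Y | delta u y <= r / 2 ^+ t].
have gP y : y \in Z -> g y \in Y /\ delta (g y) y <= r / 2 ^+ t.
  move=> /hZ/cY[u uY hu]; rewrite /g; case: pickP => [v /andP[]|/(_ u)] //=.
  by rewrite uY hu.
rewrite -(card_in_imset (f := g)).
  by apply/subset_leq_card/subsetP=> _ /imsetP[y /gP[? _] ->].
move=> y y' yZ y'Z E; apply/eqP; apply: contraTT isT => ne.
have := sep y y' yZ y'Z ne; have := delta_triangle valid y (g y) y'.
have := (gP _ yZ).2; have := (gP _ y'Z).2; rewrite -E (delta_sym valid y (g y)).
by lra.
Qed.

(* [N] is cut into annuli around each point of [A], of radii [s], [2s], [4s] and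
   so on; a point of [N] is separated from the others in proportion to its
   radius. *)
Lemma net_card A N (e s : R) (S t : nat) : A != set0 -> 0 < e -> 0 < s ->
  4 / e <= 2 ^+ t ->
  (forall x, x \in N -> dist_to_set A x <= 2 ^+ S * s) ->
  {in N &, forall x y, x != y ->
     e * s < delta x y /\ (e * dist_to_set A x < delta x y \/ e * dist_to_set A y < delta x y)} ->
  #|N|%:R <= #|A|%:R * S.+1%:R * (2 `^ (c * d)) ^+ t.
Proof.
move=> A0 e0 s0 ht hN sep; set K := (2 `^ (c * d)) ^+ t.
have [a0 a0A] := set0Pn _ A0.
pose a x := odflt a0 [pick y in A | dist_to_set A x == delta x y].
have aP x : a x \in A /\ dist_to_set A x = delta x (a x).
  rewrite /a; case: pickP => [y /andP[yA /eqP E]|H] //=.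
  by have [y yA E] := dist_ex x A0; have := H y; rewrite yA E eqxx.
(* Minimality of the index provides the lower bound on the distance to [A], and with it the
   separation within an annulus. *)
pose j x : 'I_S.+1 := [arg min_(i < ord_max | dist_to_set A x <= 2 ^+ i * s) i].
have jP x : x \in N -> dist_to_set A x <= 2 ^+ j x * s /\
    ((0 < j x)%N -> 2 ^+ (j x).-1 * s < dist_to_set A x).
  move=> xN; rewrite /j; case: arg_minnP => [|i hi mi]; first exact: hN.
  split=> // i0; rewrite ltNge; apply/negP => h.
  have hi' : (i.-1 < S.+1)%N by rewrite (leq_ltn_trans (leq_pred _)).
  by have := mi (Ordinal hi') h; rewrite /= leqNgt prednK // leqnn.
pose h x := (a x, j x).
have fib v : v \in setX A [set: 'I_S.+1] -> #|[set x in N | h x == v]|%:R <= K.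
  case: v => b i _; set r := 2 ^+ i * s.
  have r0 : 0 < r by rewrite mulr_gt0 ?exprn_gt0.
  apply: (separated_card (x := b) r0) => [y|x y].
    rewrite inE => /andP[yN /eqP[<- E]]; rewrite (delta_sym valid) -(aP y).2.
    by have := (jP _ yN).1; rewrite E.
  rewrite !inE => /andP[xN /eqP[_ Ex]] /andP[yN /eqP[_ Ey]] xy.
  have [d1 d2] := sep _ _ xN yN xy.
  have T0 : 0 < 2 ^+ t :> R by rewrite exprn_gt0.
  (* [t] makes twice the radius of the covering balls at most [e r / 2]. The points of annulus [i]
     are farther apart than that: beyond the innermost annulus their distance to [A] exceeds
     [r / 2], and in the innermost one the absolute separation [e s] applies. *)
  have hT : 4 * r / 2 ^+ t <= e * r.
    rewrite ler_pdivrMr // mulrAC ler_wpM2r ?(ltW r0) //.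
    by rewrite mulrC -ler_pdivrMr.
  have {hT} hT : 2 * (r / 2 ^+ t) <= e * (r / 2) by move: hT; rewrite -mulrA; lra.
  apply: le_lt_trans hT _.
  have [i0|ipos] := posnP i.
    apply: lt_trans d1; rewrite ltr_pM2l // /r i0 expr0; lra.
  have rE : r / 2 = 2 ^+ i.-1 * s.
    by rewrite /r -{1}(prednK ipos) exprS; field.
  case: d2 => d2; apply: lt_trans d2; rewrite ltr_pM2l // rE.
    by have := (jP _ xN).2; rewrite Ex; apply.
  by have := (jP _ yN).2; rewrite Ey; apply.
have -> : #|N|%:R = \sum_(v in setX A [set: 'I_S.+1]) #|[set x in N | h x == v]|%:R :> R.
  rewrite -natr_sum -sum1_card (partition_big h (mem (setX A [set: 'I_S.+1]))) /=.
    congr _%:R; apply: eq_bigr => v _; rewrite sum1_card; apply: eq_card => x.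
    by rewrite !inE unfold_in.
  by move=> x xN; rewrite inE (aP x).1 inE.
apply: (@le_trans _ _ (\sum_(v in setX A [set: 'I_S.+1]) K)).
  by apply: ler_sum => v; exact: fib.
by rewrite sumr_const cardsX cardsT card_ord -[leLHS]mulr_natl natrM.
Qed.

(** A facility close enough to serve [p] within [U] is near [A], because [p] is. This caps the
    radius of the outermost annulus. *)
Lemma relevant_dist A p x (U : R) : A != set0 -> p \in clients I -> 0 <= U ->
  robust_cost z A <= U -> weight p * delta p x `^ z <= U ->
  dist_to_set A x `^ z * weight p <= 2 `^ z * U.
Proof.
move=> A0 pC U0 hA hx; have w0 := weight_gt0 valid pC.
set m := Num.max (delta p x) (dist_to_set A p).
have m0 : 0 <= m by rewrite le_max delta_ge0.
have hm : m `^ z * weight p <= U.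
  rewrite /m /Num.max; case: ifP => _; rewrite mulrC //.
  exact: le_trans (client_cost_le z valid A pC) hA.
apply: (@le_trans _ _ ((2 * m) `^ z * weight p)).
  rewrite ler_wpM2r ?(ltW w0) // powR_le ?dist_ge0 //.
  apply: le_trans (dist_triangle valid x p A0) _; rewrite (delta_sym valid).
  have : delta p x <= m by rewrite le_max lexx.
  have : dist_to_set A p <= m by rewrite le_max lexx orbT.
  by lra.
by rewrite powRM // -mulrA ler_wpM2l ?powR_ge0.
Qed.

(** The annuli start at the radius [s] by which the whole weight moves at cost [V], and end at the
    distance allowed by [relevant_dist]. The total weight is at most [n Q] times the weight of any
    client, so the two radii differ by a factor at most [2 D n Q]. *)
Lemma facility_net_card A N (e V U Q D : R) (S t : nat) :
  A != set0 -> 0 < e -> 4 / e <= 2 ^+ t -> 1 <= Q -> 1 <= D -> 0 <= c * d ->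
  robust_cost z A <= U -> 0 <= V -> U <= D `^ z * V ->
  weight_aspect_ratio I <= Q -> 2 * D * (#|clients I|%:R * Q) <= 2 ^+ S ->
  (forall x, x \in N -> x \in A \/
     exists2 p, p \in clients I & weight p * delta p x `^ z <= U) ->
  {in N &, forall x y, x != y -> ~~ covered (dist_to_set A) e V x y \/
      ~~ covered (dist_to_set A) e V y x} ->
  #|N|%:R <= #|A|%:R * S.+1%:R * (2 `^ (c * d)) ^+ t.
Proof.
move=> A0 e0 ht Q1 D1 cd0 hA V0 hU hQ hS rel sep.
have U0 : 0 <= U := le_trans (robust_cost_ge0 _ _) hA.
have z0 : z != 0 by rewrite gt_eqF // (lt_le_trans _ z1).
have [/subset_leq_card NA|/subsetPn[x0 x0N x0A]] := boolP (N \subset A).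
  apply: (@le_trans _ _ (#|A|%:R * 1 * 1)); first by rewrite !mulr1 ler_nat.
  rewrite ler_pM ?mulr_ge0 //; first by rewrite ler_wpM2l // ler1n.
  by rewrite exprn_ege1 // -[leLHS](powRr0 2) ler_powR // ler1n.
have [p0 p0C hp0] : exists2 p, p \in clients I & weight p * delta p x0 `^ z <= U.
  by case: (rel _ x0N) => // h; rewrite h in x0A.
have W0 := total_weight_gt0 p0C.
(* [V = 0] forces [U = 0], and then [relevant_dist] puts [x0] into [A]. *)
have Vpos : 0 < V.
  rewrite lt_neqAle V0 andbT; apply/eqP => VE.
  have UE : U = 0 by apply/eqP; rewrite eq_le U0 (le_trans hU) // -VE mulr0.
  have := relevant_dist A0 p0C U0 hA hp0; rewrite UE mulr0.
  rewrite pmulr_lle0 ?(weight_gt0 valid) // => h.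
  have /eqP : dist_to_set A x0 `^ z = 0 by apply/eqP; rewrite eq_le h powR_ge0.
  rewrite powR_eq0 z0 andbT => /eqP; have [a aA ->] := dist_ex x0 A0.
  by move/(delta_eq0 valid) => E; rewrite E aA in x0A.
set s := (V / total_weight) `^ z^-1.
have VW : 0 < V / total_weight by rewrite divr_gt0.
have s0 : 0 < s by rewrite powR_gt0.
have sz : s `^ z = V / total_weight by rewrite /s -powRrM mulVf // powRr1 // ltW.
apply: (net_card A0 e0 s0 ht) => [x xN|x y xN yN xy].
  case: (rel _ xN) => [xA|[p pC hp]].
    apply: le_trans (dist_le x xA) _; rewrite (delta_refl valid).
    by rewrite mulr_ge0 ?exprn_ge0 // ltW.
  have w0 := weight_gt0 valid pC.
  have n1 : 1 <= #|clients I|%:R :> R.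
    by rewrite ler1n card_gt0; apply/set0Pn; exists p.
  have nQ1 : 1 <= #|clients I|%:R * Q by rewrite mulr_ege1.
  have nQ0 := lt_le_trans ltr01 nQ1.
  have S0 : 0 <= 2 ^+ S :> R by rewrite exprn_ge0.
  have D0 : 0 <= 2 * D by rewrite mulr_ge0 // (le_trans _ D1).
  apply: (powR_le_cancel z1); first by rewrite mulr_ge0 // ltW.
  rewrite powRM ?(ltW s0) // sz -(ler_pM2r w0).
  apply: le_trans (relevant_dist A0 pC U0 hA hp) _.
  apply: (@le_trans _ _ ((2 * D) `^ z * V)).
    rewrite powRM //; last by apply: le_trans D1.
    by rewrite -mulrA ler_wpM2l ?powR_ge0.
  have hW : total_weight <= #|clients I|%:R * Q * weight p.
    apply: (@le_trans _ _ (\sum_(q in clients I) Q * weight p)).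
      by apply: ler_sum => q qC; apply: weight_le.
    by rewrite sumr_const -[leLHS]mulr_natl mulrA.
  have hV : V <= #|clients I|%:R * Q * (V / total_weight * weight p).
    rewrite [leRHS](_ : _ = V * (#|clients I|%:R * Q * weight p / total_weight)); last by ring.
    by rewrite ler_peMr // ler_pdivlMr // mul1r.
  apply: le_trans (ler_wpM2l (powR_ge0 _ _) hV) _.
  rewrite [leLHS]mulrA -[leRHS]mulrA ler_wpM2r ?(mulr_ge0 (ltW VW) (ltW w0)) //.
  apply: (@le_trans _ _ ((2 * D * (#|clients I|%:R * Q)) `^ z)); last first.
    by rewrite powR_le // mulr_ge0 // ltW.
  by rewrite [leRHS]powRM ?(ltW nQ0) // ler_wpM2l ?powR_ge0 // le1r_powR.
have small (v w : 'I_(npts I)) : total_weight * (delta v w / e) `^ z <= V \/ e * s < delta v w.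
  case: (ltP (e * s) (delta v w)) => h; [by right|left].
  rewrite mulrC -ler_pdivlMr // -sz powR_le //; first exact: divr_ge0 (delta_ge0 valid _ _) (ltW e0).
  by rewrite ler_pdivrMr // mulrC.
case: (sep _ _ xN yN xy); rewrite negb_or -!ltNge => /andP[h1 h2].
  case: (small x y) => [|h3]; first by rewrite leNgt h2.
  by split=> //; left.
rewrite (delta_sym valid x y).
case: (small y x) => [|h3]; first by rewrite leNgt h2.
by split=> //; right.
Qed.

End Nets.

(** * Arithmetic of the time bound *)

(** Raise [a <= k 2^(a / k)], with the quotient rounded down, to the power [k]. *)
Lemma leq_expn_mul_exp2 (a k : nat) : (0 < k)%N -> (a ^ k <= k ^ k * 2 ^ a)%N.
Proof.
move=> k0; have h : (a <= k * 2 ^ (a %/ k))%N.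
  rewrite {1}(divn_eq a k) (leq_trans (n := (k * (a %/ k).+1)%N)) //.
    by rewrite mulnS mulnC addnC leq_add2r ltnW ?ltn_mod.
  by rewrite leq_mul2l ltn_expl ?orbT.
apply: (leq_trans (n := ((k * 2 ^ (a %/ k)) ^ k)%N)); first by rewrite leq_exp2r.
by rewrite expnMn leq_mul2l -expnM leq_exp2l // leq_divM orbT.
Qed.

Lemma up_log2_le (a : nat) : (0 < a)%N -> (2 ^ up_log 2 a <= 2 * a)%N.
Proof.
move=> a0; have [->|l0] := posnP (up_log 2 a); first by rewrite expn0 muln_gt0.
have a1 : (1 < a)%N by move: l0; rewrite up_log_gt0 => /andP[].
have /andP[+ _] := up_log_bounds (isT : 1 < 2)%N a1.
by rewrite -{2}(prednK l0) expnS leq_pmul2l // => /ltnW.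
Qed.

Section TimeArithmetic.
Variable R : realType.

(** With [x = 1 / (2k)], Bernoulli gives [(1 + x)^(2k) >= 2], and [(1 - x)(1 + x) <= 1] turns this
    into [(1 - x)^(2k) <= 1/2]. So [l] blocks of [2k] factors outweigh [2m <= 2^l]. *)
Lemma rate_exp (k l m : nat) : (0 < k)%N -> (2 * m <= 2 ^ l)%N ->
  (1 - (2 * k%:R)^-1 : R) ^+ (2 * k * l) * (2 * m%:R) <= 1.
Proof.
move=> k0 hm; pose N := (2 * k)%N; have N0 : (0 < N)%N by rewrite muln_gt0.
have NR : 0 < N%:R :> R by rewrite ltr0n.
have N1 : 1 <= N%:R :> R by rewrite ler1n.
have -> : 2 * k%:R = N%:R :> R by rewrite natrM.
set y := 1 - _; set x : R := N%:R^-1.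
have x0 : 0 <= x by rewrite invr_ge0 ltW.
have x1 : x <= 1 by rewrite invf_le1.
have y0 : 0 <= y by rewrite subr_ge0.
have bern j : 1 + j%:R * x <= (1 + x) ^+ j.
  elim: j => [|j IHj]; first by rewrite mul0r addr0 expr0.
  rewrite exprS -(natr1 j); apply: le_trans (ler_wpM2l _ IHj); last by lra.
  have : 0 <= j%:R * x * x by rewrite !mulr_ge0.
  by move: (j%:R) => j'; lra.
have half : y ^+ N * 2 <= 1.
  have -> : 2 = 1 + N%:R * x :> R by rewrite /x divff ?gt_eqF.
  apply: le_trans (ler_wpM2l (exprn_ge0 _ y0) (bern N)) _.
  rewrite -exprMn exprn_ile1 //; first by rewrite mulr_ge0 // addr_ge0.
  by rewrite /y; have := mulr_ge0 x0 x0; rewrite -/x; lra.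
rewrite -natrM -/N exprM; apply: (@le_trans _ _ ((y ^+ N * 2) ^+ l)).
  by rewrite exprMn ler_wpM2l ?exprn_ge0 // -natrX ler_nat.
by rewrite exprn_ile1 // mulr_ge0 ?exprn_ge0.
Qed.

Lemma exists_halvings (x : R) : 1 <= x -> exists t : nat, x <= 2 ^+ t <= 2 * x.
Proof.
move=> x1.
have ex : exists t : nat, x <= 2 ^+ t.
  exists (Num.bound x); apply: ltW; apply: lt_trans (archi_boundP _) _; first by lra.
  by rewrite -natrX ltr_nat ltn_expl.
case: (ex_minnP ex) => t ht mt; exists t; rewrite ht /=.
case: t ht mt => [|t] ht mt; first by rewrite expr0; lra.
rewrite exprS ler_wpM2l // leNgt; apply/negP => /ltW /mt; by rewrite ltnn.
Qed.

Lemma poly_bound (q : {poly R}) : exists K e : nat, (0 < K)%N /\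
  forall n : nat, (0 < n)%N -> q.[n%:R] <= (K * n ^ e)%:R.
Proof.
elim/poly_ind: q => [|p a [K [e [K0 H]]]].
  by exists 1%N, 0%N; split=> // n n0; rewrite horner0.
exists (K + Num.bound `|a|)%N, e.+1; split; first by rewrite addn_gt0 K0.
move=> n n0; rewrite hornerMXaddC mulnDl natrD; apply: lerD.
  by rewrite expnSr mulnA natrM ler_wpM2r // H.
apply: le_trans (ler_norm a) _; apply: (@le_trans _ _ (Num.bound `|a|)%:R).
  exact/ltW/archi_boundP.
by rewrite ler_nat leq_pmulr // expn_gt0 n0.
Qed.

Lemma f_bound_ge1 C k (d eps z : R) : (0 < k)%N -> 0 < eps -> 0 <= d -> 1 <= z ->
  1 <= f_bound C k d eps z.
Proof.
move=> k0 e0 d0 z1; rewrite exprn_ege1 // mulr_ege1 //; last by rewrite le_max lexx.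
rewrite mulr_ege1 ?ler1n //.
have m0 : 0 < Num.min 1 eps by rewrite lt_min ltr01.
have X1 : 1 <= 2 `^ z / Num.min 1 eps.
  rewrite ler_pdivlMr // mul1r (@le_trans _ _ 1) ?ge_min ?lexx //.
  by rewrite -[leLHS](powRr0 2) ler_powR ?ler1n // (le_trans _ z1).
by rewrite -[leLHS](powRr0 (2 `^ z / Num.min 1 eps)) ler_powR.
Qed.

(** With [X = 2^z / min(1, eps)], the net has at most [k S^2 l X^(14 c d)] points, where [S] and [l]
    are logarithms. In the [k]-th power the logarithms contribute [k^(3k)] and the factor
    [2^(2S + l)], which is polynomial in [n] and [m]. The hypothesis [1 <= c d] lets powers of
    [X^(c d)] absorb the constants and [z]. *)
Lemma count_bound (c : R) (K e : nat) : 0 < c -> (0 < K)%N -> exists C D : nat,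
  forall (z eps d : R) (k n m t g L : nat)
    (Q := (K * n ^ e)%N) (S := up_log 2 (2 * (8 * n * Q ^ 2) * (n * Q))),
  1 <= z -> 0 < eps -> 0 <= d -> 1 <= c * d -> (0 < k)%N -> (0 < n)%N -> (0 < m)%N ->
  2 ^+ t <= 8 / (Num.min 1 eps / (16 * 4 `^ z)) ->
  2 ^+ g <= (8 * n * Q ^ 2)%:R `^ z :> R ->
  L%:R <= (k + g.+1 * (2 * k * up_log 2 (2 * m)))%:R * S.+1%:R * (2 `^ (c * d)) ^+ t ->
  (L ^ k)%:R <= f_bound C k d eps z * (D * (m + n) ^ D)%:R.
Proof.
(* [C] covers the exponent [14 c] of [X^d] and the 4 of [k^(4k)]. [D0] and [D1] are the coefficient
   and the degree of the bound [(2Y)^2 4m] on [2^(2S + l)], where [Y = 16 K^3 n^(3e + 2)]. *)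
move=> c0 K0; pose C := (Num.bound (14 * c) + 4)%N.
pose D0 := (32 * 32 * K ^ 6 * 4)%N; pose D1 := (6 * e + 5)%N.
exists C, (D0 + D1)%N => z eps d k n m t g L Q S z1 e0 d0 cd1 k0 n0 m0 ht hg hL.
set l := up_log 2 (2 * m) in hL.
have min0 : 0 < Num.min 1 eps by rewrite lt_min ltr01.
set X := 2 `^ z / Num.min 1 eps.
have zge0 : 0 <= z by apply: le_trans z1.
have p2z : 2 <= 2 `^ z :> R by rewrite le1r_powR // ler1n.
have X2z : 2 `^ z <= X.
  by rewrite ler_pdivlMr // ler_piMr ?powR_ge0 // ge_min lexx.
have X2 : 2 <= X by apply: le_trans X2z.
have X1 : 1 <= X by apply: le_trans X2; rewrite ler1n.
have X0 : 0 < X by apply: lt_le_trans X1.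
have Q0 : (0 < Q)%N by rewrite muln_gt0 K0 expn_gt0 n0.
pose Y := (2 * (8 * n * Q ^ 2) * (n * Q))%N.
have Y2 : (2 * (8 * n * Q ^ 2) <= Y)%N by rewrite leq_pmulr // muln_gt0 n0.
have Dpos : (0 < 8 * n * Q ^ 2)%N by rewrite 2!muln_gt0 n0 expn_gt0 Q0.
have Ypos : (0 < Y)%N by apply: leq_trans Y2; rewrite muln_gt0.
have YS : (Y <= 2 ^ S)%N by apply: up_logP.
have S0 : (0 < S)%N.
  by rewrite up_log_gt0 /= (leq_trans _ Y2) // (@leq_pmulr 2).
have l0 : (0 < l)%N by rewrite up_log_gt0 /= (@leq_pmulr 2).
have SR : 1 <= S%:R :> R by rewrite ler1n.
have lR : 1 <= l%:R :> R by rewrite ler1n.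
have kR : 1 <= k%:R :> R by rewrite ler1n.
have gS : g%:R <= z * S%:R.
  rewrite leNgt; apply/negP => h; suff : 2 ^+ g < 2 ^+ g :> R by rewrite ltxx.
  apply: le_lt_trans hg _.
  apply: (@le_lt_trans _ _ (2 `^ (S%:R * z))); last first.
    rewrite -powR_mulrn // /powR pnatr_eq0 /= ltr_expR ltr_pM2r; last by rewrite ln_gt0 // ltr1n.
    by rewrite mulrC.
  rewrite powRrM powR_le ?ler0n // powR_mulrn // -natrX ler_nat (leq_trans _ YS) //.
  by rewrite (leq_trans _ Y2) // leq_pmull.
have hA : (k + g.+1 * (2 * k * l))%:R <= 5 * k%:R * z * S%:R * l%:R :> R.
  rewrite natrD natrM -natr1 !natrM.
  apply: (@le_trans _ _ (k%:R * (z * S%:R * l%:R) + (z * S%:R + z * S%:R) * (2 * k%:R * l%:R))).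
    apply: lerD; first by rewrite ler_peMr // !mulr_ege1.
    rewrite ler_wpM2r ?mulr_ge0 // lerD // mulr_ege1 //.
  by rewrite le_eqVlt; apply/orP; left; apply/eqP; ring.
have hS : S.+1%:R <= 2 * S%:R :> R by rewrite -natr1; lra.
(* The hypothesis on [t] says [2^t <= 2^7 2^z X], and this is at most [X^9]. *)
have ht' : (2 `^ (c * d)) ^+ t <= X `^ (9 * (c * d)).
  rewrite -powR_mulrn ?powR_ge0 // -powRrM mulrC powRrM [leLHS]powRrM powR_mulrn //.
  apply: powR_le => //.
  apply: le_trans ht _.
  have -> : 8 / (Num.min 1 eps / (16 * 4 `^ z)) = 2 ^+ 7 * 2 `^ z * X.
    have -> : (4 : R) = 2 * 2 by ring.
    by rewrite powRM // /X; field; apply/andP; split; rewrite gt_eqF ?powR_gt0.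
  have -> : X `^ 9 = X ^+ 7 * X * X by rewrite powR_mulrn ?(ltW X0) //; ring.
  rewrite ler_wpM2r ?(ltW X0) // ler_pM ?powR_ge0 ?exprn_ge0 //.
  by rewrite lerXn2r // nnegrE ltW.
(* [10 z <= 2^4 2^z <= X^5]; together with the 9 above this makes the exponent 14. *)
have zX : 10 * z <= X `^ (5 * (c * d)).
  have z2 : z <= 2 `^ z.
    apply: ltW; apply: lt_le_trans (truncnS_gt z) _.
    apply: (@le_trans _ _ (2 `^ (Num.truncn z)%:R)); last first.
      by rewrite ler_powR ?ler1n // truncn_le.
    by rewrite powR_mulrn // -natrX ler_nat ltn_expl.
  apply: (@le_trans _ _ (X ^+ 5)).
    have h5 : 2 ^+ 4 * 2 `^ z <= X ^+ 5.
      by rewrite [X ^+ 5]exprSr ler_pM ?powR_ge0 ?exprn_ge0 // lerXn2r // nnegrE ltW.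
    by apply: le_trans h5; have := powR_ge0 2 z; lra.
  by rewrite -powR_mulrn ?(ltW X0) // ler_powR // ler_peMr.
have {hL} hL : L%:R <= k%:R * S%:R ^+ 2 * l%:R * X `^ (14 * (c * d)).
  apply: le_trans hL _.
  apply: (@le_trans _ _ (5 * k%:R * z * S%:R * l%:R * (2 * S%:R) * X `^ (9 * (c * d)))).
    by rewrite !ler_pM ?exprn_ge0 ?powR_ge0 ?mulr_ge0.
  have -> : X `^ (14 * (c * d)) = X `^ (5 * (c * d)) * X `^ (9 * (c * d)).
    rewrite -powRD; first by congr (_ `^ _); ring.
    by apply/implyP => _; rewrite gt_eqF.
  rewrite [leRHS]mulrA ler_wpM2r ?powR_ge0 //.
  apply: (@le_trans _ _ (k%:R * S%:R ^+ 2 * l%:R * (10 * z))).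
    by rewrite le_eqVlt; apply/orP; left; apply/eqP; ring.
  by rewrite ler_wpM2l // !mulr_ge0 // exprn_ge0.
have hLk : (L ^ k)%:R <= (k ^ (4 * k) * 2 ^ (2 * S + l))%:R * X `^ (14 * (c * d)) ^+ k.
  rewrite natrX; apply: (@le_trans _ _ ((k%:R * S%:R ^+ 2 * l%:R * X `^ (14 * (c * d))) ^+ k)).
    by rewrite lerXn2r // nnegrE ?ler0n // !mulr_ge0 ?exprn_ge0 ?powR_ge0.
  rewrite exprMn ler_wpM2r ?exprn_ge0 ?powR_ge0 //.
  rewrite -natrX -!natrM -natrX ler_nat.
  have hSk := leq_expn_mul_exp2 S k0; have hlk := leq_expn_mul_exp2 l k0.
  have -> : ((k * S ^ 2 * l) ^ k = k ^ k * (S ^ k * S ^ k) * l ^ k)%N.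
    by rewrite -mulnn !expnMn.
  have -> : (2 ^ (2 * S + l) = 2 ^ S * 2 ^ S * 2 ^ l)%N by rewrite expnD mul2n -addnn expnD.
  have -> : (k ^ (4 * k) = k ^ k * (k ^ k * k ^ k) * k ^ k)%N.
    by rewrite -!expnD; congr expn; ring.
  move: hSk hlk; move: (S ^ k)%N (l ^ k)%N (k ^ k)%N (2 ^ S)%N (2 ^ l)%N => a b x y w h1 h2.
  rewrite (leq_trans (n := (x * ((x * y) * (x * y)) * (x * w))%N)) //.
    by rewrite !leq_mul.
  by apply: eq_leq; ring.
apply: le_trans hLk _; rewrite natrM mulrAC; apply: ler_pM => //.
- by rewrite mulr_ge0 // exprn_ge0 ?powR_ge0.
- have Xd1 : 1 <= X `^ d by rewrite -[leLHS](powRr0 X) ler_powR.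
  rewrite /f_bound -/X -mulrA exprMn mulrC; apply: ler_pM => //.
  + by rewrite exprn_ge0 ?powR_ge0.
  + rewrite exprM lerXn2r // ?nnegrE ?powR_ge0 ?exprn_ge0 ?powR_ge0 //.
    rewrite -powR_mulrn ?powR_ge0 // -powRrM ler_powR // mulrA [d * _]mulrC ler_wpM2r //.
    have c14 : 0 <= 14 * c by rewrite mulr_ge0 // ltW.
    by rewrite natrD ler_wpDr // ltW // archi_boundP.
  rewrite natrX; apply: (@le_trans _ _ (k%:R ^+ (C * k))).
    by apply: ler_weXn2l => //; rewrite leq_mul2r leq_addl orbT.
  rewrite lerXn2r // ?nnegrE ?mulr_ge0 ?ler0n ?le_max ?ler01 //.
  by rewrite ler_peMr // le_max lexx.
rewrite ler_nat expnD [(2 * S)%N]mulnC expnM.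
have hY : (2 ^ S <= 2 * Y)%N by apply: up_log2_le.
have hl : (2 ^ l <= 2 * (2 * m))%N by apply: up_log2_le; rewrite muln_gt0.
apply: (leq_trans (n := ((2 * Y) ^ 2 * (2 * (2 * m)))%N)).
  by rewrite leq_mul // leq_exp2r.
have -> : ((2 * Y) ^ 2 * (2 * (2 * m)) = D0 * (n ^ (6 * e + 4) * m))%N.
  rewrite /Y /Q /D0 expnD [(6 * e)%N]mulnC expnM; move: (n ^ e)%N => a.
  by ring.
apply: leq_mul; first exact: leq_addr.
apply: (leq_trans (n := ((m + n) ^ D1)%N)); last first.
  by rewrite leq_pexp2l ?leq_addl // addn_gt0 m0.
rewrite /D1 (addnS (6 * e) 4) expnSr leq_mul ?leq_addr //.
by rewrite leq_exp2r ?leq_addl // addn_gt0 orbT.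
Qed.
End TimeArithmetic.

(** * The algorithm *)

Section Evaluation.
Variables (R : realType) (I : clustering_input R) (z eps : R).
Implicit Types (s : state R) (a b : nexp) (r t : rexp).

Lemma at_indexE (n : nat) (T : Type) (dflt : T) (f : 'I_n -> T) (i : 'I_n) :
  at_index dflt f i = f i.
Proof. by rewrite /at_index valK. Qed.

Lemma eval_NVar s v : neval I s (NVar v) = nv I s v 0. Proof. by []. Qed.
Lemma eval_NArr s v a : neval I s (NArr v a) = nv I s v (neval I s a). Proof. by []. Qed.
Lemma eval_NMem s a : neval I s (NMem a) = nmem s (neval I s a). Proof. by []. Qed.
Lemma eval_NConst s n : neval I s (NConst n) = n. Proof. by []. Qed.
Lemma eval_NAdd s a b : neval I s (NAdd a b) = (neval I s a + neval I s b)%N.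
Proof. by []. Qed.
Lemma eval_NCenters s : neval I s NCenters = ncenters I. Proof. by []. Qed.
Lemma eval_NIsClient s v (p : 'I_(npts I)) : nv I s v 0 = p ->
  neval I s (NIsClient (NVar v)) = (p \in clients I).
Proof. by rewrite -eval_NVar /= => ->; rewrite at_indexE. Qed.
Lemma eval_NIsFacility s v (p : 'I_(npts I)) : nv I s v 0 = p ->
  neval I s (NIsFacility (NVar v)) = (p \in facilities I).
Proof. by rewrite -eval_NVar /= => ->; rewrite at_indexE. Qed.
Lemma eval_NInGroup s v w (i : 'I_(ngroups I)) (p : 'I_(npts I)) :
  nv I s v 0 = i -> nv I s w 0 = p ->
  neval I s (NInGroup (NVar v) (NVar w)) = (p \in @group R I i).
Proof. by rewrite -!eval_NVar /= => -> ->; rewrite !at_indexE. Qed.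

Definition RZero : rexp := RSub ROne ROne.
Definition RTwo : rexp := RAdd ROne ROne.
Definition RFour : rexp := RMul RTwo RTwo.

Lemma eval_ROne s : reval I z eps s ROne = 1. Proof. by []. Qed.
Lemma eval_RZero s : reval I z eps s RZero = 0. Proof. by rewrite /= subrr. Qed.
Lemma eval_RTwo s : reval I z eps s RTwo = 2. Proof. by []. Qed.
Lemma eval_RFour s : reval I z eps s RFour = 4.
Proof. by rewrite /=; ring. Qed.
Lemma eval_RVar s v : reval I z eps s (RVar v) = rv s v 0. Proof. by []. Qed.
Lemma eval_RArr s v a : reval I z eps s (RArr v a) = rv s v (neval I s a).
Proof. by []. Qed.
Lemma eval_RAdd s r t : reval I z eps s (RAdd r t) = reval I z eps s r + reval I z eps s t.
Proof. by []. Qed.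
Lemma eval_RSub s r t : reval I z eps s (RSub r t) = reval I z eps s r - reval I z eps s t.
Proof. by []. Qed.
Lemma eval_RMul s r t : reval I z eps s (RMul r t) = reval I z eps s r * reval I z eps s t.
Proof. by []. Qed.
Lemma eval_RDiv s r t : reval I z eps s (RDiv r t) = reval I z eps s r / reval I z eps s t.
Proof. by []. Qed.
Lemma eval_RPowZ s r : reval I z eps s (RPowZ r) = reval I z eps s r `^ z.
Proof. by []. Qed.
Lemma eval_REps s : reval I z eps s REps = eps. Proof. by []. Qed.
Lemma eval_RDelta s a b (x y : 'I_(npts I)) : neval I s a = x -> neval I s b = y ->
  reval I z eps s (RDelta a b) = delta x y.
Proof. by move=> /= -> ->; rewrite !at_indexE. Qed.
Lemma eval_RDeltaV s v w (x y : 'I_(npts I)) : nv I s v 0 = x -> nv I s w 0 = y ->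
  reval I z eps s (RDelta (NVar v) (NVar w)) = delta x y.
Proof. by rewrite -!eval_NVar; apply: eval_RDelta. Qed.
Lemma eval_RWeight s v (x : 'I_(npts I)) : nv I s v 0 = x ->
  reval I z eps s (RWeight (NVar v)) = weight x.
Proof. by rewrite -eval_NVar /= => ->; rewrite at_indexE. Qed.

Lemma eval_TNatLt s a b : teval I z eps s (TNatLt a b) = (neval I s a < neval I s b)%N.
Proof. by []. Qed.
Lemma eval_TRealLe s r t :
  teval I z eps s (TRealLe r t) = (reval I z eps s r <= reval I z eps s t).
Proof. by []. Qed.

Lemma sum_lt_ordS (n : nat) (P : pred 'I_n) (F : 'I_n -> R) (i : 'I_n) :
  \sum_(j | P j && (j < i.+1)%N) F j =
  \sum_(j | P j && (j < i)%N) F j + (if P i then F i else 0).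
Proof.
case: ifPn => Pi; last first.
  rewrite addr0; apply: eq_bigl => j; rewrite ltnS leq_eqVlt.
  by case: eqVneq => [/val_inj ->|] //=; rewrite (negbTE Pi).
rewrite (bigD1 i) /=; last by rewrite Pi ltnS leqnn.
rewrite addrC; congr (_ + _); apply: eq_bigl => j.
by case: (P j) => //=; rewrite ltnS [(j < i)%N]ltn_neqAle andbC.
Qed.

End Evaluation.

Definition evalE := (eval_NVar, eval_NArr, eval_NMem, eval_NConst, eval_NAdd,
  eval_NCenters, eval_ROne, eval_RZero, eval_RTwo, eval_RFour, eval_RVar,
  eval_RArr, eval_RAdd, eval_RSub, eval_RMul, eval_RDiv, eval_RPowZ, eval_REps,
  eval_TNatLt, eval_TRealLe).
Definition denE := (den_Skip, den_SetN, den_SetR, den_Mark, den_Seq, den_If).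

Arguments neval : simpl never.
Arguments reval : simpl never.
Arguments teval : simpl never.

(* Memory layout: [i] marks loop counters, [a] the other natural arrays and [r] the
   real ones.  For a solution [A] kept as the array [rD] of the distances to [A], [aF]
   is the argument facility of a subprogram and [aIn] some element of [A]; [rUp] and
   [rLow] hold an upper and a lower bound on the optimum, and [rU] the inverse of the
   greedy threshold, so that its initial value 0 is an infinite threshold. *)
Local Notation iP := 0%N (only parsing).
Local Notation iX := 1%N (only parsing).
Local Notation iG := 2%N (only parsing).
Local Notation iJ := 3%N (only parsing).
Local Notation iQ := 4%N (only parsing).
Local Notation aF := 5%N (only parsing).
Local Notation aAny := 6%N (only parsing).
Local Notation aCnt := 7%N (only parsing).
Local Notation aGo := 8%N (only parsing).
Local Notation aSel := 9%N (only parsing).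
Local Notation aNet := 10%N (only parsing).
Local Notation aLen := 11%N (only parsing).
Local Notation aIdx := 12%N (only parsing).
Local Notation aBest := 13%N (only parsing).
Local Notation aCarry := 14%N (only parsing).
Local Notation aAct := 15%N (only parsing).
Local Notation aRel := 16%N (only parsing).
Local Notation aIn := 17%N (only parsing).
Local Notation aHas := 18%N (only parsing).
Local Notation iR := 19%N (only parsing).

Local Notation rD := 0%N (only parsing).
Local Notation rC := 1%N (only parsing).
Local Notation rM := 2%N (only parsing).
Local Notation rU := 3%N (only parsing).
Local Notation rPhi := 4%N (only parsing).
Local Notation rPhiF := 5%N (only parsing).
Local Notation rE := 6%N (only parsing).
Local Notation rW := 7%N (only parsing).
Local Notation rK := 8%N (only parsing).
Local Notation rBest := 9%N (only parsing).
Local Notation rUp := 10%N (only parsing).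
Local Notation rLow := 11%N (only parsing).
Local Notation rNear := 12%N (only parsing).

Local Notation "'SET' v <- e" := (SetN v (NConst 0) e) (at level 50, v at level 0).
Local Notation "'SETR' v <- e" := (SetR v (NConst 0) e) (at level 50, v at level 0).
Local Notation "a ;; b" := (Seq a b) (at level 60, right associativity).
Local Notation "'NZ' e" := (TNatLt (NConst 0) e) (at level 9, e at level 8).

Definition init_dist : cmd :=
  Block (For iP AllPoints (SetR rD (NVar iP) (RDelta (NVar iP) (NVar aF)))).

Definition add_center : cmd :=
  Block (For iP AllPoints
    (If (TRealLe (RArr rD (NVar iP)) (RDelta (NVar iP) (NVar aF))) Skip
       (SetR rD (NVar iP) (RDelta (NVar iP) (NVar aF))))).

Definition add_cost (e : rexp) : cmd :=
  SETR rC <- RAdd (RVar rC) (RMul (RWeight (NVar iP)) (RPowZ e)).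

(* The cost after adding the facility [aF], which is the cost of the current solution
   when [aF] already belongs to it. *)
Definition compute_group_cost : cmd :=
  Block (SETR rC <- RZero ;; For iP AllPoints
    (If (NZ (NInGroup (NVar iG) (NVar iP)))
       (If (TRealLe (RArr rD (NVar iP)) (RDelta (NVar iP) (NVar aF)))
          (add_cost (RArr rD (NVar iP)))
          (add_cost (RDelta (NVar iP) (NVar aF))))
       Skip)).

Definition compute_cost : cmd :=
  Block (SETR rM <- RZero ;; For iG AllGroups
    (compute_group_cost ;;
     If (TRealLe (RVar rC) (RVar rM)) Skip (SETR rM <- RVar rC))).

Definition find_facility : cmd :=
  Block (For iX AllPoints (If (NZ (NIsFacility (NVar iX))) (SET aAny <- NVar iX) Skip)).

Definition find_nearest : cmd :=
  Block (SET aF <- NVar aAny ;; For iX AllPoints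
    (If (NZ (NIsFacility (NVar iX)))
       (If (TRealLe (RDelta (NVar iQ) (NVar aF)) (RDelta (NVar iQ) (NVar iX))) Skip
          (SET aF <- NVar iX))
       Skip)).

(** [rK] is [2k], accumulated in a loop because the machine cannot convert naturals to reals. [rE]
    is the resolution of the net; its 16 is a constant that the program can build from 1 and that
    exceeds the 6 of [snap_cost]. *)
Definition compute_constants : cmd :=
  Block (
    SETR rK <- RZero ;;
    For iJ AllCenters (SETR rK <- RAdd (RVar rK) RTwo) ;;
    SETR rW <- RZero ;;
    For iP AllPoints (If (NZ (NIsClient (NVar iP)))
      (SETR rW <- RAdd (RVar rW) (RWeight (NVar iP))) Skip) ;;
    SETR rE <- RMul (RMul RFour RFour) (RPowZ RFour) ;;
    If (TRealLe ROne REps) (SETR rE <- RDiv ROne (RVar rE)) (SETR rE <- RDiv REps (RVar rE))).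

(* The facilities nearest to the first k clients: an optimal solution if there are at
   most k clients, and otherwise an upper bound comparable to the lower bound that
   two clients sharing a center provide. *)
Definition initial_centers : cmd :=
  Block (
    SET aF <- NVar aAny ;; init_dist ;; SET aCnt <- NConst 0 ;; SETR rNear <- RZero ;;
    For iQ AllPoints
      (If (NZ (NIsClient (NVar iQ)))
         (If (TNatLt (NVar aCnt) NCenters)
            (find_nearest ;;
             If (NZ (NVar aCnt)) add_center init_dist ;;
             SET aCnt <- NAdd (NVar aCnt) (NConst 1) ;;
             SETR rNear <- RMul (RWeight (NVar iQ)) (RPowZ (RDelta (NVar iQ) (NVar aF))))
            Skip)
         Skip)).

Definition pair_cost : rexp :=
  RMul (RWeight (NVar iQ)) (RPowZ (RDiv (RDelta (NVar iQ) (NVar iX)) RTwo)).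

(** [rLow] starts at the cost of the initial centers and is lowered to the cheapest pair. Raising it
    to [rNear] keeps it below the optimum and makes the gap to [rUp] controllable. *)
Definition cost_bounds : cmd :=
  Block (
    compute_cost ;; SETR rUp <- RVar rM ;; SETR rLow <- RVar rM ;;
    For iQ AllPoints (For iX AllPoints
      (If (NZ (NIsClient (NVar iQ)))
         (If (NZ (NIsClient (NVar iX)))
            (If (TRealLe (RDelta (NVar iQ) (NVar iX)) RZero) Skip
               (If (TRealLe (RVar rLow) pair_cost) Skip (SETR rLow <- pair_cost)))
            Skip)
         Skip)) ;;
    If (TRealLe (RVar rNear) (RVar rLow)) Skip (SETR rLow <- RVar rNear)).

Definition active_costs : cmd :=
  Block (
    SETR rPhi <- RZero ;;
    For iG AllGroups
      (compute_group_cost ;;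
       If (TRealLe (RMul (RVar rC) (RVar rU)) ROne)
         (SetN aAct (NVar iG) (NConst 0))
         (SetN aAct (NVar iG) (NConst 1) ;; SETR rPhi <- RAdd (RVar rPhi) (RVar rC)))).

Definition active_costs_with : cmd :=
  Block (
    SETR rPhiF <- RZero ;;
    For iG AllGroups
      (If (NZ (NArr aAct (NVar iG)))
         (compute_group_cost ;; SETR rPhiF <- RAdd (RVar rPhiF) (RVar rC)) Skip)).

Definition select_center : cmd :=
  Block (
    SET aGo <- NConst 0 ;;
    For iX AllPoints
      (If (NZ (NIsFacility (NVar iX)))
         (SET aF <- NVar iX ;; active_costs_with ;;
          If (TRealLe (RMul (RVar rK) (RVar rPhiF)) (RMul (RSub (RVar rK) ROne) (RVar rPhi)))
            (SET aGo <- NConst 1 ;; SET aSel <- NVar iX) Skip)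
         Skip)).

Definition greedy_step : cmd :=
  Block (
    SET aF <- NVar aIn ;; compute_cost ;;
    If (TRealLe (RVar rM) (RVar rLow)) (SET aGo <- NConst 0)
      (If (TRealLe (RMul (RVar rM) (RVar rU)) ROne) (SETR rU <- RDiv RTwo (RVar rM)) Skip ;;
       active_costs ;; select_center ;;
       If (NZ (NVar aGo)) (SET aF <- NVar aSel ;; add_center) Skip)).

(** Each round that continues has added a facility not chosen before, so a loop over the points is
    long enough. *)
Definition greedy : cmd :=
  Block (
    SET aIn <- NVar aF ;; SET aGo <- NConst 1 ;; SETR rU <- RZero ;;
    For iR AllPoints (If (NZ (NVar aGo)) greedy_step Skip)).

Definition check_relevant : cmd :=
  Block (
    SET aRel <- NConst 0 ;;
    For iP AllPoints
      (If (NZ (NIsClient (NVar iP)))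
         (If (TRealLe (RMul (RWeight (NVar iP)) (RPowZ (RDelta (NVar iP) (NVar iX)))) (RVar rUp))
            (SET aRel <- NConst 1) Skip)
         Skip)).

Definition check_covered : cmd :=
  let d := RDelta (NVar iX) (NArr aNet (NVar iJ)) in
  Block (
    For iJ AllPoints
      (If (TNatLt (NVar iJ) (NVar aLen))
         (If (TRealLe d (RMul (RVar rE) (RArr rD (NVar iX)))) (SET aRel <- NConst 0)
            (If (TRealLe (RMul (RVar rW) (RPowZ (RDiv d (RVar rE)))) (RVar rLow))
               (SET aRel <- NConst 0) Skip))
         Skip)).

Definition build_net : cmd :=
  Block (
    SetN aNet (NConst 0) (NVar aIn) ;; SET aLen <- NConst 1 ;;
    For iX AllPoints
      (If (NZ (NIsFacility (NVar iX)))
         (check_relevant ;; check_covered ;;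
          If (NZ (NVar aRel))
            (SetN aNet (NVar aLen) (NVar iX) ;; SET aLen <- NAdd (NVar aLen) (NConst 1)) Skip)
         Skip)).

Definition prepare : cmd :=
  Block (find_facility ;; compute_constants ;; initial_centers ;; cost_bounds ;; greedy ;;
         build_net).

Definition tuple_center (j : nexp) : nexp := NArr aNet (NArr aIdx j).

Definition tuple_cost : cmd :=
  Block (
    SET aF <- tuple_center (NConst 0) ;; init_dist ;;
    For iJ AllCenters (SET aF <- tuple_center (NVar iJ) ;; add_center) ;;
    compute_cost).

Definition record_best : cmd :=
  Block (
    If (NZ (NVar aHas)) Skip (SETR rBest <- RVar rM) ;;
    SET aHas <- NConst 1 ;;
    If (TRealLe (RVar rM) (RVar rBest))
      (SETR rBest <- RVar rM ;;
       For iJ AllCenters (SetN aBest (NVar iJ) (tuple_center (NVar iJ)))) Skip).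

(* The index array is a k-digit counter in base [aLen]. *)
Definition next_tuple : cmd :=
  Block (
    SET aCarry <- NConst 1 ;;
    For iJ AllCenters
      (If (NZ (NVar aCarry))
         (If (TNatLt (NAdd (NArr aIdx (NVar iJ)) (NConst 1)) (NVar aLen))
            (SetN aIdx (NVar iJ) (NAdd (NArr aIdx (NVar iJ)) (NConst 1)) ;;
             SET aCarry <- NConst 0)
            (SetN aIdx (NVar iJ) (NConst 0)))
         Skip)).

Definition try_tuple : cmd := Block (tuple_cost ;; record_best ;; next_tuple).

Definition output_point (x : nexp) : cmd :=
  If (NZ (NMem x)) Skip (Mark x ;; SET aCnt <- NAdd (NVar aCnt) (NConst 1)).

(** The entries of a tuple may coincide, so the set is filled up with further facilities to exactly
    [k] elements; this cannot increase the cost. *)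
Definition write_output : cmd :=
  Block (
    SET aCnt <- NConst 0 ;;
    For iJ AllCenters (output_point (NArr aBest (NVar iJ))) ;;
    For iX AllPoints
      (If (NZ (NIsFacility (NVar iX)))
         (If (TNatLt (NVar aCnt) NCenters) (output_point (NVar iX)) Skip)
         Skip)).

(** After the last tuple the counter overflows and leaves the carry 1 that ends the while loop. *)
Definition clustering_program : program :=
  PSeq (compile prepare)
    (PSeq (PWhile (TNatLt (NVar aCarry) (NConst 1)) (compile try_tuple))
       (compile write_output)).

(** * Correctness of the subprograms *)

Section DistanceSpecs.
Variables (R : realType) (I : clustering_input R) (z eps : R).
Hypotheses (valid : valid_input I) (z1 : 1 <= z).
Implicit Types (s : state R) (A : {set 'I_(npts I)}) (f x y p q : 'I_(npts I)).

Local Notation nv := (nv I).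
Local Notation den := (den I z eps).
Local Notation setn := (setn I).
Local Notation neval := (neval I).
Local Notation reval := (reval I z eps).

Definition dist_is A s : Prop := forall p, rv s rD p = dist_to_set A p.

Lemma init_dist_spec s f : nv s aF 0 = f -> dist_is [set f] (den init_dist s).
Proof.
move=> hf p; rewrite dist_set1 // den_Block.
apply: (den_for_points (Inv := fun i s => forall p, (p < i)%N -> rv s rD p = delta p f)) => //.
move=> x s' Ex Hn Hr _ Hs {}p hp.
have Ed := eval_RDeltaV z eps Ex (etrans (Hn aF _ isT) hf).
rewrite rv_setn denE rv_setr // Ed !evalE Ex /=.
case: eqP => [/val_inj -> //|ne].
by apply: Hs; move: hp; rewrite ltnS leq_eqVlt => /orP[/eqP/ne|].
Qed.

Lemma add_center_spec s A f : A != set0 -> dist_is A s -> nv s aF 0 = f ->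
  dist_is (f |: A) (den add_center s).
Proof.
move=> A0 hD hf p; rewrite den_Block -[RHS](_ : (if (p < npts I)%N then
  dist_to_set (f |: A) p else dist_to_set A p) = _); last by rewrite ltn_ord.
move: p; apply: (den_for_points (Inv := fun i s => forall p, rv s rD p =
   if (p < i)%N then dist_to_set (f |: A) p else dist_to_set A p)) => //.
move=> x s' Ex Hn Hr _ Hs p.
have Ed := eval_RDeltaV z eps Ex (etrans (Hn aF _ isT) hf).
have E0 := Hs x; rewrite ltnn in E0; have E1 := dist_setU1 f x A0.
rewrite rv_setn denE !evalE Ex Ed E0 ltnS leq_eqVlt.
case: ifP => h; rewrite denE ?rv_setr //= ?evalE ?Ex ?Ed.
  rewrite Hs; case: eqP => //= /val_inj ->.
  by rewrite ltnn E1 min_l.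
case: eqP => [/val_inj ->|ne] /=; last exact: Hs.
by rewrite E1 min_r // ltW // ltNge h.
Qed.

Lemma compute_group_cost_spec s A f (i : 'I_(ngroups I)) : A != set0 -> dist_is A s ->
  nv s aF 0 = f -> nv s iG 0 = i ->
  rv (den compute_group_cost s) rC 0 = group_cost z (f |: A) i.
Proof.
move=> A0 hD hf hi; rewrite den_Block denE; set s0 := den (SETR rC <- RZero) s.
transitivity (\sum_(p in group i | (p < npts I)%N) weight p * dist_to_set (f |: A) p `^ z).
  apply: (den_for_points (Inv := fun j s => rv s rC 0 =
    \sum_(p in group i | (p < j)%N) weight p * dist_to_set (f |: A) p `^ z)) => //.
    rewrite rv_setn /s0 denE !evalE rv_setr //= big_pred0 // => p.
    by rewrite ltn0 andbF.
  move=> x s' Ex Hn Hr _ Hs.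
  have Ed := eval_RDeltaV z eps Ex (etrans (Hn aF _ isT) hf).
  have Ew := eval_RWeight z eps Ex.
  have Eg := eval_NInGroup (etrans (Hn iG _ isT) hi) Ex.
  have E0 : rv s' rD x = dist_to_set A x by rewrite Hr // /s0 denE rv_setr //= hD.
  have E1 := dist_setU1 f x A0.
  rewrite (sum_lt_ordS _ _ x) -Hs rv_setn denE !evalE Eg.
  case: (x \in group i) => /=; last by rewrite denE addr0.
  rewrite denE !evalE Ed Ex E0.
  case: ifP => h; rewrite /add_cost !denE rv_setr //= !evalE Ew ?Ed ?Ex ?E0.
    by rewrite E1 min_l.
  by rewrite E1 min_r // ltW // ltNge h.
by apply: eq_bigl => p; rewrite ltn_ord andbT.
Qed.

Lemma compute_cost_spec s A f : A != set0 -> dist_is A s -> nv s aF 0 = f ->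
  rv (den compute_cost s) rM 0 = robust_cost z (f |: A).
Proof.
move=> A0 hD hf; rewrite den_Block denE; set s0 := den (SETR rM <- RZero) s.
suff [h0 h1 h2] : let M := rv (den (For iG AllGroups (compute_group_cost ;;
     If (TRealLe (RVar rC) (RVar rM)) Skip (SETR rM <- RVar rC))) s0) rM 0 in
    [/\ 0 <= M, forall i : 'I_(ngroups I), (i < ngroups I)%N -> group_cost z (f |: A) i <= M &
      M <= robust_cost z (f |: A)].
  apply/eqP; rewrite eq_le h2; apply: robust_cost_le => // i; exact: h1.
apply: (den_for_groups (Inv := fun j s => let M := rv s rM 0 in
    [/\ 0 <= M, forall i : 'I_(ngroups I), (i < j)%N -> group_cost z (f |: A) i <= M &
      M <= robust_cost z (f |: A)])) => //.
  by rewrite /= rv_setn /s0 denE rv_setr //= evalE; split=> //; exact: robust_cost_ge0.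
move=> x s' Ex Hn Hr _ /= [h0 h1 h2]; rewrite rv_setn denE.
have Dx : dist_is A s' by move=> p; rewrite Hr // /s0 denE rv_setr //= hD.
have Ec := compute_group_cost_spec A0 Dx (etrans (Hn aF _ isT) hf) Ex.
rewrite denE !evalE Ec rv_den_free //.
case: (leP (group_cost z (f |: A) x) (rv s' rM 0)) => h; rewrite denE.
  rewrite rv_den_free //; split=> // i; rewrite ltnS leq_eqVlt => /orP[/eqP/val_inj -> //|].
  exact: h1.
rewrite rv_setr //= evalE Ec; split; [exact: group_cost_ge0| |exact: group_cost_le].
move=> i; rewrite ltnS leq_eqVlt => /orP[/eqP/val_inj -> //|/h1 /le_trans]; apply.
exact: ltW.
Qed.

End DistanceSpecs.

(** * Constants and initial centers *)

Section PreparationSpecs.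
Variables (R : realType) (I : clustering_input R) (z eps : R).
Hypotheses (valid : valid_input I) (z1 : 1 <= z).
Implicit Types (s : state R) (A : {set 'I_(npts I)}) (f x y p q any : 'I_(npts I)).

Local Notation nv := (nv I).
Local Notation den := (den I z eps).
Local Notation setn := (setn I).
Local Notation neval := (neval I).
Local Notation reval := (reval I z eps).

Lemma find_facility_spec s :
  exists2 f, f \in facilities I & nv (den find_facility s) aAny 0 = f.
Proof.
have : (0 < #|facilities I|)%N.
  by case: valid => _ _ _ _ /andP[k0 kF]; apply: leq_trans kF.
rewrite card_gt0 => /set0Pn[f0 f0F].
suff [[f fF E]|/(_ f0 f0F)] :
  (exists2 f, f \in facilities I & nv (den find_facility s) aAny 0 = f) \/
  (forall f, f \in facilities I -> (npts I <= f)%N); [by exists f| |].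
  by rewrite leqNgt ltn_ord.
rewrite den_Block.
apply: (den_for_points (Inv := fun i s =>
  (exists2 f, f \in facilities I & nv s aAny 0 = f) \/
  (forall f, f \in facilities I -> (i <= f)%N))) => //; first by right.
move=> x s' Ex _ _ _ Hs; rewrite denE !evalE (eval_NIsFacility Ex).
case: ifPn => xF; rewrite denE nv_setn //=.
  left; exists x; last by rewrite nv_setn // !evalE.
  by move: xF; rewrite lt0b.
case: Hs => [?|H]; [by left|right] => f fF.
rewrite ltn_neqAle H // andbT; apply: contra xF => /eqP/val_inj ->.
by rewrite fF.
Qed.

Lemma find_nearest_spec s q any : nv s iQ 0 = q -> nv s aAny 0 = any ->
  any \in facilities I ->
  exists f, [/\ f \in facilities I, nv (den find_nearest s) aF 0 = f &
    forall x, x \in facilities I -> delta q f <= delta q x].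
Proof.
move=> hq hany anyF; rewrite den_Block denE.
suff [f [fF E H]] : exists f, [/\ f \in facilities I,
    nv (den (For iX AllPoints
    (If (NZ (NIsFacility (NVar iX)))
       (If (TRealLe (RDelta (NVar iQ) (NVar aF)) (RDelta (NVar iQ) (NVar iX))) Skip
          (SET aF <- NVar iX))
       Skip)) (den (SET aF <- NVar aAny) s)) aF 0 = f &
    forall x, x \in facilities I -> (x < npts I)%N -> delta q f <= delta q x].
  by exists f; split=> // x xF; apply: H.
apply: (den_for_points (Inv := fun i s => exists f, [/\ f \in facilities I,
    nv s aF 0 = f & forall x, x \in facilities I -> (x < i)%N -> delta q f <= delta q x])) => //.
  by exists any; split=> //; rewrite denE !nv_setn //= evalE.
move=> x s' Ex Hn _ _ [f [fF Ef H]].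
have Eq : nv s' iQ 0 = q by rewrite Hn // denE nv_setn.
have Ed := eval_RDeltaV z eps Eq Ef.
have Ed' := eval_RDeltaV z eps Eq Ex.
rewrite denE !evalE (eval_NIsFacility Ex) lt0b.
case: ifPn => xF; last first.
  rewrite denE; exists f; split=> //; first by rewrite nv_setn.
  move=> y yF; rewrite ltnS leq_eqVlt => /orP[/eqP/val_inj yx|]; last exact: H.
  by rewrite yx (negbTE xF) in yF.
rewrite denE !evalE Ed Ed'; case: leP => h; rewrite denE.
  exists f; split=> //; first by rewrite nv_setn.
  move=> y yF; rewrite ltnS leq_eqVlt => /orP[/eqP/val_inj -> //|]; exact: H.
exists x; split=> //; first by rewrite !nv_setn //= !evalE.
move=> y yF; rewrite ltnS leq_eqVlt => /orP[/eqP/val_inj -> //|hy].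
exact: le_trans (ltW h) (H _ yF hy).
Qed.

Lemma compute_constants_spec s (s' := den compute_constants s) :
  [/\ rv s' rK 0 = 2 * (ncenters I)%:R, rv s' rW 0 = total_weight I &
      rv s' rE 0 = Num.min 1 eps / (16 * 4 `^ z)].
Proof.
rewrite {}/s' den_Block 5!denE.
set s1 := den (For iJ _ _) _.
have E1 : rv s1 rK 0 = 2 * (ncenters I)%:R.
  apply: (den_for_centers (Inv := fun j s => rv s rK 0 = 2 * j%:R)) => //.
    by rewrite rv_setn denE rv_setr //= evalE mulr0.
  move=> x s' Ex Hn _ _ Hs; rewrite rv_setn denE rv_setr //= !evalE Hs.
  by rewrite -(natr1 (x : nat)) mulrDr mulr1.
set s2 := den (For iP _ _) _.
have E2 : rv s2 rW 0 = total_weight I.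
  rewrite /total_weight; transitivity (\sum_(p in clients I | (p < npts I)%N) @weight R I p);
    last by apply: eq_bigl => p; rewrite ltn_ord andbT.
  apply: (den_for_points (Inv := fun j s => rv s rW 0 =
     \sum_(p in clients I | (p < j)%N) weight p)) => //.
    by rewrite rv_setn denE rv_setr //= evalE big_pred0 // => p; rewrite ltn0 andbF.
  move=> x s' Ex _ _ _ Hs; rewrite (sum_lt_ordS _ _ x) -Hs rv_setn denE !evalE.
  rewrite (eval_NIsClient Ex) lt0b; case: (x \in clients I); rewrite denE ?addr0 //.
  by rewrite rv_setr //= !evalE (eval_RWeight z eps Ex).
have EK : rv s2 rK 0 = 2 * (ncenters I)%:R.
  by rewrite rv_den_free // rv_den_free.
have EQ : 4 * 4 * 4 `^ z = 16 * 4 `^ z by ring.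
rewrite !denE !evalE; case: leP => h; split; rewrite ?rv_setr //= ?evalE ?rv_setr //= EQ //.
Qed.

(** No solution serves [p] at a lower cost, so [r] bounds the optimum from below; once [V] is raised
    to [r], it is also the bound that [cost_gap] needs on the pair [p0], [f0]. *)
Definition nearest_cost (A : {set 'I_(npts I)}) (r : R) : Prop :=
  exists p f, [/\ p \in clients I, f \in A, r = weight p * delta p f `^ z &
    forall x, x \in facilities I -> delta p f <= delta p x].

Definition is_start A (r : R) : Prop :=
  [/\ A != set0, A \subset facilities I, (#|A| <= ncenters I)%N,
    (clients I = set0 /\ r = 0) \/ nearest_cost A r &
    (#|clients I| <= ncenters I)%N -> forall p x, p \in clients I -> x \in facilities I ->
      dist_to_set A p <= delta p x].

Lemma initial_centers_spec s any : nv s aAny 0 = any -> any \in facilities I ->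
  exists A f, [/\ is_start A (rv (den initial_centers s) rNear 0),
    dist_is A (den initial_centers s), f \in A & nv (den initial_centers s) aF 0 = f].
Proof.
move=> hany anyF; rewrite den_Block 4!denE.
set s1 := den (SETR rNear <- RZero) _.
(* [C j] collects the clients met so far. The [maxn 1] in the invariant accounts for the placeholder
   facility that forms the solution until the first client replaces it. *)
pose C j := [set p in clients I | (p < j)%N].
pose Inv j (s : state R) := exists A f (cnt := nv s aCnt 0) (r := rv s rNear 0),
  [/\ [/\ A != set0, A \subset facilities I, f \in A & (#|A| <= maxn 1 cnt)%N],
   [/\ (cnt <= #|C j|)%N, (cnt <= ncenters I)%N & cnt = 0%N -> C j = set0 /\ r = 0],
   (0 < cnt)%N -> nearest_cost A r,
   (#|clients I| <= ncenters I)%N -> forall p x, p \in C j -> x \in facilities I ->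
      dist_to_set A p <= delta p x &
   dist_is A s /\ nv s aF 0 = f].
have k0 : (0 < ncenters I)%N by case: valid => _ _ _ _ /andP[].
set s2 := den (For iQ _ _) s1.
have Cn : C (npts I) = clients I by apply/setP => p; rewrite inE ltn_ord andbT.
suff [A [f [[A0 AF fA hA] [h1 h2 h3] h4 h5 [h6 h7]]]] : Inv (npts I) s2.
  exists A, f; split=> //; split=> //.
  - by rewrite (leq_trans hA) // geq_max k0 h2.
  - case: (posnP (nv s2 aCnt 0)) => [/h3|/h4]; last by right.
    by rewrite Cn; left.
  - by move=> hn p x pC; apply: h5 => //; rewrite Cn.
apply: den_for_points => //.
  exists [set any], any => /=; rewrite !nv_setn //= !rv_setn.
  have -> : nv s1 aCnt 0 = 0%N by rewrite /s1 !denE nv_setr nv_setn //= evalE.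
  have -> : rv s1 rNear 0 = 0 by rewrite /s1 denE rv_setr //= evalE.
  have C0 : C 0%N = set0 by apply/setP => p; rewrite !inE ltn0 andbF.
  split=> //.
  - rewrite sub1set cards1 set11 anyF; split=> //.
    by apply/set0Pn; exists any; rewrite set11.
  - by move=> _ p x; rewrite C0 inE.
  - rewrite /s1 !denE nv_setr nv_setn //= nv_den_free // nv_setn //= evalE.
    split=> // p; rewrite rv_setn rv_setr //= rv_setn.
    by apply: init_dist_spec; rewrite nv_setn //= evalE.
move=> q s' Eq Hn _ _ [A [f [[A0 AF fA hA] [h1 h2 h3] h4 h5 [hD hf]]]].
have CS : C q.+1 = if q \in clients I then q |: C q else C q.
  apply/setP => p; have [->|pq] := eqVneq p q.
    by case: ifP => qC; rewrite !inE ?eqxx qC // ltnS leqnn.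
  have E : (p < q.+1)%N = (p < q)%N by rewrite ltnS leq_eqVlt (negbTE pq : (p == q :> nat) = false).
  by case: ifP => qC; rewrite !inE ?(negbTE pq) E.
have qCq : q \notin C q by rewrite inE ltnn andbF.
rewrite denE !evalE (eval_NIsClient Eq) lt0b; case: ifPn => qC; last first.
  rewrite denE; exists A, f => /=; rewrite !nv_setn //= !rv_setn CS (negbTE qC).
  by split.
rewrite denE !evalE; set cnt := nv s' aCnt 0 in hA h1 h2 h3 h4 *.
rewrite qC in CS.
case: ltnP => hk; last first.
  rewrite denE; exists A, f => /=; rewrite !nv_setn //= !rv_setn -/cnt.
  split=> //.
  - split=> //; first by rewrite (leq_trans h1) // CS subset_leq_card // subsetUr.
    by move=> c0; rewrite c0 leqNgt k0 in hk.
  (* A further client after [k] of them have been served means more than [k] clients, so the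
     optimality clause holds vacuously. *)
  - move=> hn; suff : (#|C q.+1| <= #|clients I|)%N.
      by rewrite CS cardsU1 qCq add1n leqNgt ltnS (leq_trans hn) // (leq_trans hk).
    by apply/subset_leq_card/subsetP => p; rewrite inE => /andP[].
have hany' : nv s' aAny 0 = any.
  by rewrite Hn // /s1 !denE nv_setr !nv_setn //= nv_den_free // nv_setn.
have [f' [f'F Ef' nf']] := find_nearest_spec Eq hany' anyF.
rewrite 3!denE; set s3 := den find_nearest s' in Ef' *.
have D3 : dist_is A s3 by move=> p; rewrite rv_den_free // hD.
set s4 := den (If _ _ _) s3.
pose A' := if cnt is 0 then [set f'] else f' |: A.
have D4 : dist_is A' s4.
  rewrite /s4 denE !evalE [nv s3 aCnt 0]nv_den_free // -/cnt /A'.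
  by case: (cnt) => [|c] /=; [apply: init_dist_spec|apply: add_center_spec].
have f4 : nv s4 aF 0 = f' by rewrite nv_den_free.
have c4 : nv s4 aCnt 0 = cnt by rewrite nv_den_free // nv_den_free.
have f'A' : f' \in A' by rewrite /A'; case: (cnt) => [|c]; rewrite !inE eqxx.
exists A', f' => /=; rewrite nv_setn //= nv_setn //= !denE nv_setr nv_setn //=.
rewrite rv_setn rv_setr //= !evalE c4 addn1.
have Eq4 : nv (setn aCnt 0 cnt.+1 s4) iQ 0 = q.
  by rewrite nv_setn //= nv_den_free // nv_den_free.
have Ef4 : nv (setn aCnt 0 cnt.+1 s4) aF 0 = f' by rewrite nv_setn.
rewrite (eval_RWeight z eps Eq4).
rewrite (eval_RDeltaV z eps Eq4 Ef4).
split=> //.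
- split=> //.
  + by apply/set0Pn; exists f'.
  + by rewrite /A'; case: (cnt) => [|c]; rewrite ?subUset ?AF sub1set f'F.
  + rewrite /A'; case: (cnt) hA => [|c] hA; first by rewrite cards1.
    rewrite (leq_trans (leq_card_setU _ _)) // cards1 add1n maxnE.
    by move: hA; rewrite maxnE; case: c => //= c; rewrite !subn1.
- by rewrite CS cardsU1 qCq add1n ltnS.
- by move=> _; exists q, f'.
- move=> hn p x; rewrite CS => /setU1P[-> xF|pC xF].
    by apply: le_trans (dist_le q f'A') _; apply: nf'.
  have c0 : (0 < cnt)%N.
    by rewrite lt0n; apply/eqP => /h3[C0 _]; rewrite C0 inE in pC.
  apply: le_trans (h5 hn p x pC xF); rewrite /A'; case: (cnt) c0 => // c _.
  by apply: dist_anti => //; apply: subsetUr.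
- split; last by [].
  by move=> p; rewrite rv_setn rv_setr //= rv_setn D4.
Qed.

End PreparationSpecs.

(** * Lower bound on the optimum and greedy search *)

Section SearchSpecs.
Variables (R : realType) (I : clustering_input R) (z eps : R).
Hypotheses (valid : valid_input I) (z1 : 1 <= z).
Implicit Types (s : state R) (A Y : {set 'I_(npts I)}) (f x y p q any : 'I_(npts I)).
Implicit Types (N : seq 'I_(npts I)).

Local Notation nv := (nv I).
Local Notation den := (den I z eps).
Local Notation setn := (setn I).
Local Notation neval := (neval I).
Local Notation reval := (reval I z eps).

Definition close_pair_cost q x : R := weight q * (delta q x / 2) `^ z.

Lemma cost_bounds_spec s A f (s' := den cost_bounds s) (V := rv s' rLow 0) (r := rv s rNear 0) :
  A != set0 -> dist_is A s -> nv s aF 0 = f -> f \in A ->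
  [/\ rv s' rUp 0 = robust_cost z A, r <= V,
   robust_cost z A <= V \/ (exists q x, [/\ q \in clients I, x \in clients I, q != x &
       close_pair_cost q x <= V]) &
   V = r \/ V <= robust_cost z A /\ (forall q x, q \in clients I -> x \in clients I ->
      q != x -> V <= close_pair_cost q x)].
Proof.
move=> A0 hD hf fA; rewrite /V {V}/s' den_Block 4!denE.
set U := robust_cost z A; set s1 := den compute_cost s.
have E1 : rv s1 rM 0 = U.
  rewrite /s1 (compute_cost_spec z eps valid A0 hD hf) /U.
  by have -> : f |: A = A by apply/setUidPr; rewrite sub1set.
set s2 := den (SETR rLow <- _) _.
have E2 : rv s2 rLow 0 = U by rewrite /s2 !denE rv_setr //= !evalE rv_setr.
have E2' : rv s2 rUp 0 = U by rewrite /s2 !denE rv_setr //= !evalE rv_setr.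
have E2r : rv s2 rNear 0 = r by rewrite /s2 !denE !rv_setr //= rv_den_free.
set s3 := den (For iQ _ _) s2.
(* The second conjunct keeps [V] from being too small, as it is at least [U] or the cost of some
   pair; the rest of the invariant keeps it from being too large. *)
pose P V := V <= U /\ (U <= V \/ (exists q x, [/\ q \in clients I, x \in clients I, q != x &
       close_pair_cost q x <= V])).
have [[h1 h2] h3] : P (rv s3 rLow 0) /\ forall q x, (q < npts I)%N -> q \in clients I ->
    x \in clients I -> q != x -> rv s3 rLow 0 <= close_pair_cost q x.
  apply: (den_for_points (Inv := fun i s => P (rv s rLow 0) /\ forall q x, (q < i)%N ->
    q \in clients I -> x \in clients I -> q != x -> rv s rLow 0 <= close_pair_cost q x)) => //.
    by rewrite rv_setn E2; split=> //; split; [|left].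
  move=> q s' Eq _ _ _ [Hs1 Hs2]; rewrite rv_setn.
  suff [H1 H2] : P (rv (den (For iX AllPoints
      (If (NZ (NIsClient (NVar iQ)))
         (If (NZ (NIsClient (NVar iX)))
            (If (TRealLe (RDelta (NVar iQ) (NVar iX)) RZero) Skip
               (If (TRealLe (RVar rLow) pair_cost) Skip (SETR rLow <- pair_cost)))
            Skip)
         Skip)) s') rLow 0) /\ forall q' x, (q' < q)%N || (q' == q) && (x < npts I)%N ->
    q' \in clients I -> x \in clients I -> q' != x -> rv (den (For iX AllPoints
      (If (NZ (NIsClient (NVar iQ)))
         (If (NZ (NIsClient (NVar iX)))
            (If (TRealLe (RDelta (NVar iQ) (NVar iX)) RZero) Skip
               (If (TRealLe (RVar rLow) pair_cost) Skip (SETR rLow <- pair_cost)))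
            Skip)
         Skip)) s') rLow 0 <= close_pair_cost q' x.
    split=> // q' x; rewrite ltnS leq_eqVlt => h; apply: H2.
    by rewrite ltn_ord andbT orbC.
  (* In the inner loop the pairs already treated are those that precede the current one
     lexicographically. *)
  apply: (den_for_points (Inv := fun i s => P (rv s rLow 0) /\
    forall q' x, (q' < q)%N || (q' == q) && (x < i)%N ->
      q' \in clients I -> x \in clients I -> q' != x ->
      rv s rLow 0 <= close_pair_cost q' x)) => //.
    rewrite rv_setn; split=> // q' x; rewrite ltn0 andbF orbF; exact: Hs2.
  move=> x s4 Ex Hn _ _ [[h1 h2] h3]; rewrite rv_setn.
  have Eq4 : nv s4 iQ 0 = q by rewrite Hn.
  have Ed := eval_RDeltaV z eps Eq4 Ex.
  have Ew := eval_RWeight z eps Eq4.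
  rewrite denE evalE (eval_NIsClient Eq4) lt0b.
  have old V : (forall q' x0, (q' < q)%N || (q' == q) && (x0 < x)%N ->
      q' \in clients I -> x0 \in clients I -> q' != x0 -> V <= close_pair_cost q' x0) ->
    (q \in clients I -> x \in clients I -> q != x -> V <= close_pair_cost q x) ->
    forall q' x0, (q' < q)%N || (q' == q) && (x0 < x.+1)%N ->
      q' \in clients I -> x0 \in clients I -> q' != x0 -> V <= close_pair_cost q' x0.
    move=> H1 H2 q' x0; rewrite ltnS (leq_eqVlt x0) => /orP[h|/andP[/eqP -> /orP[/eqP/val_inj ->|h]]] //.
      by apply: H1; rewrite h.
    by apply: H1; rewrite eqxx h orbT.
  case: ifPn => qC; last first.
    by rewrite denE; split=> //; apply: old => // qC'; rewrite qC' in qC.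
  rewrite denE evalE (eval_NIsClient Ex) lt0b; case: ifPn => xC; last first.
    by rewrite denE; split=> //; apply: old => // _ xC'; rewrite xC' in xC.
  rewrite denE evalE Ed evalE; case: leP => hd.
    rewrite denE; split=> //; apply: old => // _ _ qx.
    by have := delta_gt0 valid qx; rewrite ltNge hd.
  have qx : q != x by apply: contraTneq hd => ->; rewrite (delta_refl valid) ltxx.
  rewrite denE !evalE Ed Ew -/(close_pair_cost q x).
  case: (leP (rv s4 rLow 0) (close_pair_cost q x)) => hV; rewrite denE.
    by split=> //; apply: old.
  rewrite rv_setr //= !evalE Ed Ew -/(close_pair_cost q x).
  split; first split.
  - exact: le_trans (ltW hV) h1.
  - by right; exists q, x.
  - apply: old => // q' x0 h qC' xC' qx'; apply: le_trans (ltW hV) _; exact: h3.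
have {}h3 q x : q \in clients I -> x \in clients I -> q != x ->
  rv s3 rLow 0 <= close_pair_cost q x by apply: h3.
have E3 : rv s3 rUp 0 = U by rewrite rv_den_free.
have E3r : rv s3 rNear 0 = r by rewrite rv_den_free.
rewrite denE !evalE E3r; case: (leP r (rv s3 rLow 0)) => h; rewrite denE.
  by split=> //; right.
rewrite !rv_setr //= evalE E3r; split=> //; last by left.
case: h2 => [h2|[q [x [? ? ? h2]]]]; first by left; apply: le_trans h2 (ltW h).
by right; exists q, x; split=> //; apply: le_trans h2 (ltW h).
Qed.

(** If [V = r], no solution serves the client concerned closer than its nearest facility does.
    Otherwise, with at most [k] clients the initial centers are best possible for each client, and
    with more than [k] clients two of them share a center of [Y]. *)
Lemma lower_bound_le A (V r : R) Y : is_start z A r -> feasible Y ->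
  V = r \/ V <= robust_cost z A /\ (forall q x, q \in clients I -> x \in clients I ->
      q != x -> V <= close_pair_cost q x) ->
  V <= robust_cost z Y.
Proof.
move=> [A0 AF hA start opt] fY; case=> [->|[h1 h2]].
  case: start => [[_ ->]|[p [f [pC fA -> near]]]]; first exact: robust_cost_ge0.
  apply: le_trans (client_cost_le z valid Y pC).
  rewrite ler_wpM2l ?(ltW (weight_gt0 valid pC)) // powR_le ?(delta_ge0 valid) //.
  have [y yY ->] := dist_ex p (feasible_neq0 valid fY); apply: near.
  exact: (subsetP fY.1).
have [hn|hn] := leqP #|clients I| (ncenters I).
  apply: le_trans h1 _; apply: robust_cost_le => [|i]; first exact: robust_cost_ge0.
  apply: le_trans (group_cost_le z Y i); apply: ler_sum => p /(group_client valid) pC.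
  rewrite ler_wpM2l ?(ltW (weight_gt0 valid pC)) // powR_le ?(dist_ge0 valid) //.
  have [y yY ->] := dist_ex p (feasible_neq0 valid fY); apply: opt => //.
  exact: (subsetP fY.1).
have [q [x [qC xC qx h]]] := close_pair valid z1 fY hn.
exact: le_trans (h2 q x qC xC qx) h.
Qed.

Definition active_is A (u : R) s : Prop :=
  forall i : 'I_(ngroups I), (0 < nv s aAct i)%N = active z u A i.

Lemma active_costs_spec s A f (u := rv s rU 0) (s' := den active_costs s) :
  A != set0 -> dist_is A s -> nv s aF 0 = f -> f \in A ->
  active_is A u s' /\ rv s' rPhi 0 = active_cost z u A A.
Proof.
move=> A0 hD hf fA; rewrite {}/s' den_Block denE.
set s1 := den (SETR rPhi <- _) _; set s2 := den (For _ _ _) _.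
have fAE : f |: A = A by apply/setUidPr; rewrite sub1set.
suff [h1 h2] : (forall i : 'I_(ngroups I), (i < ngroups I)%N ->
      (0 < nv s2 aAct i)%N = active z u A i) /\
    rv s2 rPhi 0 = \sum_(i | active z u A i && (i < ngroups I)%N) group_cost z A i.
  split; first by move=> i; apply: h1.
  by rewrite h2; apply: eq_bigl => i; rewrite ltn_ord andbT.
apply: (den_for_groups (Inv := fun j s => (forall i : 'I_(ngroups I), (i < j)%N ->
      (0 < nv s aAct i)%N = active z u A i) /\
    rv s rPhi 0 = \sum_(i | active z u A i && (i < j)%N) group_cost z A i)) => //.
  rewrite rv_setn /s1 denE rv_setr //= !evalE big_pred0 // => i; by rewrite ltn0 andbF.
move=> i s' Ei Hn Hr _ [h1 h2].
have Dx : dist_is A s' by move=> p; rewrite Hr // /s1 denE rv_setr //= hD.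
have Ec := compute_group_cost_spec z eps A0 Dx (etrans (Hn aF _ isT) hf) Ei.
rewrite fAE in Ec; rewrite (sum_lt_ordS _ _ i) -h2 rv_setn 2!denE.
set s3 := den compute_group_cost s' in Ec *.
have Eu : rv s3 rU 0 = u by rewrite rv_den_free // Hr // /s1 denE rv_setr.
have Ei3 : nv s3 iG 0 = i by rewrite nv_den_free.
have Ea j : nv s3 aAct j = nv s' aAct j by rewrite nv_den_free.
have Ep : rv s3 rPhi 0 = rv s' rPhi 0 by rewrite rv_den_free.
rewrite !denE !evalE Ec Eu Ei3; case: (leP (group_cost z A i * u) 1) => h; rewrite ?denE.
  rewrite rv_setn Ep /active ltNge h /= addr0; split=> // j hj.
  rewrite nv_setn //= nv_setn //=; case: eqVneq => [/val_inj ->|ne]; first by rewrite ltNge h.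
  by rewrite Ea h1 // ltn_neqAle ne -ltnS.
rewrite /active h rv_setr //= !rv_setn Ep Ec; split=> // j hj.
rewrite nv_setn //= nv_setr nv_setn //=; case: eqVneq => [/val_inj ->|ne]; first by rewrite h.
by rewrite Ea h1 // ltn_neqAle ne -ltnS.
Qed.

Lemma active_costs_with_spec s A f (u : R) : A != set0 -> dist_is A s -> nv s aF 0 = f ->
  active_is A u s -> rv (den active_costs_with s) rPhiF 0 = active_cost z u A (f |: A).
Proof.
move=> A0 hD hf hact; rewrite den_Block denE.
transitivity (\sum_(i | active z u A i && (i < ngroups I)%N) group_cost z (f |: A) i);
  last by apply: eq_bigl => i; rewrite ltn_ord andbT.
apply: (den_for_groups (Inv := fun j s => rv s rPhiF 0 =
   \sum_(i | active z u A i && (i < j)%N) group_cost z (f |: A) i)) => //.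
  rewrite rv_setn denE rv_setr //= !evalE big_pred0 // => i; by rewrite ltn0 andbF.
move=> i s' Ei Hn Hr _ h2.
have Dx : dist_is A s' by move=> p; rewrite Hr // denE rv_setr //= hD.
have Ef : nv s' aF 0 = f by rewrite Hn.
have Ec := compute_group_cost_spec z eps A0 Dx Ef Ei.
rewrite (sum_lt_ordS _ _ i) -h2 rv_setn denE !evalE Ei Hn // denE nv_setr hact.
case: ifP => _; rewrite !denE ?addr0 //.
by rewrite rv_setr //= !evalE Ec rv_den_free.
Qed.

Lemma select_center_spec s A (u : R) (Phi := rv s rPhi 0) (K := rv s rK 0)
    (s' := den select_center s) :
  A != set0 -> dist_is A s -> active_is A u s ->
  (nv s' aGo 0 = 1%N /\ exists f, [/\ f \in facilities I, nv s' aSel 0 = f &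
     K * active_cost z u A (f |: A) <= (K - 1) * Phi]) \/
  (nv s' aGo 0 = 0%N /\ forall f, f \in facilities I ->
     (K - 1) * Phi < K * active_cost z u A (f |: A)).
Proof.
move=> A0 hD hact; rewrite {}/s' den_Block denE.
set s1 := den (SET aGo <- _) _; set s2 := den (For _ _ _) _.
suff : (nv s2 aGo 0 = 1%N /\ exists f, [/\ f \in facilities I, nv s2 aSel 0 = f &
     K * active_cost z u A (f |: A) <= (K - 1) * Phi]) \/
  (nv s2 aGo 0 = 0%N /\ forall f, f \in facilities I -> (f < npts I)%N ->
     (K - 1) * Phi < K * active_cost z u A (f |: A)).
  by case=> [?|[? H]]; [left|right; split=> // f fF; apply: H].
apply: (den_for_points (Inv := fun i s =>
   (nv s aGo 0 = 1%N /\ exists f, [/\ f \in facilities I, nv s aSel 0 = f &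
     K * active_cost z u A (f |: A) <= (K - 1) * Phi]) \/
  (nv s aGo 0 = 0%N /\ forall f, f \in facilities I -> (f < i)%N ->
     (K - 1) * Phi < K * active_cost z u A (f |: A)))) => //.
  by right; rewrite nv_setn //= /s1 denE nv_setn.
move=> x s' Ex Hn Hr _ Hs.
rewrite denE evalE (eval_NIsFacility Ex) lt0b; case: ifPn => xF; last first.
  rewrite denE !nv_setn //=; case: Hs => [?|[? H]]; [by left|right; split=> // f fF].
  by rewrite ltnS leq_eqVlt => /orP[/eqP/val_inj fx|]; [rewrite fx (negbTE xF) in fF|apply: H].
rewrite 3!denE; set s3 := den (SET aF <- _) s'.
have D3 : dist_is A s3.
  by move=> p; rewrite /s3 denE rv_setn Hr // /s1 denE rv_setn hD.
have F3 : nv s3 aF 0 = x by rewrite /s3 denE nv_setn //= evalE.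
have A3 : active_is A u s3.
  by move=> i; rewrite /s3 denE nv_setn //= Hn // /s1 denE nv_setn //= hact.
have := active_costs_with_spec A0 D3 F3 A3; set s4 := den active_costs_with s3 => E4.
have EK : rv s4 rK 0 = K by rewrite rv_den_free // /s3 denE rv_setn Hr.
have EP : rv s4 rPhi 0 = Phi by rewrite rv_den_free // /s3 denE rv_setn Hr.
have Ex4 : nv s4 iX 0 = x by rewrite nv_den_free // /s3 denE nv_setn.
rewrite !denE !evalE E4 EK EP; case: (leP (K * active_cost z u A (x |: A)) ((K - 1) * Phi)) => h.
  by left; rewrite !nv_setn //=; split=> //; exists x.
have G4 w : nfree w active_costs_with -> (w < 32)%N -> w != aF -> nv s4 w 0 = nv s' w 0.
  by move=> h1 h2 h3; rewrite nv_den_free // /s3 denE nv_setn // (negbTE h3).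
rewrite !nv_setn //= !G4 //.
case: Hs => [?|[? H]]; [by left|right; split=> // f fF].
by rewrite ltnS leq_eqVlt => /orP[/eqP/val_inj ->|] //; apply: H.
Qed.

Section Greedy.
Variables (A0 : {set 'I_(npts I)}) (T : nat) (Delta V : R) (f0 : 'I_(npts I)).
Let U := robust_cost z A0.
Hypotheses (A0F : A0 \subset facilities I) (f0A0 : f0 \in A0)
  (hT : (1 - (2 * (ncenters I)%:R)^-1 : R) ^+ T * (2 * (ngroups I)%:R) <= 1)
  (V0 : 0 <= V) (gap : U <= Delta * V) (D0 : 0 <= Delta)
  (optV : forall Y, feasible Y -> V <= robust_cost z Y).

Let A0_neq0 : A0 != set0. Proof. by apply/set0Pn; exists f0. Qed.

Definition greedy_state A s : Prop :=
  [/\ A0 \subset A, A \subset facilities I, dist_is A s &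
    greedy_inv z A0 T U Delta A (rv s rU 0)].

(** Both ways of stopping are justified: a cost of at most [V] is at most the optimum, and if no
    facility gains enough, [greedy_stop] applies. *)
Lemma greedy_step_spec s A (s' := den greedy_step s) :
  greedy_state A s -> rv s rLow 0 = V -> rv s rK 0 = 2 * (ncenters I)%:R ->
  nv s aIn 0 = f0 ->
  exists A', greedy_state A' s' /\
    ((nv s' aGo 0 = 1%N /\ (#|A| < #|A'|)%N) \/
     (nv s' aGo 0 = 0%N /\ forall Y, feasible Y -> robust_cost z A' <= 4 * robust_cost z Y)).
Proof.
move=> [sA AF hD hG] EV EK Ein; rewrite {}/s' den_Block 2!denE.
have AN : A != set0 by apply: contra_neq A0_neq0 => E; apply/eqP; rewrite -subset0 -E.
have f0A : f0 \in A by apply: (subsetP sA).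
have fAE : f0 |: A = A by apply/setUidPr; rewrite sub1set.
set s1 := den (SET aF <- _) s.
have D1 : dist_is A s1 by move=> p; rewrite /s1 denE rv_setn hD.
have F1 : nv s1 aF 0 = f0 by rewrite /s1 denE nv_setn //= evalE.
have := compute_cost_spec z eps valid AN D1 F1; rewrite fAE.
set s2 := den compute_cost s1; set M := robust_cost z A => EM.
have D2 : dist_is A s2 by move=> p; rewrite rv_den_free.
have S2 w : rfree w compute_cost -> rv s2 w 0 = rv s w 0.
  by move=> h; rewrite rv_den_free // /s1 denE rv_setn.
have F2 : nv s2 aF 0 = f0 by rewrite nv_den_free.
rewrite denE !evalE EM S2 // EV; case: (leP M V) => hM.
  exists A; rewrite denE !nv_setn //= evalE; split.
    by split=> //; rewrite rv_setn S2.
  right; split=> // Y fY; apply: le_trans hM (le_trans (optV fY) _).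
  by have := robust_cost_ge0 z Y; lra.
have M0 : 0 < M by apply: le_lt_trans hM.
have gapM : U <= Delta * M by apply: le_trans gap _; rewrite ler_wpM2l // ltW.
have [hG' [u0 Mu]] := greedy_reset valid z1 A0_neq0 (erefl U) hG M0 gapM.
set u := next_threshold M (rv s rU 0) in hG' u0 Mu.
rewrite 3!denE; set s3 := den (If _ _ _) s2.
have U3 : rv s3 rU 0 = u.
  rewrite /s3 denE !evalE EM S2 // /u /next_threshold; case: ifP => _; rewrite !denE.
    by rewrite rv_setr //= !evalE EM.
  by rewrite S2.
have D3 : dist_is A s3 by move=> p; rewrite rv_den_free.
have F3 : nv s3 aF 0 = f0 by rewrite nv_den_free.
have [A4 P4] := active_costs_spec AN D3 F3 f0A.
set s4 := den active_costs s3 in A4 P4 *; rewrite U3 in A4 P4.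
have D4 : dist_is A s4 by move=> p; rewrite rv_den_free.
have K4 : rv s4 rK 0 = 2 * (ncenters I)%:R by rewrite rv_den_free // rv_den_free // S2.
have U4 : rv s4 rU 0 = u by rewrite rv_den_free.
have := select_center_spec AN D4 A4; rewrite P4 K4.
set s5 := den select_center s4.
have D5 : dist_is A s5 by move=> p; rewrite rv_den_free.
have U5 : rv s5 rU 0 = u by rewrite rv_den_free.
case=> [[go [f [fF sel hf]]]|[go H]]; rewrite denE !evalE go /= ?denE; last first.
  exists A; split; first by split=> //; rewrite U5.
  right; split=> // Y fY; exact: (greedy_stop valid z1 AN fY u0 Mu).
have Mu1 : 1 < M * u by case/andP: Mu.
have [hG5 fA] := greedy_add valid z1 A0_neq0 hT hG' u0 Mu1 hf.
set s6 := setn aF _ _ s5.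
have D6 : dist_is A s6 by move=> p; rewrite rv_setn.
have F6 : nv s6 aF 0 = f by rewrite nv_setn //= evalE.
exists (f |: A); split.
  split.
  - by apply: subset_trans sA _; apply: subsetUr.
  - by rewrite subUset sub1set fF.
  - exact: add_center_spec.
  - by rewrite rv_den_free // rv_setn U5.
left; rewrite nv_den_free // nv_setn //= go; split=> //.
by rewrite cardsU1 fA add1n.
Qed.

Lemma greedy_spec s (s' := den greedy s) :
  dist_is A0 s -> nv s aF 0 = f0 -> rv s rLow 0 = V -> rv s rK 0 = 2 * (ncenters I)%:R ->
  (#|A0| <= ncenters I)%N ->
  exists A, [/\ greedy_state A s',
    forall Y, feasible Y -> robust_cost z A <= 4 * robust_cost z Y & nv s' aIn 0 = f0].
Proof.
move=> hD hf EV EK cA0; rewrite {}/s' den_Block 3!denE.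
set s1 := den (SETR rU <- _) _; set s2 := den (For _ _ _) _.
have E1 : nv s1 aIn 0 = f0 by rewrite /s1 !denE nv_setr !nv_setn //= evalE.
suff [A [hA [[_ h]|[_ H]]]] : exists A, greedy_state A s2 /\
   ((nv s2 aGo 0 = 1%N /\ (npts I < #|A|)%N) \/
    (nv s2 aGo 0 = 0%N /\ forall Y, feasible Y -> robust_cost z A <= 4 * robust_cost z Y)).
(* A loop that never stopped would have made [A] larger than the set of all points. *)
- by have := max_card (mem A); rewrite card_ord leqNgt h.
- by exists A; split=> //; rewrite nv_den_free.
apply: (den_for_points (Inv := fun i s => exists A, greedy_state A s /\
   ((nv s aGo 0 = 1%N /\ (i < #|A|)%N) \/
    (nv s aGo 0 = 0%N /\ forall Y, feasible Y -> robust_cost z A <= 4 * robust_cost z Y)))) => //.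
  exists A0; split; last first.
    by left; rewrite nv_setn //= card_gt0 /s1 !denE nv_setr nv_setn.
  split=> //; first by move=> p; rewrite rv_setn /s1 !denE rv_setr //= !rv_setn hD.
  by rewrite rv_setn /s1 !denE rv_setr //= evalE; split=> //; left.
move=> i s' _ Hn Hr _ [A [hA]]; rewrite denE !evalE => -[[go hi]|[go H]]; rewrite go /=; last first.
  rewrite denE; exists A; rewrite nv_setn //=; split; last by right.
  by case: hA.
have EV' : rv s' rLow 0 = V by rewrite Hr // /s1 !denE rv_setr.
have EK' : rv s' rK 0 = 2 * (ncenters I)%:R by rewrite Hr // /s1 !denE rv_setr.
have Ein' : nv s' aIn 0 = f0 by rewrite Hn.
have [A' [hA' H]] := greedy_step_spec hA EV' EK' Ein'.
exists A'; rewrite !nv_setn //=; split; first by case: hA'.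
case: H => [[go' h]|]; [left|by right].
by split=> //; apply: leq_ltn_trans h.
Qed.

End Greedy.
End SearchSpecs.

(** * Construction of the net *)

Section NetSpecs.
Variables (R : realType) (I : clustering_input R) (z eps : R).
Hypotheses (valid : valid_input I) (z1 : 1 <= z).
Implicit Types (s : state R) (A Y : {set 'I_(npts I)}) (f x y p q any : 'I_(npts I)).
Implicit Types (N : seq 'I_(npts I)).

Local Notation nv := (nv I).
Local Notation den := (den I z eps).
Local Notation setn := (setn I).
Local Notation neval := (neval I).
Local Notation reval := (reval I z eps).

(** A center of an optimal solution that is nearest to some client passes this test, because that
    client alone costs at most the optimum, hence at most [U]. Centers that serve no client can be
    ignored. *)
Definition relevant (U : R) x : bool :=
  [exists p in clients I, weight p * delta p x `^ z <= U].

Lemma check_relevant_spec s x : nv s iX 0 = x ->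
  (0 < nv (den check_relevant s) aRel 0)%N = relevant (rv s rUp 0) x.
Proof.
move=> hx; rewrite den_Block denE; set U := rv s rUp 0.
pose r (i : nat) := [exists p : 'I_(npts I), [&& p \in clients I, (p < i)%N &
  weight p * delta p x `^ z <= U]].
have -> : relevant U x = r (npts I) by apply: eq_existsb => p; rewrite ltn_ord.
apply: (den_for_points (Inv := fun i s => (0 < nv s aRel 0)%N = r i)) => //.
  rewrite nv_setn //= denE nv_setn //= evalE; apply/esym/existsP => -[p].
  by rewrite ltn0 andbF.
move=> p s' Ep Hn Hr _ Hs.
have Ex : nv s' iX 0 = x by rewrite Hn // denE nv_setn.
have rS : r p.+1 = r p || (p \in clients I) && (weight p * delta p x `^ z <= U).
  apply/existsP/orP => [[p' /and3P[pC]]|[/existsP[p' /and3P[pC hp' h]]|/andP[pC h]]].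
  - rewrite ltnS leq_eqVlt => /orP[/eqP/val_inj <- h|hp' h]; first by right; rewrite pC.
    by left; apply/existsP; exists p'; rewrite pC hp'.
  - by exists p'; rewrite pC h andbT ltnS ltnW.
  - by exists p; rewrite pC ltnSn.
rewrite rS denE evalE (eval_NIsClient Ep) lt0b.
case: (p \in clients I) => /=; last by rewrite denE nv_setn //= orbF.
rewrite denE !evalE (eval_RWeight z eps Ep) (eval_RDeltaV z eps Ep Ex).
have -> : rv s' rUp 0 = U by rewrite Hr.
by case: (_ <= U); rewrite denE !nv_setn //= ?evalE ?orbT ?orbF.
Qed.

Definition net_is (d : 'I_(npts I)) N s : Prop :=
  nv s aLen 0 = size N /\ forall j, (j < size N)%N -> nv s aNet j = nth d N j.

Lemma check_covered_spec s A d N x (e V : R) : dist_is A s -> net_is d N s ->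
  (size N <= npts I)%N -> nv s iX 0 = x -> rv s rE 0 = e -> rv s rLow 0 = V ->
  rv s rW 0 = total_weight I ->
  (0 < nv (den check_covered s) aRel 0)%N =
  (0 < nv s aRel 0)%N && ~~ has (covered z (dist_to_set A) e V x) N.
Proof.
move=> hD [hL hN] hsz hx hE hV hW; rewrite den_Block.
rewrite -[X in has _ X](take_oversize hsz).
apply: (den_for_points (Inv := fun i s' => (0 < nv s' aRel 0)%N =
  (0 < nv s aRel 0)%N && ~~ has (covered z (dist_to_set A) e V x) (take i N))) => //.
  by rewrite nv_setn //= take0 /= andbT.
move=> j s' Ej Hn Hr _ Hs.
have L' : nv s' aLen 0 = size N by rewrite Hn.
rewrite denE !evalE Ej L'; case: (ltnP j (size N)) => hj; last first.
  by rewrite denE nv_setn //= Hs !take_oversize // (leq_trans hj).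
have Ex : nv s' iX 0 = x by rewrite Hn.
have Ey : neval s' (NArr aNet (NVar iJ)) = nth d N j by rewrite !evalE Ej Hn // hN.
have Ed : reval s' (RDelta (NVar iX) (NArr aNet (NVar iJ))) = delta x (nth d N j).
  exact: eval_RDelta.
rewrite denE !evalE Ed Ex !Hr // hE hD (take_nth d hj).
rewrite has_rcons negb_or andbCA -Hs /covered.
case: (delta x _ <= _) => /=; first by rewrite denE !nv_setn //= evalE.
rewrite denE !evalE Ed !Hr // hW hE hV.
by case: (_ <= V); rewrite denE !nv_setn //= ?evalE.
Qed.

(** Of two net points only the later one was tested against the other, and [covered] is not
    symmetric; hence the disjunction in the separation. *)
Definition is_net A (e V U : R) f (N : seq 'I_(npts I)) (bound : nat) : Prop :=
  [/\ uniq N, f \in N, {subset N <= facilities I},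
    forall x, x \in facilities I -> (x < bound)%N -> relevant U x ->
      has (covered z (dist_to_set A) e V x) N &
    (forall x, x \in N -> x = f \/ relevant U x) /\
    {in N &, forall x y, x != y -> ~~ covered z (dist_to_set A) e V x y \/
      ~~ covered z (dist_to_set A) e V y x}].

Lemma covered_refl A (e V : R) x : 0 <= e -> covered z (dist_to_set A) e V x x.
Proof. by move=> e0; rewrite /covered (delta_refl valid) mulr_ge0 ?(dist_ge0 valid). Qed.

Lemma build_net_spec s A f (e V U : R) (s' := den build_net s) :
  dist_is A s -> nv s aIn 0 = f -> f \in facilities I -> 0 <= e -> rv s rE 0 = e ->
  rv s rLow 0 = V -> rv s rW 0 = total_weight I -> rv s rUp 0 = U ->
  exists N, net_is f N s' /\ is_net A e V U f N (npts I).
Proof.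
move=> hD hf fF e0 hE hV hW hU; rewrite {}/s' den_Block 2!denE.
set s1 := den (SET aLen <- _) _.
apply: (den_for_points (Inv := fun i s => exists N, net_is f N s /\ is_net A e V U f N i)) => //.
  exists [:: f]; split.
    split=> [|[] //= _]; first by rewrite !nv_setn //= evalE.
    by rewrite nv_setn //= /s1 !denE nv_setn //= nv_setn //= !evalE.
  split=> //; rewrite ?inE //; first by move=> x; rewrite inE => /eqP ->.
  split; first by move=> x; rewrite inE => /eqP; left.
  by move=> x y; rewrite !inE => /eqP -> /eqP ->; rewrite eqxx.
move=> x s2 Ex Hn Hr _ [N [[hL hN] [uN fN NF cov [rel sep]]]].
have szN : (size N <= npts I)%N.
  by rewrite -(card_uniqP uN) (leq_trans (max_card _)) // card_ord.
have Hr1 w j : rfree w (For iX AllPoints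
      (If (NZ (NIsFacility (NVar iX)))
         (check_relevant ;; check_covered ;;
          If (NZ (NVar aRel))
            (SetN aNet (NVar aLen) (NVar iX) ;; SET aLen <- NAdd (NVar aLen) (NConst 1)) Skip)
         Skip)) -> rv s2 w j = rv s w j.
  by move=> h; rewrite Hr // /s1 !denE !rv_setn.
rewrite denE evalE (eval_NIsFacility Ex) lt0b; case: ifPn => xF; last first.
  rewrite denE; exists N; split.
    by rewrite /net_is nv_setn //=; split=> // j hj; rewrite nv_setn //= hN.
  split=> // y yF; rewrite ltnS leq_eqVlt => /orP[/eqP/val_inj yx|]; last exact: cov.
  by rewrite yx (negbTE xF) in yF.
have E3 := check_relevant_spec Ex; rewrite Hr1 // hU in E3.
rewrite 2!denE; set s3 := den check_relevant s2 in E3 *.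
have D3 : dist_is A s3 by move=> p; rewrite rv_den_free // Hr1 // hD.
have N3 : net_is f N s3 by split=> [|j hj]; rewrite nv_den_free // hN.
have X3 : nv s3 iX 0 = x by rewrite nv_den_free.
have R3 w : rfree w check_relevant -> rfree w build_net -> rv s3 w 0 = rv s w 0.
  by move=> h1 h2; rewrite rv_den_free // Hr1 // ; case/and3P: h2.
have := check_covered_spec D3 N3 szN X3 (etrans (R3 rE isT isT) hE) (etrans (R3 rLow isT isT) hV)
  (etrans (R3 rW isT isT) hW); rewrite E3.
set s4 := den check_covered s3 => E4.
have L4 : nv s4 aLen 0 = size N by rewrite nv_den_free // N3.1.
have N4 j : (j < size N)%N -> nv s4 aNet j = nth f N j.
  by move=> hj; rewrite nv_den_free // N3.2.
have X4 : nv s4 iX 0 = x by rewrite nv_den_free.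
rewrite denE !evalE E4; case: ifPn => h; last first.
  rewrite denE; exists N; split.
    by rewrite /net_is nv_setn //=; split=> // j hj; rewrite nv_setn //= N4.
  split=> // y yF; rewrite ltnS leq_eqVlt => /orP[/eqP/val_inj ->|]; last exact: cov.
  by move=> hr; move: h; rewrite hr negbK.
case/andP: h => hr /hasPn hc.
(* Every point covers itself, so an uncovered point is new. *)
have xN : x \notin N by apply/negP => /hc; rewrite covered_refl.
exists (rcons N x); split.
  rewrite !denE !evalE L4 X4 /net_is size_rcons !nv_setn //= L4 addn1; split=> // j.
  rewrite ltnS leq_eqVlt nv_setn //= nv_setn //= nv_setn //= nth_rcons.
  by case: (ltngtP j (size N)) => // hj _; exact: N4.
split.
- by rewrite rcons_uniq xN.
- by rewrite mem_rcons inE fN orbT.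
- by move=> y; rewrite mem_rcons inE => /predU1P[-> //|]; exact: NF.
- move=> y yF; rewrite has_rcons ltnS leq_eqVlt => /orP[/eqP/val_inj -> _|hy ry].
    by rewrite covered_refl.
  by rewrite cov ?orbT.
- split=> [y|]; first by rewrite mem_rcons inE => /predU1P[->|]; [right|exact: rel].
  move=> y y'; rewrite !mem_rcons !inE => /predU1P[->|yN] /predU1P[->|y'N] //; last exact: sep.
  + by rewrite eqxx.
  + by move=> _; left; exact: hc.
  + by move=> _; right; exact: hc.
Qed.

End NetSpecs.

(** * Enumeration of the tuples and the output *)

Section Tuples.
Variables (R : realType) (I : clustering_input R) (z eps : R).
Hypotheses (valid : valid_input I) (z1 : 1 <= z).
Implicit Types (s : state R) (A X Y : {set 'I_(npts I)}) (x y p q f : 'I_(npts I)).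

Local Notation nv := (nv I).
Local Notation den := (den I z eps).
Local Notation setn := (setn I).
Local Notation neval := (neval I).
Local Notation reval := (reval I z eps).
Local Notation k := (ncenters I).

Definition digit (L j t : nat) : nat := ((t %/ L ^ j) %% L)%N.

(** In base [L], the condition [L ^ j %| t.+1] says that the increment carries into position [j],
    all lower digits of [t] being [L - 1]. *)
Lemma digitS L j t : (0 < L)%N -> digit L j t.+1 =
  (if L ^ j %| t.+1 then (if digit L j t + 1 < L then digit L j t + 1 else 0)
   else digit L j t)%N.
Proof.
move=> L0; rewrite /digit divnS ?expn_gt0 ?L0 //.
case: (L ^ j %| t.+1)%N; last by rewrite add0n.
rewrite add1n addn1 modnS; set q := (t %/ L ^ j)%N.
have lt : (q %% L < L)%N by rewrite ltn_mod.
have -> : (L %| q.+1)%N = ~~ ((q %% L).+1 < L)%N.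
  rewrite -leqNgt {1}(divn_eq q L) -addnS dvdn_addr ?dvdn_mull //.
  apply/idP/idP => [/dvdn_leq -> //|h].
  by have -> : (q %% L).+1 = L by apply/eqP; rewrite eqn_leq lt h.
by case: ((q %% L).+1 < L)%N.
Qed.

Lemma dvdn_expS L j t : (0 < L)%N ->
  (L ^ j.+1 %| t.+1)%N = (L ^ j %| t.+1)%N && ~~ (digit L j t + 1 < L)%N.
Proof.
move=> L0; have Lj : (0 < L ^ j)%N by rewrite expn_gt0 L0.
case: (boolP (L ^ j %| t.+1)%N) => /= [/dvdnP[m E]|]; last first.
  by apply: contraNF; apply: dvdn_trans; rewrite expnSr dvdn_mulr.
have Em : (t %/ L ^ j).+1 = m.
  by have := divnS t Lj; rewrite E dvdn_mull // mulnK // add1n => ->.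
rewrite E expnSr mulnC dvdn_pmul2r // -Em /digit addn1 -leqNgt.
set q := (t %/ L ^ j)%N; rewrite {1}(divn_eq q L) -addnS dvdn_addr ?dvdn_mull //.
have := ltn_mod q L; rewrite L0 => lt.
apply/idP/idP => [/dvdn_leq -> //|h].
by have -> : (q %% L).+1 = L by apply/eqP; rewrite eqn_leq lt h.
Qed.

Lemma digits_exist L (h : nat -> nat) n : (forall j, (j < n)%N -> (h j < L)%N) ->
  exists t, (t < L ^ n)%N /\ forall j, (j < n)%N -> digit L j t = h j.
Proof.
elim: n => [|n IHn] H; first by exists 0%N.
have [|t [ht dt]] := IHn; first by move=> j hj; apply: H; apply: ltnW.
have hn := H n (ltnSn n); have L0 : (0 < L)%N by apply: leq_ltn_trans hn.
exists (h n * L ^ n + t)%N; split.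
  rewrite expnS (@leq_trans ((h n).+1 * L ^ n)%N) ?leq_mul //.
  by rewrite mulSn addnC ltn_add2r.
move=> j; rewrite ltnS leq_eqVlt => /orP[/eqP ->|hj].
  by rewrite /digit divnMDl ?expn_gt0 ?L0 // divn_small // addn0 modn_small.
have E : (h n * L ^ n = h n * L ^ (n - j.+1) * L * L ^ j)%N.
  by rewrite -!mulnA -expnS -expnD subnK.
by rewrite -(dt j hj) /digit E divnMDl ?expn_gt0 ?L0 // modnMDl.
Qed.

Section Enumeration.
Variables (d : 'I_(npts I)) (N : seq 'I_(npts I)).
Hypothesis dN : d \in N.
Let L := size N.
Let L0 : (0 < L)%N. Proof. by rewrite /L; case: (N) dN. Qed.
Let k0 : (0 < k)%N. Proof. by case: valid => _ _ _ _ /andP[]. Qed.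

Definition tuple_point (t j : nat) : 'I_(npts I) := nth d N (digit L j t).
Definition tuple_set (t : nat) : {set 'I_(npts I)} := [set tuple_point t (nat_of_ord j) | j : 'I_k].

Lemma tuple_point_in t j : tuple_point t j \in N.
Proof. by rewrite mem_nth // ltn_mod. Qed.

Definition digits_are t s : Prop := forall j, (j < k)%N -> nv s aIdx j = digit L j t.

Lemma eval_tuple_center t s a j : net_is d N s -> digits_are t s -> (j < k)%N ->
  neval s a = j -> neval s (tuple_center a) = tuple_point t j.
Proof.
by move=> [_ hN] hd hj ha; rewrite /tuple_center !evalE ha hd // hN // ltn_mod.
Qed.

Lemma tuple_cost_spec t s : net_is d N s -> digits_are t s ->
  rv (den tuple_cost s) rM 0 = robust_cost z (tuple_set t).
Proof.
move=> hN hd; rewrite den_Block 3!denE.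
set s1 := den (SET aF <- _) s; set s2 := den init_dist s1; set s3 := den (For _ _ _) s2.
(* Entry 0 is inserted before the loop, since the distance array must stem from a nonempty set, and
   once more by the loop. *)
pose X j := tuple_point t 0 |: [set tuple_point t (nat_of_ord i) | i : 'I_k & (i < j)%N].
have X0 j : X j != set0 by apply/set0Pn; exists (tuple_point t 0); rewrite setU11.
have F1 : nv s1 aF 0 = tuple_point t 0.
  by rewrite /s1 denE nv_setn //= (eval_tuple_center hN hd k0).
have [f [D3 F3 fX]] : exists f, [/\ dist_is (X k) s3, nv s3 aF 0 = f & f \in X k].
  apply: (den_for_centers (Inv := fun j s => exists f, [/\ dist_is (X j) s,
    nv s aF 0 = f & f \in X j])) => //.
    exists (tuple_point t 0); split; last by rewrite setU11.
      have -> : X 0%N = [set tuple_point t 0].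
        apply/setUidPl/subsetP => x /imsetP[i]; by rewrite inE ltn0.
      move=> p; rewrite rv_setn; exact: init_dist_spec.
    by rewrite nv_setn //= nv_den_free.
  move=> j s' Ej Hn Hr _ [f [hD hF fX]].
  have hN' : net_is d N s'.
    by split=> [|i hi]; rewrite Hn // nv_den_free // /s1 denE nv_setn //= ?hN.1 ?hN.2 //.
  have hd' : digits_are t s'.
    by move=> i hi; rewrite Hn // nv_den_free // /s1 denE nv_setn //= hd.
  rewrite denE; set s4 := den (SET aF <- _) s'.
  have F4 : nv s4 aF 0 = tuple_point t j.
    by rewrite /s4 denE nv_setn //= (eval_tuple_center hN' hd' (ltn_ord j)) // evalE.
  have D4 : dist_is (X j) s4 by move=> p; rewrite /s4 denE rv_setn hD.
  have XS : X j.+1 = tuple_point t j |: X j.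
    rewrite /X setUCA; congr (_ |: _); apply/setP => x; rewrite !inE.
    apply/imsetP/orP => [[i] |[/eqP ->|/imsetP[i]]].
    - rewrite inE ltnS leq_eqVlt => /orP[/eqP/val_inj ->|hi] ->; first by left.
      by right; apply/imsetP; exists i; rewrite ?inE.
    - by exists j; rewrite ?inE //= ltnSn.
    - by rewrite inE /= => hi ->; exists i; rewrite ?inE //= ltnW.
  exists (tuple_point t j); rewrite XS; split; last by rewrite setU11.
    by move=> p; rewrite rv_setn; apply: add_center_spec.
  by rewrite nv_setn //= nv_den_free.
rewrite (compute_cost_spec z eps valid (X0 k) D3 F3).
have -> : f |: X k = X k by apply/setUidPr; rewrite sub1set.
congr robust_cost; apply/setP => x; rewrite !inE; apply/orP/imsetP.
  case=> [/eqP ->|/imsetP[i _ ->]]; last by exists i.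
  by exists (Ordinal k0).
by case=> i _ ->; right; apply/imsetP; exists i; rewrite ?inE /=.
Qed.

(** Before the first tuple there is no best cost; the flag [aHas] stands in for an infinite one. *)
Definition best_is t s : Prop :=
  (t = 0%N /\ nv s aHas 0 = 0%N) \/
  (nv s aHas 0 = 1%N /\ exists b, [/\ forall j, (j < k)%N -> nv s aBest j = tuple_point b j,
    rv s rBest 0 = robust_cost z (tuple_set b) &
    forall t', (t' < t)%N -> robust_cost z (tuple_set b) <= robust_cost z (tuple_set t')]).

Lemma record_best_spec t s : net_is d N s -> digits_are t s -> best_is t s ->
  rv s rM 0 = robust_cost z (tuple_set t) -> best_is t.+1 (den record_best s).
Proof.
move=> hN hd hb hM; rewrite den_Block 2!denE.
set s1 := den (If _ _ _) s; set s2 := den (SET aHas <- _) s1.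
have H2 : nv s2 aHas 0 = 1%N by rewrite /s2 denE nv_setn.
have M2 : rv s2 rM 0 = rv s rM 0 by rewrite /s2 denE rv_setn rv_den_free.
have N2 : net_is d N s2.
  by split=> [|j hj]; rewrite /s2 denE nv_setn //= nv_den_free // ?hN.1 ?hN.2 //.
have d2 : digits_are t s2.
  by move=> j hj; rewrite /s2 denE nv_setn //= nv_den_free // hd.
rewrite denE !evalE M2 hM; case: leP => h; last first.
  rewrite denE; right; split=> //; case: hb => [[t0 has0]|[has1 [b [b1 b2 b3]]]].
    by move: h; rewrite /s2 denE rv_setn /s1 denE !evalE has0 /= denE rv_setr //= evalE hM ltxx.
  have B2 : rv s2 rBest 0 = robust_cost z (tuple_set b).
    by rewrite /s2 denE rv_setn /s1 denE !evalE has1 /= denE.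
  exists b; split=> //.
    by move=> j hj; rewrite /s2 denE nv_setn //= nv_den_free // b1.
  by move=> t'; rewrite ltnS leq_eqVlt => /orP[/eqP ->|]; [rewrite -B2 ltW|exact: b3].
right; rewrite denE; set s3 := den (SETR rBest <- _) s2; split.
  by rewrite nv_den_free // /s3 denE nv_setr.
exists t; split.
- apply: (den_for_centers (Inv := fun i s => forall j, (j < i)%N ->
    nv s aBest j = tuple_point t j)) => //.
  move=> i s' Ei Hn Hr _ Hs j.
  have N' : net_is d N s'.
    by split=> [|j' hj]; rewrite Hn // /s3 denE nv_setr ?N2.1 ?N2.2 //.
  have d' : digits_are t s' by move=> j' hj; rewrite Hn // /s3 denE nv_setr d2.
  have Et := eval_tuple_center (a := NVar iJ) N' d' (ltn_ord i) Ei.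
  rewrite nv_setn //= denE nv_setn //= Et evalE Ei ltnS leq_eqVlt.
  by case: eqP => [-> //|_] /=; exact: Hs.
- by rewrite rv_den_free // /s3 denE rv_setr //= evalE M2.
- case: hb => [[-> _] t'|[has1 [b [_ b2 b3]]] t']; first by case: t' => // _; exact: lexx.
  rewrite ltnS leq_eqVlt => /orP[/eqP -> //|/b3 h']; apply: le_trans h'; apply: le_trans h _.
  by rewrite /s2 denE rv_setn /s1 denE !evalE has1 /= denE b2.
Qed.

(** The invariant identifies the carry into position [j] with divisibility of [t + 1] by [L^j]; at
    [j = k] it signals the overflow. *)
Lemma next_tuple_spec t s : digits_are t s -> nv s aLen 0 = L ->
  digits_are t.+1 (den next_tuple s) /\
  nv (den next_tuple s) aCarry 0 = (L ^ k %| t.+1)%N.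
Proof.
move=> hd hL; rewrite den_Block denE; set s1 := den (SET aCarry <- _) s.
set s2 := den (For _ _ _) s1.
suff [H1 H2] : (forall i, (i < k)%N ->
    nv s2 aIdx i = if (i < k)%N then digit L i t.+1 else digit L i t) /\
    nv s2 aCarry 0 = (L ^ k %| t.+1)%N.
  by split=> // i hi; rewrite H1 // hi.
apply: (den_for_centers (Inv := fun j s => (forall i, (i < k)%N ->
    nv s aIdx i = if (i < j)%N then digit L i t.+1 else digit L i t) /\
    nv s aCarry 0 = (L ^ j %| t.+1)%N)) => //.
  by split=> [i hi|]; rewrite nv_setn //= /s1 denE nv_setn //= ?hd // expn0 dvd1n.
move=> j s' Ej Hn _ _ [H1 H2].
have L' : nv s' aLen 0 = L by rewrite Hn // /s1 denE nv_setn.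
have I' : nv s' aIdx j = digit L j t by rewrite H1 // ltnn.
rewrite dvdn_expS // denE !evalE H2 lt0b.
have old (P : nat -> nat) : (P j = digit L j t.+1) ->
    (forall i : nat, i != j :> nat -> (i < k)%N -> P i = nv s' aIdx i) ->
    forall i, (i < k)%N -> P i = if (i < j.+1)%N then digit L i t.+1 else digit L i t.
  move=> h1 h2 i hi; have [->|ne] := eqVneq i (j : nat); first by rewrite ltnSn.
  by rewrite h2 // H1 // ltnS [(i <= j)%N]leq_eqVlt (negbTE ne).
have DS := digitS j t L0; case: ifPn DS => hdv DS; last first.
  rewrite denE; split; last by rewrite nv_setn //= H2 (negbTE hdv).
  by apply: old => [|i _ _]; rewrite nv_setn //= I'.
rewrite denE !evalE L' Ej I'; case: ifPn DS => h DS; rewrite !denE !evalE Ej /=.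
  split; last by rewrite !nv_setn //= ?evalE.
  apply: old => [|i ne _]; rewrite nv_setn //= nv_setn //= nv_setn //=.
    by rewrite eqxx I' DS.
  by rewrite (negbTE ne).
split; last by rewrite !nv_setn //= H2 hdv.
apply: old => [|i ne _]; rewrite nv_setn //= nv_setn //=; first by rewrite eqxx DS.
by rewrite (negbTE ne).
Qed.

Definition enum_inv t s : Prop :=
  [/\ net_is d N s, digits_are t s, best_is t s, nv s aCarry 0 = (t == L ^ k)%N &
    forall x, (x < npts I)%N -> nmem s x = 0%N].

Lemma exec_enumeration B n s : (npts I <= B)%N -> (ngroups I <= B)%N -> (k <= B)%N ->
  (n <= L ^ k)%N -> enum_inv (L ^ k - n) s ->
  exists s' t, [/\ exec I z eps (PWhile (TNatLt (NVar aCarry) (NConst 1)) (compile try_tuple))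
     s s' t, enum_inv (L ^ k) s' & (t <= n * (time_bound B try_tuple).+1 + 1)%N].
Proof.
move=> hP hG hC; elim: n s => [|n IHn] s hn.
  rewrite subn0 => hs; exists s, 1%N; split=> //; apply: ExecWhileFalse.
  by case: hs => _ _ _ hc _; rewrite eval_TNatLt !evalE hc eqxx.
move=> [hN hd hb hc ho].
set t := (L ^ k - n.+1)%N in hd hb hc.
have tS : (L ^ k - n)%N = t.+1 by rewrite /t subnSK.
have tlt : (t < L ^ k)%N by rewrite -tS leq_subr.
have [t1 [ex1 le1]] := exec_compile z eps s hP hG hC (isT : wf_loops try_tuple).
have inv1 : enum_inv (L ^ k - n) (den try_tuple s).
  rewrite tS den_Block 2!denE; have EM := tuple_cost_spec hN hd.
  set s1 := den tuple_cost s in EM *.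
  have N1 : net_is d N s1 by split=> [|j hj]; rewrite nv_den_free // ?hN.1 ?hN.2 //.
  have d1 : digits_are t s1 by move=> j hj; rewrite nv_den_free // hd.
  have b1 : best_is t s1.
    case: hb => [[-> h]|[h [b [h1 h2 h3]]]]; [left|right]; rewrite nv_den_free //.
    split=> //; exists b; split=> // [j hj|]; first by rewrite nv_den_free // h1.
    by rewrite rv_den_free.
  have b2 := record_best_spec N1 d1 b1 EM; set s2 := den record_best s1 in b2 *.
  have N2 : net_is d N s2 by split=> [|j hj]; rewrite nv_den_free // ?N1.1 ?N1.2 //.
  have d2 : digits_are t s2 by move=> j hj; rewrite nv_den_free // d1.
  have [d3 c3] := next_tuple_spec d2 N2.1.
  split=> //.
  - by split=> [|j hj]; rewrite nv_den_free // ?N2.1 ?N2.2 //.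
  - case: b2 => [[]|[h [b [h1 h2 h3]]]] //; right; rewrite nv_den_free //.
    split=> //; exists b; split=> // [j hj|]; first by rewrite nv_den_free // h1.
    by rewrite rv_den_free.
  (* [t + 1] is positive and at most [L^k], so divisibility means equality. *)
  - rewrite c3; congr nat_of_bool; apply/idP/eqP => [/dvdn_leq h|-> //].
    by apply/eqP; rewrite eqn_leq tlt h.
  - by move=> x hx; rewrite !nmem_den_free // ho.
have [s' [t2 [ex2 inv2 le2]]] := IHn _ (ltnW hn) inv1.
exists s', (t1 + t2).+1; split=> //.
  apply: ExecWhileTrue ex1 ex2.
  by rewrite eval_TNatLt !evalE hc; have := tlt; rewrite ltn_neqAle => /andP[/negbTE ->].
by rewrite mulSn addSn addSn ltnS -addnA leq_add.
Qed.

End Enumeration.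

Lemma output_point_spec s e x (O := output_set (npts I) s) (s' := den (output_point e) s) :
  neval s e = x -> nv s aCnt 0 = #|O| ->
  output_set (npts I) s' = x |: O /\ nv s' aCnt 0 = #|x |: O|.
Proof.
move=> he hc; rewrite {}/s' /output_point denE !evalE he.
have xO : (x \in O) = (0 < nmem s x)%N by rewrite inE lt0n.
case: ifPn => h.
  have E : x |: O = O by apply/setUidPr; rewrite sub1set xO.
  by rewrite denE E.
have xN : x \notin O by rewrite xO.
rewrite !denE !evalE he; split; last first.
  by rewrite nv_setn //= nv_mark hc cardsU1 xN addn1.
apply/setP => y; rewrite !inE nmem_setn // nmem_mark //.
have [->|ne] := eqVneq y x; first by rewrite eqxx.
by rewrite (negbTE (ne : y != x :> nat)).
Qed.

Lemma output_set_setn v i a s : output_set (npts I) (setn v i a s) = output_set (npts I) s.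
Proof. by apply/setP => x; rewrite !inE nmem_setn. Qed.

Lemma write_output_spec s (pt : nat -> 'I_(npts I)) (O := output_set (npts I) (den write_output s)) :
  (forall j, (j < k)%N -> nv s aBest j = pt j) -> (forall j, pt j \in facilities I) ->
  (forall x, (x < npts I)%N -> nmem s x = 0%N) ->
  feasible O /\ [set pt (nat_of_ord j) | j : 'I_k] \subset O.
Proof.
move=> hb ptF ho; rewrite /O {O} den_Block 2!denE.
set s1 := den (SET aCnt <- _) s; set s2 := den (For iJ _ _) s1; set s3 := den (For iX _ _) s2.
have [E2 c2] : output_set (npts I) s2 = [set pt (nat_of_ord j) | j : 'I_k & (j < k)%N] /\
    nv s2 aCnt 0 = #|output_set (npts I) s2|.
  apply: (den_for_centers (Inv := fun i s =>
    output_set (npts I) s = [set pt (nat_of_ord j) | j : 'I_k & (j < i)%N] /\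
    nv s aCnt 0 = #|output_set (npts I) s|)) => //.
    have E0 : output_set (npts I) s1 = set0.
      by apply/setP => x; rewrite !inE /s1 denE nmem_setn // ho.
    rewrite output_set_setn nv_setn //= /s1 denE nv_setn //= -/s1 output_set_setn.
    have -> : output_set (npts I) s = set0 by apply/setP => x; rewrite !inE ho.
    rewrite cards0; split=> //; apply/esym/setP => x; rewrite inE.
    by apply/imsetP => -[i]; rewrite inE ltn0.
  move=> j s' Ej Hn _ _ [H1 H2].
  have Eb : neval s' (NArr aBest (NVar iJ)) = pt j.
    by rewrite !evalE Ej Hn // /s1 denE nv_setn //= hb.
  have [O1 O2] := output_point_spec Eb H2.
  rewrite output_set_setn nv_setn //= O1 O2; split=> //.
  rewrite H1; apply/setP => x; rewrite !inE; apply/orP/imsetP.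
    case=> [/eqP ->|/imsetP[i]]; first by exists j; rewrite ?inE //= ltnSn.
    by rewrite inE /= => hi ->; exists i; rewrite ?inE //= ltnW.
  case=> i; rewrite inE ltnS leq_eqVlt /= => /orP[/eqP/val_inj ->|hi] ->; first by left.
  by right; apply/imsetP; exists i; rewrite ?inE.
set X := [set pt (nat_of_ord j) | j : 'I_k].
have {}E2 : output_set (npts I) s2 = X.
  by rewrite E2; apply/setP => x; apply/imsetP/imsetP => -[i] _ ->; exists i; rewrite ?inE /=.
have [XO OF Ok c3 full] : [/\ X \subset output_set (npts I) s3,
    output_set (npts I) s3 \subset facilities I, (#|output_set (npts I) s3| <= k)%N,
    nv s3 aCnt 0 = #|output_set (npts I) s3| &
    forall x, x \in facilities I -> (x < npts I)%N ->
      (x \in output_set (npts I) s3) || (k <= #|output_set (npts I) s3|)%N].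
  apply: (den_for_points (Inv := fun i s => let O := output_set (npts I) s in
    [/\ X \subset O, O \subset facilities I, (#|O| <= k)%N, nv s aCnt 0 = #|O| &
    forall x, x \in facilities I -> (x < i)%N -> (x \in O) || (k <= #|O|)%N])) => //.
    rewrite /= output_set_setn nv_setn //= c2 E2; split=> //.
      by apply/subsetP => x /imsetP[j _ ->].
    by rewrite (leq_trans (leq_imset_card _ _)) // card_ord.
  move=> x s' Ex _ _ _ /= [H1 H2 H3 H4 H5]; rewrite output_set_setn nv_setn //=.
  have old : (x \in facilities I -> (k <= #|output_set (npts I) s'|)%N) ->
     forall y, y \in facilities I -> (y < x.+1)%N ->
       (y \in output_set (npts I) s') || (k <= #|output_set (npts I) s'|)%N.
    move=> hx y yF; rewrite ltnS leq_eqVlt => /orP[/eqP/val_inj yx|]; last exact: H5.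
    by rewrite hx ?orbT // -yx.
  rewrite denE evalE (eval_NIsFacility Ex) lt0b; case: ifPn => xF; last first.
    by rewrite denE; split=> //; apply: old => xF'; rewrite xF' in xF.
  rewrite denE !evalE H4; case: ltnP => hk; last first.
    by rewrite denE; split=> //; apply: old.
  have [O1 O2] := @output_point_spec s' (NVar iX) x Ex H4.
  rewrite O1 O2; split=> //.
  - by apply: subset_trans H1 _; apply: subsetUr.
  - by rewrite subUset sub1set xF.
  - by rewrite (leq_trans (leq_card_setU _ _)) // cards1.
  - move=> y yF; rewrite ltnS leq_eqVlt => /orP[/eqP/val_inj ->|hy]; first by rewrite setU11.
    case/orP: (H5 y yF hy) => h; first by rewrite inE h orbT.
    by rewrite leqNgt hk in h.
split=> //; split=> //; apply/eqP; rewrite eqn_leq Ok /= leqNgt; apply/negP => lt.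
(* With fewer than [k] points written, the filling loop skipped no facility; but there are at least
   [k] facilities. *)
have FO : facilities I \subset output_set (npts I) s3.
  by apply/subsetP => x xF; have := full x xF (ltn_ord x); rewrite leqNgt lt orbF.
have := subset_leq_card FO; rewrite leqNgt (leq_trans lt) //.
by case: valid => _ _ _ _ /andP[].
Qed.

End Tuples.

(** * Correctness and running time *)

Section Correctness.
Variables (R : realType) (I : clustering_input R) (z eps : R).
Hypotheses (valid : valid_input I) (z1 : 1 <= z) (eps0 : 0 < eps).
Implicit Types (s : state R) (A X Y : {set 'I_(npts I)}) (x y p q f : 'I_(npts I)).
Implicit Types (N : seq 'I_(npts I)).

Local Notation nv := (nv I).
Local Notation den := (den I z eps).

(** The minimum keeps it at most 1, as convexity requires, and the 16 keeps the error [6 e 4^z] of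
    [snap_cost] below [eps]. *)
Definition resolution : R := Num.min 1 eps / (16 * 4 `^ z).

Lemma min_gt0 : 0 < Num.min 1 eps.
Proof. by rewrite lt_min ltr01. Qed.

Lemma pow4_ge1 : 1 <= 4 `^ z :> R.
Proof. by rewrite -[leLHS](powRr0 4) ler_powR ?ler1n // (le_trans _ z1). Qed.

Lemma resolution_gt0 : 0 < resolution.
Proof. by rewrite divr_gt0 ?min_gt0 // mulr_gt0 // powR_gt0. Qed.

Lemma resolution_le1 : resolution <= 1.
Proof.
have h := pow4_ge1; rewrite ler_pdivrMr ?mulr_gt0 ?powR_gt0 // mul1r.
by rewrite (@le_trans _ _ 1) ?ge_min ?lexx //; lra.
Qed.

Lemma resolution_error : 6 * (resolution * 4 `^ z) <= eps.
Proof.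
have h : 4 `^ z != 0 :> R by rewrite gt_eqF // powR_gt0.
have -> : resolution * 4 `^ z = Num.min 1 eps / 16 by rewrite /resolution; field.
have : Num.min 1 eps <= eps by rewrite ge_min lexx orbT.
by have := min_gt0; move: (Num.min 1 eps) => m; lra.
Qed.

Lemma start_gap A (Q V r : R) : 1 <= Q -> weight_aspect_ratio I <= Q ->
  distance_aspect_ratio I <= Q -> is_start z A r -> 0 <= V -> r <= V ->
  robust_cost z A <= V \/ (exists q x, [/\ q \in clients I, x \in clients I, q != x &
       close_pair_cost z q x <= V]) ->
  robust_cost z A <= (8 * #|clients I|%:R * Q ^+ 2) `^ z * V.
Proof.
move=> Q1 hw hd [A0 AF hA [[C0 _]|[p [f [pC fA rE _]]]] _] V0 rV hV; last first.
  by apply: (cost_gap valid z1 pC fA) => //; rewrite -rE.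
apply: (@le_trans _ _ 0); last by rewrite mulr_ge0 ?powR_ge0.
apply: robust_cost_le => // i; rewrite /group_cost big_pred0 // => p.
by apply/negP => /(group_client valid); rewrite C0 inE.
Qed.

Lemma start_cost_ge0 A (r : R) : is_start z A r -> 0 <= r.
Proof.
move=> [_ _ _ [[_ ->]|[p [f [pC _ -> _]]]] _] //.
by rewrite mulr_ge0 ?powR_ge0 // ltW // weight_gt0.
Qed.

(** What the enumeration and the counting use of the preparation. [Q] and [T] belong to the analysis
    and are never computed by the program. *)
Definition prepared (Q : R) (T : nat) A0 A N f (u V : R) : Prop :=
  let U := robust_cost z A0 in let Delta := (8 * #|clients I|%:R * Q ^+ 2) `^ z in
  [/\ is_net z A resolution V U f N (npts I),
    [/\ f \in A, A \subset facilities I, robust_cost z A <= U & 0 <= V],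
    forall Y, feasible Y -> robust_cost z A <= 4 * robust_cost z Y /\ V <= robust_cost z Y,
    exists2 Y : {set 'I_(npts I)}, feasible Y & robust_cost z Y <= U &
    U <= Delta * V /\ greedy_inv z A0 T U Delta A u].

Lemma prepare_spec s (Q : R) (T : nat) : 1 <= Q ->
  weight_aspect_ratio I <= Q -> distance_aspect_ratio I <= Q ->
  (1 - (2 * (ncenters I)%:R)^-1 : R) ^+ T * (2 * (ngroups I)%:R) <= 1 ->
  exists A0 A N f u V, net_is f N (den prepare s) /\ prepared Q T A0 A N f u V.
Proof.
move=> Q1 hw hd hT; rewrite den_Block 5!denE.
have [any anyF E1] := find_facility_spec z eps valid s.
set s1 := den find_facility s in E1 *.
have [K2 W2 e2] := compute_constants_spec I z eps s1.
set s2 := den compute_constants s1 in K2 W2 e2 *.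
have E2 : nv s2 aAny 0 = any by rewrite nv_den_free.
have [A0 [f [start D3 fA F3]]] := initial_centers_spec z eps valid E2 anyF.
set s3 := den initial_centers s2 in start D3 F3 *.
have [A0_neq0 A0F hA0 _ _] := start.
have [U4 rV V2 V3] := cost_bounds_spec z eps valid A0_neq0 D3 F3 fA.
set s4 := den cost_bounds s3 in U4 rV V2 V3 *.
set V := rv s4 rLow 0 in rV V2 V3 *.
have V0 : 0 <= V := le_trans (start_cost_ge0 start) rV.
have optV Y : feasible Y -> V <= robust_cost z Y.
  by move=> fY; apply: (lower_bound_le valid z1 start fY V3).
have gap := start_gap Q1 hw hd start V0 rV V2.
have D4 : dist_is A0 s4 by move=> p; rewrite rv_den_free.
have F4 : nv s4 aF 0 = f by rewrite nv_den_free.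
have K4 : rv s4 rK 0 = 2 * (ncenters I)%:R by rewrite rv_den_free // rv_den_free.
have Dge0 : 0 <= (8 * #|clients I|%:R * Q ^+ 2) `^ z by exact: powR_ge0.
have [A [[sA AF D5 G5] opt5 E5]] :=
  greedy_spec eps valid z1 A0F fA hT V0 gap Dge0 optV D4 F4 (erefl V) K4 hA0.
set s5 := den greedy s4 in D5 G5 E5 *.
have fF : f \in facilities I by apply: (subsetP A0F).
have e5 : rv s5 rE 0 = resolution by do 3 (rewrite rv_den_free //).
have V5 : rv s5 rLow 0 = V by rewrite rv_den_free.
have W5 : rv s5 rW 0 = total_weight I by do 3 (rewrite rv_den_free //).
have U5 : rv s5 rUp 0 = robust_cost z A0 by rewrite rv_den_free.
have [N [hN netN]] := build_net_spec z eps valid D5 E5 fF (ltW resolution_gt0) e5 V5 W5 U5.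
exists A0, A, N, f, (rv s5 rU 0), V; split; first exact: hN.
split=> //.
- by split=> //; [exact: (subsetP sA)|exact: (robust_cost_anti valid)].
- by move=> Y fY; split; [exact: opt5|exact: optV].
- have [Y fY sY] := extend_feasible valid z1 A0F hA0.
  by exists Y => //; exact: (robust_cost_anti valid).
Qed.

Lemma net_solution (Q : R) (T : nat) A0 A N f (u V : R) : prepared Q T A0 A N f u V ->
  exists Y0 (g : 'I_(npts I) -> 'I_(npts I)), [/\ feasible Y0, forall y, g y \in N &
    forall Y, feasible Y -> robust_cost z (g @: Y0) <= (1 + eps) * robust_cost z Y].
Proof.
move=> [[uN fN NF cov _] [fA AF hA V0] opt [Y1 fY1 hY1] _].
set U := robust_cost z A0 in cov hA hY1.
pose P Y := (Y \subset facilities I) && (#|Y| == ncenters I).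
have PE Y : feasible Y <-> P Y.
  by split=> [[h1 h2]|/andP[h1 /eqP h2]]; [rewrite /P h1 h2 eqxx|].
have [Y0 fY0 minY] : exists2 Y0 : {set 'I_(npts I)}, feasible Y0 &
    forall Y, feasible Y -> robust_cost z Y0 <= robust_cost z Y.
  have PY1 : P Y1 by apply/PE.
  case: (arg_minP (robust_cost z) PY1) => Y0 PY0 min.
  by exists Y0 => [|Y /PE /min]; [apply/PE|].
(* A center that serves no client may be uncovered; [find] then returns the length of [N] and [nth]
   the default [f], which does no harm. *)
pose g y := nth f N (find (covered z (dist_to_set A) resolution V y) N).
have gN y : g y \in N.
  rewrite /g; have [h|h] := ltnP (find (covered z (dist_to_set A) resolution V y) N) (size N).
    exact: mem_nth.
  by rewrite nth_default.
exists Y0, g; split=> // Y fY.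
have A_neq0 : A != set0 by apply/set0Pn; exists f.
have Y0_neq0 := feasible_neq0 valid fY0.
have X_neq0 : g @: Y0 != set0.
  by have [y yY] := set0Pn _ Y0_neq0; apply/set0Pn; exists (g y); exact: imset_f.
have e01 : 0 < resolution <= 1 by rewrite resolution_gt0 resolution_le1.
have [o1 o2] := opt _ fY0.
have H : robust_cost z (g @: Y0) <= (1 + 6 * (resolution * 4 `^ z)) * robust_cost z Y0.
  apply: (snap_cost valid z1 A_neq0 X_neq0 fY0 e01 V0 o1 o2) => p pC.
  have [y yY Ey] := dist_ex p Y0_neq0; exists y => //; exists (g y); first exact: imset_f.
  apply: nth_find; apply: cov => //; first exact: (subsetP fY0.1).
  apply/existsP; exists p; rewrite pC -Ey.
  by apply: le_trans (client_cost_le z valid Y0 pC) (le_trans (minY _ fY1) hY1).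
apply: le_trans H _; apply: ler_pM; rewrite ?robust_cost_ge0 ?minY //.
  by rewrite addr_ge0 // mulr_ge0 // mulr_ge0 ?powR_ge0 // ltW // resolution_gt0.
by rewrite lerD2l resolution_error.
Qed.

Lemma tuple_solution N f Y0 (g : 'I_(npts I) -> 'I_(npts I)) : feasible Y0 ->
  (forall y, g y \in N) ->
  exists t, (t < size N ^ ncenters I)%N /\
    robust_cost z (tuple_set f N t) <= robust_cost z (g @: Y0).
Proof.
move=> fY0 gN; pose h j := index (g (nth f (enum Y0) j)) N.
have [|t [ht dt]] := @digits_exist (size N) h (ncenters I).
  by move=> j _; rewrite index_mem.
exists t; split=> //.
have Y0_neq0 := feasible_neq0 valid fY0.
apply: (robust_cost_anti valid z1).
  by have [y yY] := set0Pn _ Y0_neq0; apply/set0Pn; exists (g y); exact: imset_f.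
apply/subsetP => _ /imsetP[y yY ->].
have yE : y \in enum Y0 by rewrite mem_enum.
have hj : (index y (enum Y0) < ncenters I)%N by rewrite -fY0.2 cardE index_mem.
apply/imsetP; exists (Ordinal hj) => //=.
by rewrite /tuple_point dt // /h !nth_index.
Qed.

(** If [2^(c d) < 2], every cover is a single ball. Halving twice puts all points within a quarter
    of the diameter of one point, which is impossible for a positive diameter. The case is split off
    because [count_bound] assumes [1 <= c d]. *)
Lemma small_dimension (c d : R) : has_doubling_dimension I c d -> c * d < 1 -> (npts I <= 1)%N.
Proof.
move=> doubling cd; rewrite leqNgt; apply/negP => n2.
pose a : 'I_(npts I) := Ordinal (ltnW n2); pose b : 'I_(npts I) := Ordinal n2.
have [[x y] _ max] := @arg_maxP _ R _ (a, b) predT (fun e => delta e.1 e.2) isT.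
have r0 : 0 < delta x y.
  by apply: lt_le_trans (max (a, b) isT); apply: (delta_gt0 valid).
have one (w : 'I_(npts I)) (r : R) : 0 < r -> (forall v : 'I_(npts I), delta w v <= r) ->
    exists u : 'I_(npts I), forall v : 'I_(npts I), delta u v <= r / 2.
  move=> hr hw; have [Y [hY cY]] := doubling w r hr.
  have Y1 : (#|Y| <= 1)%N.
    rewrite -ltnS -(ltr_nat R); apply: le_lt_trans hY _.
    by rewrite -[ltRHS](powRr1 (_ : 0 <= 2)) // /powR pnatr_eq0 /= ltr_expR ltr_pM2r ?mul1r // ln_gt0 // ltr1n.
  have [u uY _] := cY w (hw w); exists u => v.
  have [u' u'Y h] := cY v (hw v).
  by move/card_le1_eqP: Y1 => /(_ u u' uY u'Y) <-.
have [u hu] : exists u : 'I_(npts I), forall v : 'I_(npts I), delta u v <= delta x y / 2.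
  by apply: (one x) => // v; apply: (max (x, v)).
have [w hw] := one u _ (divr_gt0 r0 (ltr0Sn _ 1)) hu.
have := delta_triangle valid x w y; have := hw x; have := hw y.
by rewrite (delta_sym valid w x); lra.
Qed.

Lemma net_size (c d : R) (K e : nat) (Q := (K * #|clients I| ^ e)%N)
    (T := (2 * ncenters I * up_log 2 (2 * ngroups I))%N) A0 A N f (u V : R) :
  (0 < K)%N -> clients I != set0 -> 0 <= c * d -> has_doubling_dimension I c d ->
  weight_aspect_ratio I <= Q%:R -> prepared Q%:R T A0 A N f u V ->
  exists t g, [/\ 2 ^+ t <= 8 / resolution,
    2 ^+ g <= (8 * #|clients I| * Q ^ 2)%:R `^ z :> R &
    (size N)%:R <= (ncenters I + g.+1 * T)%:R *
      (up_log 2 (2 * (8 * #|clients I| * Q ^ 2) * (#|clients I| * Q))).+1%:R *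
      (2 `^ (c * d)) ^+ t].
Proof.
move=> K0 C0 cd0 doubling hw [[uN fN NF _ [rel sep]] [fA AF hA V0] _ _ [gap hG]].
have n0 : (0 < #|clients I|)%N by rewrite card_gt0.
have Q0 : (0 < Q)%N by rewrite muln_gt0 K0 expn_gt0 n0.
pose D := (8 * #|clients I| * Q ^ 2)%N.
have Dpos : (0 < D)%N by rewrite 2!muln_gt0 n0 expn_gt0 Q0.
have DE : 8 * #|clients I|%:R * Q%:R ^+ 2 = D%:R :> R by rewrite /D !natrM natrX.
have D1 : 1 <= D%:R :> R by rewrite ler1n.
have Q1 : 1 <= Q%:R :> R by rewrite ler1n.
rewrite DE in gap hG.
have e0 := resolution_gt0.
have e4 : 1 <= 4 / resolution.
  by rewrite ler_pdivlMr // mul1r; have := resolution_le1; lra.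
(* The lower bound on [2^t] makes the covering balls fine enough for the net, the upper one limits
   their number. *)
have [t /andP[t1 t2]] := exists_halvings e4.
have Dz : 1 <= D%:R `^ z by apply: le_trans D1 (le1r_powR D1 z1).
have [g [cA hg]] := greedy_card hG Dz.
exists t, g; split=> //; first by rewrite mulrA -natrM in t2.
have A_neq0 : A != set0 by apply/set0Pn; exists f.
set S := up_log _ _.
have hS : 2 * D%:R * (#|clients I|%:R * Q%:R) <= 2 ^+ S :> R.
  by rewrite -!natrM -natrX ler_nat; apply: up_logP.
have -> : size N = #|[set x in N]| by rewrite cardsE; apply/esym/card_uniqP.
apply: le_trans (facility_net_card valid z1 doubling (N := [set x in N])
  A_neq0 e0 t1 Q1 D1 cd0 hA V0 gap hw hS _ _) _.
- move=> x; rewrite inE => /rel[->|/existsP[p /andP[pC h]]]; [by left|right].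
  by exists p.
- by move=> x y; rewrite !inE; exact: sep.
by rewrite ler_wpM2r ?exprn_ge0 ?powR_ge0 // ler_wpM2r // ler_nat.
Qed.

Lemma aspect_ratios_le (q : {poly R}) (K e : nat) (n := #|clients I|) :
  (0 < K)%N -> (forall j : nat, (0 < j)%N -> q.[j%:R] <= (K * j ^ e)%:R) ->
  weight_aspect_ratio I <= q.[n%:R] -> distance_aspect_ratio I <= q.[n%:R] ->
  clients I != set0 ->
  weight_aspect_ratio I <= (K * n ^ e)%:R /\ distance_aspect_ratio I <= (K * n ^ e)%:R.
Proof.
move=> K0 hq hw hd; rewrite -card_gt0 => /hq h.
by split; [apply: le_trans hw h|apply: le_trans hd h].
Qed.

Lemma no_client_ratios : clients I = set0 ->
  weight_aspect_ratio I = 0 /\ distance_aspect_ratio I = 0.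
Proof.
move=> C0; rewrite /weight_aspect_ratio /distance_aspect_ratio C0.
have -> : setX set0 set0 = set0 :> {set 'I_(npts I) * 'I_(npts I)}.
  by apply/setP => x; rewrite !inE.
by rewrite /maxover !big_set0 !mul0r.
Qed.

Lemma single_net A N f (V U : R) : is_net z A resolution V U f N (npts I) ->
  clients I = set0 -> (size N <= 1)%N.
Proof.
move=> [uN _ _ _ [rel _]] C0; apply: (uniq_leq_size (s2 := [:: f]) uN) => x /rel[->|].
  by rewrite inE.
by case/existsP=> p; rewrite C0 inE.
Qed.

Lemma program_spec (Q : R) (T B : nat) A0 A N f (u V : R) :
  (npts I <= B)%N -> (ngroups I <= B)%N -> (ncenters I <= B)%N ->
  net_is f N (den prepare (init_state R)) -> prepared Q T A0 A N f u V ->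
  exists s t, [/\ exec I z eps clustering_program (init_state R) s t,
    approx_solution z eps (output_set (npts I) s) &
    (t <= time_bound B prepare + (size N ^ ncenters I * (time_bound B try_tuple).+1 + 1
            + time_bound B write_output))%N].
Proof.
move=> hP hG hC hN hprep; have [[uN fN NF _ _] _ _ _ _] := hprep.
have [w1 w2 w3] : [/\ wf_loops prepare, wf_loops try_tuple & wf_loops write_output] by [].
have [t1 [ex1 le1]] := exec_compile z eps (init_state R) hP hG hC w1.
set s1 := den prepare (init_state R) in hN ex1.
have L0 : (0 < size N ^ ncenters I)%N.
  by rewrite expn_gt0; case: (N) fN.
have inv0 : enum_inv z f N (size N ^ ncenters I - size N ^ ncenters I) s1.
  rewrite subnn; split=> //.
  - by move=> j hj; rewrite nv_den_free // /digit div0n mod0n.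
  - by left; rewrite nv_den_free.
  - by rewrite nv_den_free // eq_sym (gtn_eqF L0).
  - by move=> x hx; rewrite nmem_den_free.
have [s2 [t2 [ex2 inv2 le2]]] :=
  exec_enumeration eps valid fN hP hG hC (leqnn _) inv0.
have [t3 [ex3 le3]] := exec_compile z eps s2 hP hG hC w3.
exists (den write_output s2), (t1 + (t2 + t3))%N; split.
- exact: ExecSeq ex1 (ExecSeq ex2 ex3).
- have [_ _ best _ ho] := inv2.
  case: best => [[E _]|[_ [b [b1 _ b3]]]]; first by rewrite E in L0.
  have ptF j : tuple_point f N b j \in facilities I by apply: NF; exact: tuple_point_in.
  have [fO sO] := write_output_spec z eps valid b1 ptF ho.
  split=> // Y fY.
  have [Y0 [g [fY0 gN opt]]] := net_solution hprep.
  have [t [ht ct]] := tuple_solution f fY0 gN.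
  have tuple_neq0 : tuple_set f N b != set0.
    have k0 : (0 < ncenters I)%N by case: valid => _ _ _ _ /andP[].
    by apply/set0Pn; exists (tuple_point f N b (Ordinal k0)); exact: imset_f.
  apply: le_trans (robust_cost_anti valid z1 tuple_neq0 sO) _.
  exact: le_trans (b3 t ht) (le_trans ct (opt Y fY)).
- by rewrite !leq_add.
Qed.

End Correctness.

Theorem theorem1p3 (R : realType) (c : R) (q : {poly R}) (hc : 0 < c) :
  exists (alg : program) (C D : nat),
    forall (z eps d : R) (I : clustering_input R),
      1 <= z -> 0 < eps -> 0 <= d ->
      valid_input I ->
      has_doubling_dimension I c d ->
      weight_aspect_ratio I <= q.[#|clients I|%:R] ->
      distance_aspect_ratio I <= q.[#|clients I|%:R] ->
      exists (s : state R) (t : nat),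
        [/\ exec I z eps alg (init_state R) s t,
            approx_solution z eps (output_set (npts I) s) &
            t%:R <= f_bound C (ncenters I) d eps z *
                    (D * (ngroups I + #|clients I| + #|facilities I|) ^ D)%:R].
Proof.
have [K [e [K0 hq]]] := poly_bound q.
have [C [D0 hD0]] := count_bound e hc K0.
have [K1 [a1 T1]] := time_bound_poly prepare.
have [K2 [a2 T2]] := time_bound_poly try_tuple.
have [K3 [a3 T3]] := time_bound_poly write_output.
pose Kt := (K1 + K2 + K3 + 2)%N; pose a := (a1 + a2 + a3)%N.
(* [Kt * B ^ a] will bound the time per tuple, the other parts included, and [D0.+1 * B ^ D0] the
   polynomial factor in the number of tuples; the exhibited constant exceeds the product of the
   coefficients and the sum of the degrees. *)
exists clustering_program, C, (Kt * D0.+1 + a + D0)%N.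
move=> z eps d I z1 eps0 d0 valid doubling hw hd.
set B := (ngroups I + #|clients I| + #|facilities I|)%N.
have [k0 kF] : (0 < ncenters I)%N /\ (ncenters I <= #|facilities I|)%N.
  by case: valid => _ _ _ _ /andP[].
have hP : (npts I <= B)%N.
  have <- : #|clients I :|: facilities I| = npts I.
    by case: valid => -> _ _ _ _; rewrite cardsT card_ord.
  by rewrite (leq_trans (leq_card_setU _ _)) // /B -addnA leq_addl.
have hG : (ngroups I <= B)%N by rewrite /B -addnA leq_addr.
have hC : (ncenters I <= B)%N by rewrite (leq_trans kF) // leq_addl.
have B0 : (0 < B)%N by apply: leq_trans hC.
pose n := #|clients I|.
(* The maximum with 1 keeps [Q] positive when there are no clients. *)
pose Q := (K * maxn 1 n ^ e)%N.
have Q1 : 1 <= Q%:R :> R by rewrite ler1n muln_gt0 K0 expn_gt0 leq_max.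
have [hwQ hdQ] : weight_aspect_ratio I <= Q%:R /\ distance_aspect_ratio I <= Q%:R.
  have [C0|C0] := eqVneq (clients I) set0.
    by have [-> ->] := no_client_ratios C0; rewrite !ler0n.
  have n0 : (0 < n)%N by rewrite card_gt0.
  rewrite /Q (maxn_idPr n0); exact: aspect_ratios_le hw hd C0.
pose l := up_log 2 (2 * ngroups I); pose T := (2 * ncenters I * l)%N.
have hT : (1 - (2 * (ncenters I)%:R)^-1 : R) ^+ T * (2 * (ngroups I)%:R) <= 1.
  by apply: rate_exp => //; apply: up_logP.
have [A0 [A [N [f [u [V [hN hprep]]]]]]] :=
  prepare_spec valid z1 eps0 (init_state R) Q1 hwQ hdQ hT.
have [s [t [ex approx ht]]] := program_spec valid z1 eps0 hP hG hC hN hprep.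
exists s, t; split=> //.
have f1 : 1 <= f_bound C (ncenters I) d eps z by apply: f_bound_ge1.
have [netN [fA _ _ _] _ _ _] := hprep; have [uN fN _ _ _] := netN.
have hL : (size N ^ ncenters I)%:R <= f_bound C (ncenters I) d eps z * (D0.+1 * B ^ D0)%:R.
  (* This serves two degenerate cases: without clients no facility is relevant, and for [c d < 1]
     there is only one point. *)
  have one : (size N <= 1)%N ->
      (size N ^ ncenters I)%:R <= f_bound C (ncenters I) d eps z * (D0.+1 * B ^ D0)%:R.
    move=> h; apply: (@le_trans _ _ 1).
      by rewrite lern1 -[leqRHS](exp1n (ncenters I)) leq_exp2r.
    by rewrite mulr_ege1 // ler1n muln_gt0 expn_gt0 B0.
  have [C0|C0] := eqVneq (clients I) set0; first exact: one (single_net netN C0).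
  have [cd|cd] := ltP (c * d) 1.
    apply: one; rewrite (leq_trans _ (small_dimension valid doubling cd)) //.
    by rewrite -(card_uniqP uN) (leq_trans (max_card _)) // card_ord.
  have n0 : (0 < n)%N by rewrite card_gt0.
  have m0 : (0 < ngroups I)%N.
    have [p pC] := set0Pn _ C0; have [i _] := client_group valid pC.
    exact: leq_ltn_trans (leq0n i) (ltn_ord i).
  have QE : Q = (K * n ^ e)%N by rewrite /Q (maxn_idPr n0).
  rewrite QE in hwQ hprep.
  have [t0 [g [h1 h2 h3]]] := net_size valid z1 eps0 K0 C0 (le_trans ler01 cd) doubling hwQ hprep.
  have h := hD0 z eps d _ n _ t0 g (size N) z1 eps0 d0 cd k0 n0 m0 h1 h2 h3.
  apply: le_trans h _; rewrite ler_wpM2l ?(le_trans ler01 f1) // ler_nat leq_mul //.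
  have [->|D0pos] := posnP D0; first by rewrite !expn0.
  by rewrite leq_exp2r // leq_addr.
have tB : (t <= Kt * B ^ a * size N ^ ncenters I)%N.
  apply: leq_trans ht _.
  have L0 : (0 < size N ^ ncenters I)%N by rewrite expn_gt0; case: (N) fN.
  have Ba j : (j <= a)%N -> (B ^ j <= B ^ a)%N by move=> h; rewrite leq_pexp2l.
  have b1 : (time_bound B prepare <= K1 * B ^ a)%N.
    by rewrite (leq_trans (T1 B B0)) // leq_mul // Ba // /a -addnA leq_addr.
  have b2 : (time_bound B try_tuple <= K2 * B ^ a)%N.
    by rewrite (leq_trans (T2 B B0)) // leq_mul // Ba // /a -addnA addnCA leq_addr.
  have b3 : (time_bound B write_output <= K3 * B ^ a)%N.
    by rewrite (leq_trans (T3 B B0)) // leq_mul // Ba // /a leq_addl.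
  have b0 : (0 < B ^ a)%N by rewrite expn_gt0 B0.
  move: b0 b1 b2 b3 L0; rewrite /Kt; move: (B ^ a)%N (size N ^ ncenters I)%N => x y.
  move: (time_bound B prepare) (time_bound B try_tuple) (time_bound B write_output).
  clear; move=> p1 p2 p3 x0 b1 b2 b3 y0; nia.
apply: (@le_trans _ _ ((Kt * B ^ a)%:R * (size N ^ ncenters I)%:R)).
  by rewrite -natrM ler_nat.
apply: le_trans (ler_wpM2l (ler0n _ _) hL) _.
rewrite mulrCA ler_wpM2l ?(le_trans ler01 f1) // -natrM ler_nat.
rewrite mulnACA -expnD leq_mul //; first by rewrite -addnA leq_addr.
by rewrite leq_pexp2l // -addnA leq_addl.
Qed.
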